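(* Let $n\ge 1$ be a natural number. In the theory A0 + A1 + A2 + A4 + B7a($n+1$) (listed in the context), every weakly $(n+1)$-reflective cardinal is $n$-ineffable in $\mathrm{HOD}$.
   Context: The language is set theory with an additional unary predicate $R$; here $R(\kappa)$ is read ''$\kappa$ is weakly $(n+1)$-reflective''. The axioms are: A0. ZFC (separation and replacement for formulas not mentioning $R$). A1. $\forall x \exists y \forall z\,(z \in y \Leftrightarrow z \in x \wedge R(z))$. A2. $\forall a\,(R(a) \Rightarrow a \text{ is an ordinal})$. A4. $R$ holds of a proper class of ordinals. B7a($n+1$). An ordinal $a$ satisfies $R(a)$ iff for all $a_1,\dots,a_{n+2}$ with $R(a_i)$ for all $i$ and $a\le a_1<a_2<\dots<a_{n+2}$, the theory of $(V_{a_{n+2}},\in,a,a_2,\dots,a_{n+1})$ with parameters in $V_a$ agrees with the theory of $(V_{a_{n+2}},\in,a_1,a_2,\dots,a_{n+1})$ with parameters in $V_a$. For an ordinal $\kappa$, a function $f:[\kappa]^n\to P(\kappa)$ is regressive if $f(x)\subset\min(x)$ for all $x\in[\kappa]^n$; a set $H\subset\kappa$ is $f$-homogeneous if $f(x)\cap\min(x\cup y)=f(y)\cap\min(x\cup y)$ for all $x,y\in[H]^n$. A cardinal $\kappa$ is $n$-ineffable if every regressive $f:[\kappa]^n\to P(\kappa)$ has an $f$-homogeneous stationary set $H\subset\kappa$. ''In HOD'' means relativized to the class of hereditarily ordinal definable sets of $(V,\in)$. *)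

(* Defs.v *)
(* Rocq standard library only.  Theories are read semantically: a statement
   "in the theory T" is a statement about an arbitrary structure (U, E, R)
   satisfying T.  Everything below is first-order over (U, E): the formulas
   whose truth is compared in the reflection axiom, or used in the definition
   of HOD, are coded by elements of U (there may be nonstandard ones), while
   [form] is the type of external formulas used for the schemas of ZFC. *)
From Stdlib Require Import List Sorted.
Import ListNotations.

Set Implicit Arguments.

(* External formulas of the language of set theory, with de Bruijn indices. *)
Inductive form : Type :=
| FMem (i j : nat)
| FEq (i j : nat)
| FNot (p : form)
| FAnd (p q : form)
| FEx (p : form).

Definition scons (T : Type) (x : T) (e : nat -> T) (i : nat) : T :=
  match i with O => x | S j => e j end.

Section Structure.

Variables (U : Type) (E : U -> U -> Prop).
Local Notation "x ∈ y" := (E x y) (at level 70).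

Fixpoint holds (e : nat -> U) (p : form) : Prop :=
  match p with
  | FMem i j => e i ∈ e j
  | FEq i j => e i = e j
  | FNot p => ~ holds e p
  | FAnd p q => holds e p /\ holds e q
  | FEx p => exists x, holds (scons x e) p
  end.

(** * Basic set theory *)

Definition subset (x y : U) : Prop := forall z, z ∈ x -> z ∈ y.

Definition is_empty (x : U) : Prop := forall z, ~ z ∈ x.

Definition is_upair (p x y : U) : Prop := forall z, z ∈ p <-> z = x \/ z = y.

Definition is_pair (p x y : U) : Prop :=
  exists u v, is_upair u x x /\ is_upair v x y /\ is_upair p u v.

Definition is_succ (y x : U) : Prop := forall z, z ∈ y <-> z ∈ x \/ z = x.

Definition transitive (x : U) : Prop := forall y, y ∈ x -> subset y x.

Definition ordinal (a : U) : Prop :=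
  transitive a /\
  (forall x y, x ∈ a -> y ∈ a -> x ∈ y \/ x = y \/ y ∈ x) /\
  (forall s, subset s a -> ~ is_empty s ->
     exists m, m ∈ s /\ forall z, z ∈ s -> ~ z ∈ m).

(* Natural numbers in the sense of the structure. *)
Definition is_nat (k : U) : Prop :=
  ordinal k /\
  forall j, j ∈ k \/ j = k -> is_empty j \/ exists i, is_succ j i.

Fixpoint is_numeral (n : nat) (x : U) : Prop :=
  match n with
  | O => is_empty x
  | S m => exists y, is_numeral m y /\ is_succ x y
  end.

(* The ordered pair of x and y belongs to f. *)
Definition maps (f x y : U) : Prop := exists p, is_pair p x y /\ p ∈ f.

(* f is a set, and a function from the class A to the class B. *)
Definition is_fun (f : U) (A B : U -> Prop) : Prop :=
  (forall p, p ∈ f -> exists x y, A x /\ B y /\ is_pair p x y) /\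
  (forall x, A x -> exists! y, maps f x y).

(* v = V_a, where V_b is the union of the power sets of the V_c for c < b. *)
Definition is_V (a v : U) : Prop :=
  ordinal a /\
  exists f,
    is_fun f (fun b => b ∈ a \/ b = a) (fun _ => True) /\
    (forall b w, maps f b w ->
       forall x, x ∈ w <-> exists c u, c ∈ b /\ maps f c u /\ subset x u) /\
    maps f a v.

(** * Coded formulas and satisfaction

   Coded terms: (0, i) is the variable v_i and (1, j) the j-th constant symbol.
   Coded formulas: (0, (t, u)) is t ∈ u, (1, (t, u)) is t = u, (2, p) is ¬ p,
   (3, (p, q)) is p ∧ q and (4, p) is an existential quantification.
   Formulas are considered in a context m, their free variables being among
   v_0, ..., v_(m-1); the quantifier of (4, p) in context m binds v_m, so that
   p is then a formula in context m + 1.  An assignment for a formula in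
   context m is a finite sequence of length m. *)

Definition code1 (k : nat) (c x : U) : Prop :=
  exists t, is_numeral k t /\ is_pair c t x.

Definition code2 (k : nat) (c x y : U) : Prop :=
  exists q, is_pair q x y /\ code1 k c q.

Definition is_term (k : nat) (m t : U) : Prop :=
  (exists i, i ∈ m /\ code1 0 t i) \/
  (exists j x, j < k /\ is_numeral j x /\ code1 1 t x).

Definition formula_closed (k : nat) (F : U) : Prop :=
  forall m, is_nat m ->
    (forall t u c, is_term k m t -> is_term k m u -> code2 0 c t u ->
       maps F m c) /\
    (forall t u c, is_term k m t -> is_term k m u -> code2 1 c t u ->
       maps F m c) /\
    (forall p c, maps F m p -> code1 2 c p -> maps F m c) /\
    (forall p q c, maps F m p -> maps F m q -> code2 3 c p q -> maps F m c) /\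
    (forall p c m', is_succ m' m -> maps F m' p -> code1 4 c p -> maps F m c).

(* c codes a formula in context m with constant symbols 0, ..., k-1. *)
Definition is_formula (k : nat) (m c : U) : Prop :=
  is_nat m /\ forall F, formula_closed k F -> maps F m c.

(* x is the value of the term t under the assignment s. *)
Definition term_val (cs : list U) (s t x : U) : Prop :=
  (exists i, code1 0 t i /\ maps s i x) \/
  (exists j z, is_numeral j z /\ code1 1 t z /\ nth_error cs j = Some x).

(* s' is the sequence s of length m, followed by x. *)
Definition is_snoc (s' s m x : U) : Prop :=
  forall p, p ∈ s' <-> p ∈ s \/ is_pair p m x.

(* The set S of pairs (formula, assignment) obeys Tarski's clauses for the
   structure (A, ∈, cs). *)
Definition tarski (A : U) (cs : list U) (S : U) : Prop :=
  let k := length cs in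
  forall m s, is_nat m -> is_fun s (fun i => i ∈ m) (fun x => x ∈ A) ->
    (forall t u c, is_term k m t -> is_term k m u -> code2 0 c t u ->
       (maps S c s <->
        exists x y, term_val cs s t x /\ term_val cs s u y /\ x ∈ y)) /\
    (forall t u c, is_term k m t -> is_term k m u -> code2 1 c t u ->
       (maps S c s <->
        exists x y, term_val cs s t x /\ term_val cs s u y /\ x = y)) /\
    (forall p c, is_formula k m p -> code1 2 c p ->
       (maps S c s <-> ~ maps S p s)) /\
    (forall p q c, is_formula k m p -> is_formula k m q -> code2 3 c p q ->
       (maps S c s <-> maps S p s /\ maps S q s)) /\
    (forall p c m', is_succ m' m -> is_formula k m' p -> code1 4 c p ->
       (maps S c s <->
        exists x s', x ∈ A /\ is_snoc s' s m x /\ maps S p s')).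

Definition satisfies (A : U) (cs : list U) (c s : U) : Prop :=
  exists S, tarski A cs S /\ maps S c s.

(* The theories of (A, ∈, cs) and (A, ∈, ds) with parameters in P agree. *)
Definition same_theory (A : U) (cs ds : list U) (P : U) : Prop :=
  forall m c s, is_formula (length cs) m c ->
    is_fun s (fun i => i ∈ m) (fun x => x ∈ P) ->
    (satisfies A cs c s <-> satisfies A ds c s).

(** * Ordinal definability *)

(* x is the only element of some V_b satisfying in (V_b, ∈) some formula with
   finitely many ordinal parameters below b. *)
Definition OD (x : U) : Prop :=
  exists b A m m' c s,
    is_V b A /\ x ∈ A /\
    is_fun s (fun i => i ∈ m) (fun y => y ∈ b) /\
    is_succ m' m /\ is_formula 0 m' c /\
    (forall y s', y ∈ A -> is_snoc s' s m y -> (satisfies A [] c s' <-> y = x)).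

(* The elements of the transitive closure of {x} are ordinal definable. *)
Definition HOD (x : U) : Prop :=
  forall y, (forall t, transitive t -> x ∈ t -> y ∈ t) -> OD y.

(** * Ineffability *)

Definition cardinal (a : U) : Prop :=
  ordinal a /\
  ~ exists b f,
      b ∈ a /\ is_fun f (fun x => x ∈ b) (fun y => y ∈ a) /\
      (forall x x' y, maps f x y -> maps f x' y -> x = x') /\
      (forall y, y ∈ a -> exists x, maps f x y).

Definition is_min (A : U -> Prop) (m : U) : Prop :=
  A m /\ forall z, A z -> m = z \/ m ∈ z.

Definition club (a C : U) : Prop :=
  subset C a /\
  (forall x, x ∈ a -> exists y, y ∈ C /\ x ∈ y) /\
  (forall l, l ∈ a -> ~ is_empty l ->
     (forall x, x ∈ l -> exists y, y ∈ C /\ y ∈ l /\ x ∈ y) -> l ∈ C).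

Definition stationary (a H : U) : Prop :=
  subset H a /\ forall C, club a C -> exists z, z ∈ C /\ z ∈ H.

(* x is an n-element subset of a. *)
Definition n_subset (n : nat) (a x : U) : Prop :=
  subset x a /\
  exists l : list U, NoDup l /\ length l = n /\ forall z, z ∈ x <-> In z l.

Definition regressive (n : nat) (a f : U) : Prop :=
  is_fun f (n_subset n a) (fun y => subset y a) /\
  forall x y m, maps f x y -> is_min (fun z => z ∈ x) m -> subset y m.

Definition homogeneous (n : nat) (f H : U) : Prop :=
  forall x y u v m,
    n_subset n H x -> n_subset n H y -> maps f x u -> maps f y v ->
    is_min (fun z => z ∈ x \/ z ∈ y) m ->
    forall z, z ∈ u /\ z ∈ m <-> z ∈ v /\ z ∈ m.

Definition ineffable (n : nat) (a : U) : Prop :=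
  cardinal a /\
  forall f, regressive n a f -> exists H, stationary a H /\ homogeneous n f H.

(** * Axioms *)

Record ZFC : Prop := {
  zfc_extensionality :
    forall x y, (forall z, z ∈ x <-> z ∈ y) -> x = y;
  zfc_foundation :
    forall x, ~ is_empty x -> exists y, y ∈ x /\ forall z, z ∈ x -> ~ z ∈ y;
  zfc_pairing :
    forall x y, exists p, is_upair p x y;
  zfc_union :
    forall x, exists u, forall z, z ∈ u <-> exists y, y ∈ x /\ z ∈ y;
  zfc_power :
    forall x, exists p, forall z, z ∈ p <-> subset z x;
  zfc_infinity :
    exists w, (exists x, is_empty x /\ x ∈ w) /\
      forall x, x ∈ w -> exists y, is_succ y x /\ y ∈ w;
  zfc_separation :
    forall (p : form) (e : nat -> U) x,
      exists y, forall z, z ∈ y <-> z ∈ x /\ holds (scons z e) p;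
  zfc_replacement :
    forall (p : form) (e : nat -> U) a,
      (forall x, x ∈ a -> exists! y, holds (scons x (scons y e)) p) ->
      exists b, forall y,
        y ∈ b <-> exists x, x ∈ a /\ holds (scons x (scons y e)) p;
  zfc_choice :
    forall x, (forall y, y ∈ x -> ~ is_empty y) ->
      (forall y y' z, y ∈ x -> y' ∈ x -> z ∈ y -> z ∈ y' -> y = y') ->
      exists c, forall y, y ∈ x -> exists! z, z ∈ y /\ z ∈ c
}.

Variable R : U -> Prop.

Definition A1 : Prop := forall x, exists y, forall z, z ∈ y <-> z ∈ x /\ R z.

Definition A2 : Prop := forall a, R a -> ordinal a.

Definition A4 : Prop := ~ exists x, forall z, z ∈ x <-> R z.

(* The list a1 :: l ++ [b] is a_1 < ... < a_(k+1); thus b = a_(k+1) and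
   l = [a_2; ...; a_k]. *)
Definition B7a (k : nat) : Prop :=
  forall a, ordinal a ->
    (R a <->
     forall a1 l b Va Vb,
       length (a1 :: l) = k ->
       Forall R (a1 :: l ++ [b]) ->
       (a = a1 \/ a ∈ a1) ->
       StronglySorted E (a1 :: l ++ [b]) ->
       is_V a Va -> is_V b Vb ->
       same_theory Vb (a :: l) (a1 :: l) Va).

(* The theory of weakly k-reflective cardinals: R(a) is read
   "a is weakly k-reflective". *)
Record weakly_reflective_theory (k : nat) : Prop := {
  wrt_A0 : ZFC;
  wrt_A1 : A1;
  wrt_A2 : A2;
  wrt_A4 : A4;
  wrt_B7a : B7a k
}.

End Structure.

(* The membership relation of the substructure with universe D.  Evaluating a
   notion in this substructure is relativizing it to D. *)
Definition restrict (U : Type) (E : U -> U -> Prop) (D : U -> Prop)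
    (x y : {x : U | D x}) : Prop :=
  E (proj1_sig x) (proj1_sig y).

(* Main.v *)
(* If R b holds then V_b is an elementary substructure of the universe, and the
   elements of R above kappa are indiscernible, in tuples of length at most
   n + 1, for external formulas with parameters in V_kappa.  Suppose that kappa
   is not n-ineffable in HOD.  Choose a counterexample f_a uniformly at every
   a >= kappa in R: fix the code of an ordinal definition, which lies in V_kappa,
   and take the least ordinal parameters that make it define a counterexample.
   For kappa <= a_0 < ... < a_n in R let H(a_0, ..., a_n) be the set of all
   al < a_0 such that, for j < n and s of length n - j - 1 below al,
   f_(a_(j+1))(s, a_0, ..., a_j) and f_(a_j)(s, al, a_0, ..., a_(j-1)) agree
   below the elements of s and al.  The arguments from H can be replaced one by
   one, from the largest on, by the a_i, hence H is homogeneous for f_(a_0).  So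
   H is not stationary in HOD, and there is a club D(a_0, ..., a_n) in HOD
   disjoint from it, chosen uniformly as before.  If kappa < a_0, then kappa
   belongs to H(a_0, ..., a_n) by indiscernibility, and to D(a_0, ..., a_n)
   because the latter contains D(kappa, a_0, ..., a_(n-1)), which is unbounded in
   kappa.  This is a contradiction.  In the same way, uniformly chosen surjections
   in HOD from some b < kappa onto each a >= kappa in R would agree on b. *)
From Stdlib Require Import List Sorted Lia PeanoNat .
From Stdlib Require Import Classical ClassicalEpsilon FunctionalExtensionality.
Require Import Defs.
Import ListNotations.

Set Implicit Arguments.

(** * Definability with parameters *)

(** The structure may be ill-founded from outside, and its codes of formulas nonstandard. So every
    induction on its ordinals, its natural numbers or its coded formulas takes place inside it, on a
    predicate that has to be shown definable; hence the definability lemmas that accompany almost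
    every notion. The reflection axiom speaks of coded theories of one level V_b. Applied to the
    relativization of a formula to the level named by the first constant, it shows that V_a is
    elementary in V_a' whenever a < a' are in [R]. These levels exhaust the universe, so the usual
    argument on elementary chains, by induction on external formulas, makes each of them elementary
    in it. The axiom only moves the first entry of a tuple. Whole tuples are compared by moving both
    of them to a third one far above, the last entry first, while the smaller entries serve as
    parameters. Length n + 1 is what the argument requires, as this is the number of ordinals on
    which the set H of the overview depends. *)

Fixpoint ren (r : nat -> nat) (p : form) : form :=
  match p with
  | FMem i j => FMem (r i) (r j)
  | FEq i j => FEq (r i) (r j)
  | FNot p => FNot (ren r p)
  | FAnd p q => FAnd (ren r p) (ren r q)
  | FEx p => FEx (ren (scons 0 (fun i => S (r i))) p)
  end.

(* Even indices are the variables, odd ones the parameters. *)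
Definition mix (T : Type) (e rho : nat -> T) (i : nat) : T :=
  if Nat.even i then e (Nat.div2 i) else rho (Nat.div2 i).

Definition on_even_odd (f g : nat -> nat) (i : nat) : nat :=
  if Nat.even i then f (Nat.div2 i) else g (Nat.div2 i).

Lemma mix_even (T : Type) (e rho : nat -> T) (i : nat) : mix e rho (2 * i) = e i.
Proof. unfold mix. rewrite Nat.even_even, Nat.div2_double. reflexivity. Qed.

Lemma mix_odd (T : Type) (e rho : nat -> T) (i : nat) : mix e rho (S (2 * i)) = rho i.
Proof.
  unfold mix. rewrite Nat.div2_succ_double.
  replace (S (2 * i)) with (2 * i + 1) by lia. rewrite Nat.even_odd. reflexivity.
Qed.

Section Terms.

Variable U : Type.

(** Only variables and constants are terms. Operations such as [pair] or [succ], obtained below by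
    choice, can occur in a definable predicate only through the relations that characterize them. *)
Inductive term (A : U -> Prop) : ((nat -> U) -> U) -> Prop :=
| term_var i : term A (fun e => e i)
| term_const a : A a -> term A (fun _ => a).

Variable A : U -> Prop.

Lemma term_subst (s : nat -> (nat -> U) -> U) (t : (nat -> U) -> U) :
  (forall i, term A (s i)) -> term A t -> term A (fun e => t (fun i => s i e)).
Proof. intros Hs Ht. destruct Ht; [apply Hs | apply term_const; assumption]. Qed.

Lemma term_ren (r : nat -> nat) (t : (nat -> U) -> U) :
  term A t -> term A (fun e => t (fun i => e (r i))).
Proof. intros Ht. destruct Ht; [apply term_var | apply term_const; assumption]. Qed.

End Terms.

Section Definability.

Variables (U : Type) (E : U -> U -> Prop).
Local Notation "x ∈ y" := (E x y) (at level 70).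

Lemma holds_ext (p : form) : forall e e' : nat -> U,
  (forall i, e i = e' i) -> holds E e p <-> holds E e' p.
Proof.
  intros e e' H. replace e' with e by (apply functional_extensionality; exact H).
  reflexivity.
Qed.

Lemma holds_ren (p : form) : forall r (e : nat -> U),
  holds E e (ren r p) <-> holds E (fun i => e (r i)) p.
Proof.
  induction p as [i j | i j | p IH | p IHp q IHq | p IH]; intros r e; simpl.
  - reflexivity.
  - reflexivity.
  - rewrite IH. reflexivity.
  - rewrite IHp, IHq. reflexivity.
  - assert (G : forall x, holds E (scons x e) (ren (scons 0 (fun i => S (r i))) p) <->
      holds E (scons x (fun i => e (r i))) p).
    { intros x. rewrite IH. apply holds_ext. intros [| i]; reflexivity. }
    split; intros [x Hx]; exists x; apply G; exact Hx.
Qed.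

(** A semantic counterpart of [form] with parameters from [A]. Since [Def_ext] closes it under
    equivalence, definability can be checked along the text of a definition, without writing a
    formula. *)
Inductive Def (A : U -> Prop) : ((nat -> U) -> Prop) -> Prop :=
| Def_mem t u : term A t -> term A u -> Def A (fun e => t e ∈ u e)
| Def_eq t u : term A t -> term A u -> Def A (fun e => t e = u e)
| Def_not P : Def A P -> Def A (fun e => ~ P e)
| Def_and P Q : Def A P -> Def A Q -> Def A (fun e => P e /\ Q e)
| Def_ex_scons P : Def A P -> Def A (fun e => exists x, P (scons x e))
| Def_ext P Q : (forall e, P e <-> Q e) -> Def A P -> Def A Q.

Variable A : U -> Prop.

Lemma Def_ex (Q : U -> (nat -> U) -> Prop) :
  Def A (fun e => Q (e 0) (fun i => e (S i))) -> Def A (fun e => exists x, Q x e).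
Proof. intros H. exact (Def_ex_scons H). Qed.

Lemma Def_or (P Q : (nat -> U) -> Prop) :
  Def A P -> Def A Q -> Def A (fun e => P e \/ Q e).
Proof.
  intros HP HQ. apply Def_ext with (fun e => ~ (~ P e /\ ~ Q e)).
  - intros e. tauto.
  - apply Def_not, Def_and; apply Def_not; assumption.
Qed.

Lemma Def_imp (P Q : (nat -> U) -> Prop) :
  Def A P -> Def A Q -> Def A (fun e => P e -> Q e).
Proof.
  intros HP HQ. apply Def_ext with (fun e => ~ (P e /\ ~ Q e)).
  - intros e. tauto.
  - apply Def_not, Def_and; [| apply Def_not]; assumption.
Qed.

Lemma Def_iff (P Q : (nat -> U) -> Prop) :
  Def A P -> Def A Q -> Def A (fun e => P e <-> Q e).
Proof. intros HP HQ. apply Def_and; apply Def_imp; assumption. Qed.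

Lemma Def_all (Q : U -> (nat -> U) -> Prop) :
  Def A (fun e => Q (e 0) (fun i => e (S i))) -> Def A (fun e => forall x, Q x e).
Proof.
  intros H. apply Def_ext with (fun e => ~ exists x, ~ Q x e).
  - intros e. split.
    + intros G x. apply NNPP. intros N. apply G. exists x. exact N.
    + intros G [x N]. apply N, G.
  - apply Def_not, Def_ex, Def_not, H.
Qed.

Lemma Def_true : Def A (fun _ => True).
Proof.
  apply Def_ext with (fun e => e 0 = e 0); [tauto |].
  apply Def_eq; apply term_var.
Qed.

Lemma Def_false : Def A (fun _ => False).
Proof.
  apply Def_ext with (fun _ => ~ True); [tauto | apply Def_not, Def_true].
Qed.

(** A proposition independent of the environment is decided classically, hence equivalent to [True]
    or [False]. *)
Lemma Def_prop (P : Prop) : Def A (fun _ => P).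
Proof.
  destruct (classic P) as [H | H].
  - apply Def_ext with (fun _ => True); [tauto | apply Def_true].
  - apply Def_ext with (fun _ => False); [tauto | apply Def_false].
Qed.

Lemma Def_subst (P : (nat -> U) -> Prop) : Def A P ->
  forall s : nat -> (nat -> U) -> U, (forall i, term A (s i)) ->
  Def A (fun e => P (fun i => s i e)).
Proof.
  intros HP. induction HP as [t u Ht Hu | t u Ht Hu | P HP IH | P Q HP IHP HQ IHQ
    | P HP IH | P Q HPQ HP IH]; intros s Hs.
  - apply Def_mem; apply term_subst; assumption.
  - apply Def_eq; apply term_subst; assumption.
  - apply Def_not, IH, Hs.
  - apply Def_and; [apply IHP | apply IHQ]; exact Hs.
  - apply Def_ex.
    pose (s' := fun i => match i with
      | 0 => fun e : nat -> U => e 0 | S i => fun e => s i (fun j => e (S j)) end).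
    apply Def_ext with (fun e => P (fun i => s' i e)).
    + intros e.
      replace (fun i => s' i e) with (scons (e 0) (fun i => s i (fun j => e (S j))));
        [reflexivity |].
      apply functional_extensionality. intros [| i]; reflexivity.
    + apply IH. intros [| i]; simpl; [apply term_var | apply (term_ren S), Hs].
  - apply Def_ext with (fun e => P (fun i => s i e)); [intros e; apply HPQ | apply IH, Hs].
Qed.

Lemma Def_comp2 (P : U -> U -> Prop) (t u : (nat -> U) -> U) :
  Def A (fun e => P (e 0) (e 1)) -> term A t -> term A u ->
  Def A (fun e => P (t e) (u e)).
Proof.
  intros HP Ht Hu.
  apply (Def_subst HP (fun i => match i with 0 => t | _ => u end)).
  intros [| i]; assumption.
Qed.

(** A formula mentions finitely many parameters, but [rho] gives a value to every odd index; an
    element of [A] serves as default. *)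
Lemma Def_form (P : (nat -> U) -> Prop) : (exists a, A a) -> Def A P ->
  exists p rho, (forall i, A (rho i)) /\ forall e, holds E (mix e rho) p <-> P e.
Proof.
  intros [a0 Ha0] HP.
  assert (HT2 : forall t u, term A t -> term A u -> exists rho i j,
    (forall k, A (rho k)) /\ forall e, mix e rho i = t e /\ mix e rho j = u e).
  { intros t u Ht Hu.
    destruct Ht as [i | a Ha]; destruct Hu as [j | b Hb].
    - exists (fun _ => a0), (2 * i), (2 * j). split; [auto |].
      intros e. split; apply mix_even.
    - exists (fun _ => b), (2 * i), 1. split; [auto |].
      intros e. split; [apply mix_even | reflexivity].
    - exists (fun _ => a), 1, (2 * j). split; [auto |].
      intros e. split; [reflexivity | apply mix_even].
    - exists (scons a (fun _ => b)), 1, 3. split; [intros [| k]; auto |].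
      intros e. split; reflexivity. }
  induction HP as [t u Ht Hu | t u Ht Hu | P HP IH | P Q HP IHP HQ IHQ
    | P HP IH | P Q HPQ HP IH].
  - destruct (HT2 t u Ht Hu) as [rho [i [j [H1 H2]]]].
    exists (FMem i j), rho. split; [exact H1 |].
    intros e. simpl. destruct (H2 e) as [-> ->]. reflexivity.
  - destruct (HT2 t u Ht Hu) as [rho [i [j [H1 H2]]]].
    exists (FEq i j), rho. split; [exact H1 |].
    intros e. simpl. destruct (H2 e) as [-> ->]. reflexivity.
  - destruct IH as [p [rho [H1 H2]]]. exists (FNot p), rho. split; [exact H1 |].
    intros e. simpl. rewrite H2. reflexivity.
  - destruct IHP as [p [r1 [H1 H2]]], IHQ as [q [r2 [H3 H4]]].
    (* The two parameter sequences are interleaved: those of [p] occupy the even places of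
       [mix r1 r2], those of [q] the odd ones. *)
    exists (FAnd (ren (on_even_odd (fun i => 2 * i) (fun i => S (2 * (2 * i)))) p)
      (ren (on_even_odd (fun i => 2 * i) (fun i => S (2 * (S (2 * i))))) q)), (mix r1 r2).
    split.
    + intros i. unfold mix. destruct (Nat.even i); auto.
    + intros e. simpl. rewrite !holds_ren, <- H2, <- H4.
      assert (G1 : holds E (fun i => mix e (mix r1 r2)
        (on_even_odd (fun i => 2 * i) (fun i => S (2 * (2 * i))) i)) p <->
        holds E (mix e r1) p).
      { apply holds_ext. intros i. unfold on_even_odd.
        unfold mix at 3. destruct (Nat.even i).
        - apply mix_even.
        - rewrite mix_odd, mix_even. reflexivity. }
      assert (G2 : holds E (fun i => mix e (mix r1 r2)
        (on_even_odd (fun i => 2 * i) (fun i => S (2 * (S (2 * i)))) i)) q <->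
        holds E (mix e r2) q).
      { apply holds_ext. intros i. unfold on_even_odd.
        unfold mix at 3. destruct (Nat.even i).
        - apply mix_even.
        - rewrite mix_odd, mix_odd. reflexivity. }
      rewrite G1, G2. reflexivity.
  - destruct IH as [p [rho [H1 H2]]].
    (* The bound variable stands at index 0 in front of [mix e rho], so every other index is the one
       in [mix e rho] plus one. *)
    exists (FEx (ren (on_even_odd (fun i => match i with 0 => 0 | S i => S (2 * i) end)
      (fun i => S (S (2 * i)))) p)), rho.
    split; [exact H1 |]. intros e. simpl.
    assert (G : forall x, holds E (scons x (mix e rho)) (ren (on_even_odd
       (fun i => match i with 0 => 0 | S i => S (2 * i) end) (fun i => S (S (2 * i)))) p)
       <-> P (scons x e)).
    { intros x. rewrite holds_ren, <- H2. apply holds_ext. intros i.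
      unfold on_even_odd. unfold mix at 2. destruct (Nat.even i).
      - destruct (Nat.div2 i) as [| k]; [reflexivity |].
        change (mix e rho (2 * k) = e k). apply mix_even.
      - change (mix e rho (S (2 * Nat.div2 i)) = rho (Nat.div2 i)). apply mix_odd. }
    split; intros [x Hx]; exists x; apply G; exact Hx.
  - destruct IH as [p [rho [H1 H2]]]. exists p, rho. split; [exact H1 |].
    intros e. rewrite H2. apply HPQ.
Qed.

End Definability.

Lemma Def_mono (U : Type) (E : U -> U -> Prop) (A B : U -> Prop) (P : (nat -> U) -> Prop) :
  (forall a, A a -> B a) -> Def E A P -> Def E B P.
Proof.
  intros H HP.
  assert (HT : forall t, term A t -> term B t).
  { intros t [i | a Ha]; [apply term_var | apply term_const, H, Ha]. }
  induction HP as [t u Ht Hu | t u Ht Hu | P HP IH | P Q HP IHP HQ IHQ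
    | P HP IH | P Q HPQ HP IH].
  - apply Def_mem; auto.
  - apply Def_eq; auto.
  - apply Def_not; auto.
  - apply Def_and; auto.
  - apply Def_ex_scons; auto.
  - apply Def_ext with P; auto.
Qed.

(* Automation of definability goals *)
Create HintDb dfn discriminated.
#[local] Hint Constants Opaque : dfn.
#[local] Hint Resolve term_var term_ren : dfn.
#[local] Hint Extern 2 (term _ _) => (apply term_const; solve [exact I | assumption]) : dfn.

Ltac dfn_step :=
  cbv beta;
  lazymatch goal with
  | |- Def _ _ (fun e => iff (@?P e) (@?Q e)) => apply (@Def_iff _ _ _ P Q)
  | |- Def _ _ (fun e => and (@?P e) (@?Q e)) => apply (@Def_and _ _ _ P Q)
  | |- Def _ _ (fun e => or (@?P e) (@?Q e)) => apply (@Def_or _ _ _ P Q)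
  | |- Def _ _ (fun e => not (@?P e)) => apply (@Def_not _ _ _ P)
  | |- Def ?E ?A (fun e : nat -> ?U => @ex ?U (@?P e)) =>
      apply (@Def_ex U E A (fun x e => P e x))
  | |- Def _ _ (fun e => @unique _ (@?P e) (@?t e)) => unfold unique
  | |- Def _ _ (fun e => (@?P e) -> (@?Q e)) => apply (@Def_imp _ _ _ P Q)
  | |- Def ?E ?A (fun e : nat -> ?U => forall x : ?U, @?P x e) =>
      apply (@Def_all U E A (fun x e => P x e))
  | |- Def ?E _ (fun e => ?E (@?t e) (@?u e)) =>
      first [apply (@Def_mem _ E _ t u); solve [auto 30 with dfn] | solve [eauto 30 with dfn]]
  | |- Def _ _ (fun e => (@?t e) = (@?u e)) =>
      first [apply (@Def_eq _ _ _ t u); solve [auto 30 with dfn] | solve [eauto 30 with dfn]]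
  | |- Def _ _ _ => first [apply Def_prop | solve [eauto 30 with dfn]]
  end.
Ltac dfn := repeat dfn_step.
Definition everything (U : Type) (_ : U) : Prop := True.

Section Universe.

Variables (U : Type) (E : U -> U -> Prop).
Hypothesis HZ : ZFC E.
Local Notation "x ∈ y" := (E x y) (at level 70).
Local Notation DEF := (Def E (@everything U)).

(** * Set theory in the structure *)

Lemma extensionality (x y : U) : (forall z, z ∈ x <-> z ∈ y) -> x = y.
Proof. apply (zfc_extensionality HZ). Qed.

Lemma separation (P : U -> Prop) : DEF (fun e => P (e 0)) ->
  forall x, exists y, forall z, z ∈ y <-> z ∈ x /\ P z.
Proof.
  intros HP x.
  destruct (Def_form (ex_intro _ x I) HP) as [p [rho [_ Hp]]].
  (* All variables are read as the element being tested, at index 0, and the parameters come after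
     it. *)
  destruct (zfc_separation HZ (ren (on_even_odd (fun _ => 0) S) p) rho x) as [y Hy].
  exists y. intros z. rewrite Hy, holds_ren, <- (Hp (fun _ => z)).
  assert (G : holds E (fun i => scons z rho (on_even_odd (fun _ => 0) S i)) p <->
    holds E (mix (fun _ => z) rho) p).
  { apply holds_ext. intros i. unfold on_even_odd, mix.
    destruct (Nat.even i); reflexivity. }
  rewrite G. reflexivity.
Qed.

Lemma replacement (P : U -> U -> Prop) : DEF (fun e => P (e 0) (e 1)) ->
  forall a, (forall x, x ∈ a -> exists! y, P x y) ->
  exists b, forall y, y ∈ b <-> exists x, x ∈ a /\ P x y.
Proof.
  intros HP a Ha.
  destruct (Def_form (ex_intro _ a I) HP) as [p [rho [_ Hp]]].
  set (r := on_even_odd (fun i => match i with 0 => 0 | _ => 1 end) (fun i => S (S i))).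
  assert (G : forall x y, holds E (scons x (scons y rho)) (ren r p) <-> P x y).
  { intros x y. rewrite holds_ren.
    rewrite <- (Hp (fun i => match i with 0 => x | _ => y end)).
    apply holds_ext. intros i. unfold r, on_even_odd, mix.
    destruct (Nat.even i); [destruct (Nat.div2 i) |]; reflexivity. }
  destruct (zfc_replacement HZ (ren r p) rho a) as [b Hb].
  - intros x Hx. destruct (Ha x Hx) as [y [H1 H2]].
    exists y. split; [apply G, H1 | intros y' H'; apply H2, G, H'].
  - exists b. intros y. rewrite Hb. split; intros [x Hx]; exists x; [rewrite <- G | rewrite G]; exact Hx.
Qed.

Definition the (P : U -> Prop) (H : exists x, P x) : U :=
  proj1_sig (@constructive_indefinite_description U P H).

Arguments the {P} H.

Lemma the_spec (P : U -> Prop) (H : exists x, P x) : P (the H).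
Proof. exact (proj2_sig (@constructive_indefinite_description U P H)). Qed.

Lemma empty_exists : exists x, is_empty E x.
Proof. destruct (zfc_infinity HZ) as [w [[x [Hx _]] _]]. exists x. exact Hx. Qed.

Definition emp : U := the empty_exists.
Definition upair (x y : U) : U := the (zfc_pairing HZ x y).
Definition pair (x y : U) : U := upair (upair x x) (upair x y).
Definition bigcup (x : U) : U := the (zfc_union HZ x).
Definition pow (x : U) : U := the (zfc_power HZ x).
Definition union (x y : U) : U := bigcup (upair x y).
Definition sing (x : U) : U := upair x x.
Definition succ (x : U) : U := union x (sing x).

Lemma emp_iff (z : U) : z ∈ emp <-> False.
Proof. split; [| tauto]. intros H. exact (the_spec _ empty_exists _ H). Qed.

Lemma upair_iff (x y z : U) : z ∈ upair x y <-> z = x \/ z = y.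
Proof. apply (the_spec _ (zfc_pairing HZ x y)). Qed.

Lemma bigcup_iff (x z : U) : z ∈ bigcup x <-> exists y, y ∈ x /\ z ∈ y.
Proof. apply (the_spec _ (zfc_union HZ x)). Qed.

Lemma pow_iff (x z : U) : z ∈ pow x <-> subset E z x.
Proof. apply (the_spec _ (zfc_power HZ x)). Qed.

Lemma union_iff (x y z : U) : z ∈ union x y <-> z ∈ x \/ z ∈ y.
Proof.
  unfold union. rewrite bigcup_iff. split.
  - intros [t [Ht Hz]]. apply upair_iff in Ht. destruct Ht as [-> | ->]; auto.
  - intros [H | H]; [exists x | exists y]; rewrite upair_iff; auto.
Qed.

Lemma sing_iff (x z : U) : z ∈ sing x <-> z = x.
Proof. unfold sing. rewrite upair_iff. tauto. Qed.

Lemma succ_iff (x z : U) : z ∈ succ x <-> z ∈ x \/ z = x.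
Proof. unfold succ. rewrite union_iff, sing_iff. reflexivity. Qed.

Lemma is_empty_iff (x : U) : is_empty E x <-> x = emp.
Proof.
  split.
  - intros H. apply extensionality. intros z. rewrite emp_iff. split; [apply H | tauto].
  - intros -> z. rewrite emp_iff. tauto.
Qed.

Lemma not_empty (x : U) : ~ is_empty E x <-> exists z, z ∈ x.
Proof.
  split.
  - intros H. apply NNPP. intros N. apply H. intros z Hz. apply N. exists z. exact Hz.
  - intros [z Hz] H. exact (H z Hz).
Qed.

Lemma is_upair_iff (p x y : U) : is_upair E p x y <-> p = upair x y.
Proof.
  split.
  - intros H. apply extensionality. intros z. rewrite upair_iff. apply H.
  - intros -> z. apply upair_iff.
Qed.

Lemma is_pair_iff (p x y : U) : is_pair E p x y <-> p = pair x y.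
Proof.
  split.
  - intros [u [v [Hu [Hv Hp]]]]. apply is_upair_iff in Hu, Hv, Hp. subst. reflexivity.
  - intros ->. exists (upair x x), (upair x y). rewrite !is_upair_iff. auto.
Qed.

Lemma is_succ_iff (y x : U) : is_succ E y x <-> y = succ x.
Proof.
  split.
  - intros H. apply extensionality. intros z. rewrite succ_iff. apply H.
  - intros -> z. apply succ_iff.
Qed.

Lemma upair_inj (x y x' y' : U) :
  upair x y = upair x' y' -> (x = x' /\ y = y') \/ (x = y' /\ y = x').
Proof.
  intros H.
  assert (G : forall z, z = x \/ z = y <-> z = x' \/ z = y').
  { intros z. rewrite <- !upair_iff, H. reflexivity. }
  destruct (proj1 (G x) (or_introl eq_refl)); destruct (proj1 (G y) (or_intror eq_refl));
    destruct (proj2 (G x') (or_introl eq_refl)); destruct (proj2 (G y') (or_intror eq_refl));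
    subst; auto.
Qed.

Lemma pair_inj (x y x' y' : U) : pair x y = pair x' y' -> x = x' /\ y = y'.
Proof.
  unfold pair. intros H.
  apply upair_inj in H as [[H1 H2] | [H1 H2]];
    apply upair_inj in H1 as [[H3 H4] | [H3 H4]];
    apply upair_inj in H2 as [[H5 H6] | [H5 H6]]; subst; auto.
Qed.

Lemma maps_iff (f x y : U) : maps E f x y <-> pair x y ∈ f.
Proof.
  split.
  - intros [p [Hp H]]. apply is_pair_iff in Hp. subst. exact H.
  - intros H. exists (pair x y). rewrite is_pair_iff. auto.
Qed.

Lemma foundation_irrefl (x : U) : ~ x ∈ x.
Proof.
  intros H. destruct (zfc_foundation HZ (x := sing x)) as [y [Hy Hm]].
  - apply not_empty. exists x. apply sing_iff. reflexivity.
  - apply sing_iff in Hy. subst y. apply (Hm x); [apply sing_iff; reflexivity | exact H].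
Qed.

Lemma foundation_asym (x y : U) : x ∈ y -> ~ y ∈ x.
Proof.
  intros H H'. destruct (zfc_foundation HZ (x := upair x y)) as [z [Hz Hm]].
  - apply not_empty. exists x. apply upair_iff. auto.
  - apply upair_iff in Hz as [-> | ->].
    + apply (Hm y); [apply upair_iff; auto | exact H'].
    + apply (Hm x); [apply upair_iff; auto | exact H].
Qed.

Lemma succ_inj (x y : U) : succ x = succ y -> x = y.
Proof.
  intros H.
  assert (Hx : x ∈ succ y) by (rewrite <- H; apply succ_iff; auto).
  assert (Hy : y ∈ succ x) by (rewrite H; apply succ_iff; auto).
  apply succ_iff in Hx, Hy. destruct Hx as [Hx | Hx]; [| exact Hx].
  destruct Hy as [Hy | Hy]; [| auto]. destruct (foundation_asym Hx Hy).
Qed.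

Lemma subset_refl (x : U) : subset E x x.
Proof. intros z Hz. exact Hz. Qed.

Lemma subset_trans (x y z : U) : subset E x y -> subset E y z -> subset E x z.
Proof. intros H1 H2 t Ht. auto. Qed.

Lemma subset_antisym (x y : U) : subset E x y -> subset E y x -> x = y.
Proof. intros H1 H2. apply extensionality. intros z. split; auto. Qed.

(** * Definability of the basic notions *)

Lemma Def_subset A t u : term A t -> term A u ->
  Def E A (fun e => subset E (t e) (u e)).
Proof. intros. unfold subset. dfn. Qed.

Lemma Def_is_empty A t : term A t ->
  Def E A (fun e => is_empty E (t e)).
Proof. intros. unfold is_empty. dfn. Qed.

Lemma Def_is_upair A t u v : term A t -> term A u -> term A v ->
  Def E A (fun e => is_upair E (t e) (u e) (v e)).
Proof. intros. unfold is_upair. dfn. Qed.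

Lemma Def_is_succ A t u : term A t -> term A u ->
  Def E A (fun e => is_succ E (t e) (u e)).
Proof. intros. unfold is_succ. dfn. Qed.

#[local] Hint Resolve Def_subset Def_is_empty Def_is_upair Def_is_succ : dfn.

Lemma Def_is_pair A t u v : term A t -> term A u -> term A v ->
  Def E A (fun e => is_pair E (t e) (u e) (v e)).
Proof. intros. unfold is_pair. dfn. Qed.

Lemma Def_eq_pair A t u v : term A t -> term A u -> term A v ->
  Def E A (fun e => t e = pair (u e) (v e)).
Proof.
  intros. apply Def_ext with (fun e => is_pair E (t e) (u e) (v e)).
  - intros e. apply is_pair_iff.
  - apply Def_is_pair; assumption.
Qed.

Lemma Def_eq_succ A t u : term A t -> term A u ->
  Def E A (fun e => t e = succ (u e)).
Proof.
  intros. apply Def_ext with (fun e => is_succ E (t e) (u e)).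
  - intros e. apply is_succ_iff.
  - apply Def_is_succ; assumption.
Qed.

Lemma Def_transitive A t : term A t ->
  Def E A (fun e => transitive E (t e)).
Proof. intros. unfold transitive. dfn. Qed.

#[local] Hint Resolve Def_is_pair Def_eq_pair Def_eq_succ Def_transitive : dfn.

Lemma Def_maps A t u v : term A t -> term A u -> term A v ->
  Def E A (fun e => maps E (t e) (u e) (v e)).
Proof. intros. unfold maps. dfn. Qed.

Lemma Def_pair_mem A t u v : term A t -> term A u -> term A v ->
  Def E A (fun e => pair (u e) (v e) ∈ t e).
Proof.
  intros. apply Def_ext with (fun e => maps E (t e) (u e) (v e)).
  - intros e. apply maps_iff.
  - apply Def_maps; assumption.
Qed.

Lemma Def_ordinal A t : term A t ->
  Def E A (fun e => ordinal E (t e)).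
Proof. intros. unfold ordinal. dfn. Qed.

#[local] Hint Resolve Def_maps Def_pair_mem Def_ordinal : dfn.

Lemma Def_is_nat A t : term A t ->
  Def E A (fun e => is_nat E (t e)).
Proof. intros. unfold is_nat. dfn. Qed.

Lemma Def_is_numeral A (n : nat) : forall t, term A t ->
  Def E A (fun e => is_numeral E n (t e)).
Proof.
  induction n as [| n IH]; intros t Ht; simpl.
  - apply Def_is_empty; exact Ht.
  - dfn.
Qed.

Lemma Def_is_fun A t u v : term A t -> term A u -> term A v ->
  Def E A (fun e => is_fun E (t e) (fun x => x ∈ u e) (fun x => x ∈ v e)).
Proof. intros. unfold is_fun. dfn. Qed.

#[local] Hint Resolve Def_is_nat Def_is_numeral Def_is_fun : dfn.
(** * Ordinals *)

Lemma ordinal_intro (a : U) : transitive E a ->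
  (forall x y, x ∈ a -> y ∈ a -> x ∈ y \/ x = y \/ y ∈ x) -> ordinal E a.
Proof.
  intros H1 H2. split; [exact H1 |]. split; [exact H2 |].
  intros s _ Hs. apply (zfc_foundation HZ), Hs.
Qed.

Lemma ordinal_mem (a b : U) : ordinal E a -> b ∈ a -> ordinal E b.
Proof.
  intros [H1 [H2 _]] Hb. apply ordinal_intro.
  - intros y Hy z Hz.
    assert (Hya : y ∈ a) by exact (H1 b Hb y Hy).
    assert (Hza : z ∈ a) by exact (H1 y Hya z Hz).
    destruct (H2 z b Hza Hb) as [H | [-> | H]]; [exact H | |].
    + destruct (foundation_asym Hy Hz).
    (* Here z is in y, y in b and b in z; foundation for the set of these three excludes the
       cycle. *)
    + exfalso. destruct (zfc_foundation HZ (x := union (sing b) (upair y z))) as [m [Hm N]].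
      * apply not_empty. exists b. apply union_iff. left. apply sing_iff. reflexivity.
      * assert (Gb : b ∈ union (sing b) (upair y z)) by (rewrite union_iff, sing_iff; auto).
        assert (Gy : y ∈ union (sing b) (upair y z)) by (rewrite union_iff, upair_iff; auto).
        assert (Gz : z ∈ union (sing b) (upair y z)) by (rewrite union_iff, upair_iff; auto).
        rewrite union_iff, sing_iff, upair_iff in Hm.
        destruct Hm as [-> | [-> | ->]]; [exact (N y Gy Hy) | exact (N z Gz Hz) | exact (N b Gb H)].
  - intros x y Hx Hy. apply H2; [exact (H1 b Hb x Hx) | exact (H1 b Hb y Hy)].
Qed.

Lemma ordinal_trans (a b c : U) : ordinal E a -> c ∈ b -> b ∈ a -> c ∈ a.
Proof. intros [H _] Hc Hb. exact (H b Hb c Hc). Qed.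

(** If [c] is not [a], the least element of [a] outside [c] is [c] itself. *)
Lemma ordinal_subset_mem (a c : U) :
  ordinal E a -> transitive E c -> subset E c a -> c = a \/ c ∈ a.
Proof.
  intros Ha Hc Hs. destruct (classic (c = a)) as [H | H]; [auto | right].
  destruct (@separation (fun z => ~ z ∈ c)) with (x := a) as [d Hd]; [dfn |].
  destruct (zfc_foundation HZ (x := d)) as [m [Hm N]].
  - apply not_empty. apply NNPP. intros G. apply H. apply subset_antisym; [exact Hs |].
    intros z Hz. apply NNPP. intros Hzc. apply G. exists z. apply Hd. auto.
  - apply Hd in Hm as [Hma Hmc].
    assert (c = m) as ->; [| exact Hma].
    apply subset_antisym.
    + intros z Hz. destruct Ha as [Ha1 [Ha2 _]].
      destruct (Ha2 z m (Hs z Hz) Hma) as [G | [-> | G]]; [exact G | contradiction |].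
      destruct Hmc. exact (Hc z Hz m G).
    + intros z Hz. apply NNPP. intros Hzc. apply (N z); [| exact Hz].
      apply Hd. split; [exact (ordinal_trans Ha Hz Hma) | exact Hzc].
Qed.

(** The intersection of the two ordinals is equal to, or an element of, each of them; if it were an
    element of both, it would belong to itself. *)
Lemma ordinal_trichotomy (a b : U) : ordinal E a -> ordinal E b -> a ∈ b \/ a = b \/ b ∈ a.
Proof.
  intros Ha Hb.
  destruct (@separation (fun z => z ∈ b)) with (x := a) as [c Hc]; [dfn |].
  assert (Tc : transitive E c).
  { intros y Hy z Hz. apply Hc in Hy as [H1 H2]. apply Hc.
    split; [exact (ordinal_trans Ha Hz H1) | exact (ordinal_trans Hb Hz H2)]. }
  assert (Sa : subset E c a) by (intros z Hz; apply Hc, Hz).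
  assert (Sb : subset E c b) by (intros z Hz; apply Hc, Hz).
  destruct (ordinal_subset_mem Ha Tc Sa) as [-> | Ga];
    destruct (ordinal_subset_mem Hb Tc Sb) as [-> | Gb]; auto.
  exfalso. apply (@foundation_irrefl c). apply Hc. auto.
Qed.

Lemma ordinal_subset (a b : U) :
  ordinal E a -> ordinal E b -> subset E a b <-> a = b \/ a ∈ b.
Proof.
  intros Ha Hb. split.
  - apply ordinal_subset_mem; [exact Hb | apply Ha].
  - intros [-> | H]; [apply subset_refl | exact (proj1 Hb a H)].
Qed.

Lemma ordinal_emp : ordinal E emp.
Proof.
  apply ordinal_intro; [intros y Hy | intros x y Hx]; exfalso; eapply emp_iff; eassumption.
Qed.

Lemma ordinal_succ (a : U) : ordinal E a -> ordinal E (succ a).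
Proof.
  intros Ha. apply ordinal_intro.
  - intros y Hy z Hz. apply succ_iff. left. apply succ_iff in Hy as [Hy | ->]; [| exact Hz].
    exact (ordinal_trans Ha Hz Hy).
  - intros x y Hx Hy.
    assert (G : forall z, z ∈ succ a -> ordinal E z).
    { intros z Hz. apply succ_iff in Hz as [Hz | ->]; [exact (ordinal_mem Ha Hz) | exact Ha]. }
    apply ordinal_trichotomy; auto.
Qed.

Lemma mem_succ (a : U) : a ∈ succ a.
Proof. apply succ_iff. auto. Qed.

Lemma ordinal_bigcup (x : U) : (forall a, a ∈ x -> ordinal E a) -> ordinal E (bigcup x).
Proof.
  intros H. apply ordinal_intro.
  - intros y Hy z Hz. apply bigcup_iff in Hy as [a [Ha Hy]]. apply bigcup_iff.
    exists a. split; [exact Ha | exact (ordinal_trans (H a Ha) Hz Hy)].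
  - intros y z Hy Hz. apply bigcup_iff in Hy as [a [Ha Hy]].
    apply bigcup_iff in Hz as [b [Hb Hz]].
    apply ordinal_trichotomy; [exact (ordinal_mem (H a Ha) Hy) | exact (ordinal_mem (H b Hb) Hz)].
Qed.

Lemma ordinal_bound (x : U) : (forall a, a ∈ x -> ordinal E a) ->
  exists b, ordinal E b /\ forall a, a ∈ x -> a ∈ b.
Proof.
  intros H. pose proof (ordinal_bigcup H) as G. exists (succ (bigcup x)).
  split; [apply ordinal_succ, G |]. intros a Ha. apply succ_iff.
  destruct (proj1 (ordinal_subset (H a Ha) G)) as [-> | K]; auto.
  intros z Hz. apply bigcup_iff. exists a. auto.
Qed.

Lemma ordinal_least (P : U -> Prop) : DEF (fun e => P (e 0)) ->
  (exists a, ordinal E a /\ P a) ->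
  exists a, ordinal E a /\ P a /\ forall b, b ∈ a -> ~ P b.
Proof.
  intros HP [a [Ha H]].
  destruct (separation _ HP (succ a)) as [d Hd].
  destruct (zfc_foundation HZ (x := d)) as [m [Hm N]].
  - apply not_empty. exists a. apply Hd. split; [apply mem_succ | exact H].
  - apply Hd in Hm as [H1 H2]. pose proof (ordinal_succ Ha) as Hs.
    exists m. split; [exact (ordinal_mem Hs H1) |]. split; [exact H2 |].
    intros b Hb Pb. apply (N b); [| exact Hb]. apply Hd.
    split; [exact (ordinal_trans Hs Hb H1) | exact Pb].
Qed.

Lemma ordinal_ind (P : U -> Prop) : DEF (fun e => P (e 0)) ->
  (forall a, ordinal E a -> (forall b, b ∈ a -> P b) -> P a) ->
  forall a, ordinal E a -> P a.
Proof.
  intros HP H a Ha. apply NNPP. intros N.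
  destruct (@ordinal_least (fun a => ~ P a)) as [b [Hb [H1 H2]]].
  - apply Def_not, HP.
  - exists a. auto.
  - apply H1, H; [exact Hb |]. intros c Hc. apply NNPP. exact (H2 c Hc).
Qed.

(** * Natural numbers *)

Lemma is_nat_emp : is_nat E emp.
Proof.
  split; [apply ordinal_emp |]. intros j [Hj | ->].
  - destruct (proj1 (emp_iff j) Hj).
  - left. apply is_empty_iff. reflexivity.
Qed.

Lemma is_nat_succ (k : U) : is_nat E k -> is_nat E (succ k).
Proof.
  intros [H1 H2]. split; [apply ordinal_succ, H1 |].
  intros j [Hj | ->].
  - apply H2, succ_iff, Hj.
  - right. exists k. apply is_succ_iff. reflexivity.
Qed.

Lemma is_nat_mem (k j : U) : is_nat E k -> j ∈ k -> is_nat E j.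
Proof.
  intros [H1 H2] Hj. split; [exact (ordinal_mem H1 Hj) |].
  intros i [Hi | ->]; apply H2; left; [exact (ordinal_trans H1 Hi Hj) | exact Hj].
Qed.

Lemma is_nat_ordinal (k : U) : is_nat E k -> ordinal E k.
Proof. intros H. apply H. Qed.

Lemma nat_ind_def (P : U -> Prop) : DEF (fun e => P (e 0)) -> P emp ->
  (forall k, is_nat E k -> P k -> P (succ k)) -> forall k, is_nat E k -> P k.
Proof.
  intros HP H0 HS k Hk.
  apply (@ordinal_ind (fun k => is_nat E k -> P k)); [dfn | | apply Hk | exact Hk].

  clear k Hk. intros k _ IH Hk. destruct (proj2 Hk k (or_intror eq_refl)) as [H | [i H]].
  - apply is_empty_iff in H. subst. exact H0.
  - apply is_succ_iff in H. subst.
    assert (Hi : is_nat E i) by (apply (is_nat_mem Hk), mem_succ).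
    apply HS; [exact Hi |]. apply IH; [apply mem_succ | exact Hi].
Qed.

Lemma omega_exists : exists w, forall k, k ∈ w <-> is_nat E k.
Proof.
  destruct (zfc_infinity HZ) as [w [[x [Hx Hxw]] Hw]].
  apply is_empty_iff in Hx. subst x.
  destruct (@separation (is_nat E)) with (x := w) as [o Ho]; [dfn |].
  exists o. intros k. rewrite Ho. split; [tauto |]. intros Hk. split; [| exact Hk].
  revert k Hk. apply nat_ind_def; [dfn | exact Hxw |].
  intros k _ Hk. destruct (Hw k Hk) as [y [Hy Hyw]].
  apply is_succ_iff in Hy. subst. exact Hyw.
Qed.

Definition omega : U := the omega_exists.

Lemma omega_iff (k : U) : k ∈ omega <-> is_nat E k.
Proof. apply (the_spec _ omega_exists). Qed.

Lemma ordinal_omega : ordinal E omega.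
Proof.
  apply ordinal_intro.
  - intros y Hy z Hz. rewrite omega_iff in *. exact (is_nat_mem Hy Hz).
  - intros x y Hx Hy. rewrite omega_iff in *.
    apply ordinal_trichotomy; apply is_nat_ordinal; assumption.
Qed.

Fixpoint num (n : nat) : U :=
  match n with 0 => emp | S n => succ (num n) end.

Lemma is_numeral_iff (n : nat) : forall x, is_numeral E n x <-> x = num n.
Proof.
  induction n as [| n IH]; intros x; simpl.
  - apply is_empty_iff.
  - split.
    + intros [y [Hy Hx]]. apply IH in Hy. apply is_succ_iff in Hx. subst. reflexivity.
    + intros ->. exists (num n). rewrite IH, is_succ_iff. auto.
Qed.

Lemma is_nat_num (n : nat) : is_nat E (num n).
Proof. induction n; simpl; [apply is_nat_emp | apply is_nat_succ; assumption]. Qed.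

Lemma succ_not_emp (x : U) : succ x <> emp.
Proof. intros H. apply (emp_iff x). rewrite <- H. apply mem_succ. Qed.

Lemma num_inj (n : nat) : forall m, num n = num m -> n = m.
Proof.
  induction n as [| n IH]; intros [| m] H; simpl in H.
  - reflexivity.
  - symmetry in H; destruct (succ_not_emp _ H).
  - destruct (succ_not_emp _ H).
  - f_equal. apply IH, succ_inj, H.
Qed.

Lemma mem_num (n : nat) : forall x, x ∈ num n <-> exists i, i < n /\ x = num i.
Proof.
  induction n as [| n IH]; intros x; simpl.
  - rewrite emp_iff. split; [tauto | intros [i [H _]]; lia].
  - rewrite succ_iff, IH. split.
    + intros [[i [H ->]] | ->]; [exists i | exists n]; split; auto; lia.
    + intros [i [H ->]]. destruct (Nat.eq_dec i n) as [-> | N]; [auto |].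
      left. exists i. split; [lia | reflexivity].
Qed.
(** * Recursion along the ordinals *)

Section Recursion.

(* The level of index b is x0 united with the sets {x | K x u}, u a level of
   smaller index: this yields both the hierarchy V and transitive closures. *)
Variables (K : U -> U -> Prop) (x0 : U).
Hypothesis HK : DEF (fun e => K (e 0) (e 1)).
Hypothesis K_set : forall u, exists k, forall x, x ∈ k <-> K x u.

Definition upto (a b : U) : Prop := b ∈ a \/ b = a.

Definition is_rec (a f : U) : Prop :=
  is_fun E f (upto a) (fun _ => True) /\
  forall b w, maps E f b w ->
    forall x, x ∈ w <-> x ∈ x0 \/ exists c u, c ∈ b /\ maps E f c u /\ K x u.

Definition level (a w : U) : Prop := exists f, is_rec a f /\ maps E f a w.

Lemma Def_K t u : term (@everything U) t -> term (@everything U) u ->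
  DEF (fun e => K (t e) (u e)).
Proof. intros Ht Hu. exact (Def_comp2 K HK Ht Hu). Qed.
#[local] Hint Resolve Def_K : dfn.

Lemma Def_is_rec t u : term (@everything U) t -> term (@everything U) u ->
  DEF (fun e => is_rec (t e) (u e)).
Proof. intros. unfold is_rec, is_fun, upto. dfn. Qed.
#[local] Hint Resolve Def_is_rec : dfn.

Lemma Def_level t u : term (@everything U) t -> term (@everything U) u ->
  DEF (fun e => level (t e) (u e)).
Proof. intros. unfold level. dfn. Qed.
#[local] Hint Resolve Def_level : dfn.

(** Cutting a recursion at a smaller ordinal shows that its values there are levels, which makes
    induction hypotheses about levels applicable to them. *)
Lemma is_rec_restrict (a c f : U) : ordinal E a -> c ∈ a -> is_rec a f ->
  exists f', is_rec c f' /\ forall b w, maps E f' b w <-> upto c b /\ maps E f b w.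
Proof.
  intros Ha Hc [[H1 H2] H3].
  destruct (@separation (fun p => exists b w, upto c b /\ p = pair b w)) with (x := f)
    as [f' Hf']; [unfold upto; dfn |].
  assert (G : forall b w, maps E f' b w <-> upto c b /\ maps E f b w).
  { intros b w. rewrite !maps_iff, Hf'. split.
    - intros [H [b' [w' [K1 K2]]]]. apply pair_inj in K2 as [-> ->]. auto.
    - intros [K1 K2]. split; [exact K2 |]. exists b, w. auto. }
  assert (Sub : forall b, upto c b -> upto a b).
  { intros b [Hb | ->]; left; [exact (ordinal_trans Ha Hb Hc) | exact Hc]. }
  exists f'. split; [split; [split |] | exact G].
  - intros p Hp. apply Hf' in Hp as [_ [b [w [Hb ->]]]].
    exists b, w. rewrite is_pair_iff. auto.
  - intros b Hb. destruct (H2 b (Sub b Hb)) as [w [K1 K2]].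
    exists w. split; [apply G; auto |]. intros w' Hw'. apply K2, G, Hw'.
  - intros b w Hb x. apply G in Hb as [Hb Hw]. rewrite (H3 b w Hw x).
    assert (Hup : forall d, d ∈ b -> upto c d).
    { intros d Hd. left. destruct Hb as [Hb | ->]; [| exact Hd].
      exact (ordinal_trans (ordinal_mem Ha Hc) Hd Hb). }
    split; (intros [Hx | [d [u [K1 [K2 K3]]]]]; [auto | right]);
      exists d, u; repeat split; auto; apply G; auto.
Qed.

Lemma level_unique (a : U) : ordinal E a -> forall w w', level a w -> level a w' -> w = w'.
Proof.
  revert a. apply (@ordinal_ind (fun a => forall w w', level a w -> level a w' -> w = w'));
    [dfn |].
  intros a Ha IH.
  assert (G : forall w w', level a w -> level a w' -> subset E w w').
  { intros w w' [f [Hf Hw]] [f' [Hf' Hw']] x Hx.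
    apply (proj2 Hf a w Hw) in Hx. apply (proj2 Hf' a w' Hw').
    destruct Hx as [Hx | [c [u [Hc [Hu Hx]]]]]; [auto | right].
    destruct (is_rec_restrict Ha Hc Hf) as [g [Hg Gg]].
    destruct (is_rec_restrict Ha Hc Hf') as [g' [Hg' Gg']].
    destruct (proj2 (proj1 Hf') c (or_introl Hc)) as [u' [Hu' _]].
    exists c, u'. split; [exact Hc |]. split; [exact Hu' |].
    replace u' with u; [exact Hx |].
    apply (IH c Hc); [exists g | exists g']; (split; [assumption |]);
      [apply Gg | apply Gg']; (split; [right; reflexivity | assumption]). }
  intros w w' H H'. apply subset_antisym; auto.
Qed.

Lemma level_iff (a w : U) : ordinal E a -> level a w ->
  forall x, x ∈ w <-> x ∈ x0 \/ exists c u, c ∈ a /\ level c u /\ K x u.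
Proof.
  intros Ha [f [Hf Hw]] x. rewrite (proj2 Hf a w Hw x).
  assert (G : forall c u, c ∈ a -> maps E f c u -> level c u).
  { intros c u Hc Hu. destruct (is_rec_restrict Ha Hc Hf) as [g [Hg Gg]].
    exists g. split; [exact Hg |]. apply Gg. split; [right; reflexivity | exact Hu]. }
  split; (intros [Hx | [c [u [Hc [Hu Hx]]]]]; [auto | right]).
  - exists c, u. auto.
  - exists c, u. split; [exact Hc |]. split; [| exact Hx].
    destruct (proj2 (proj1 Hf) c (or_introl Hc)) as [u' [Hu' _]].
    rewrite (level_unique (ordinal_mem Ha Hc) Hu (G c u' Hc Hu')). exact Hu'.
Qed.

(** Replacement collects the levels below [a] into a function [g], and the sets that they contribute
    into [h]; the pair of [a] with [x0] united with the union of [h] completes [g]. *)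
Lemma level_exists (a : U) : ordinal E a -> exists w, level a w.
Proof.
  revert a. apply (@ordinal_ind (fun a => exists w, level a w)); [dfn |].
  intros a Ha IH.
  assert (Un : forall c, c ∈ a -> forall w w', level c w -> level c w' -> w = w').
  { intros c Hc. apply level_unique. exact (ordinal_mem Ha Hc). }
  destruct (@replacement (fun c p => exists u, level c u /\ p = pair c u)) with (a := a)
    as [g Hg]; [dfn | |].
  { intros c Hc. destruct (IH c Hc) as [u Hu]. exists (pair c u). split.
    - exists u. auto.
    - intros p [u' [Hu' ->]]. rewrite (Un c Hc u u' Hu Hu'). reflexivity. }
  destruct (@replacement (fun c k => exists u, level c u /\ forall x, x ∈ k <-> K x u))
    with (a := a) as [h Hh]; [dfn | |].
  { intros c Hc. destruct (IH c Hc) as [u Hu]. destruct (K_set u) as [k Hk].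
    exists k. split.
    - exists u. auto.
    - intros k' [u' [Hu' Hk']]. apply extensionality. intros x.
      rewrite Hk, Hk', (Un c Hc u u' Hu Hu'). reflexivity. }
  set (W := union x0 (bigcup h)).
  assert (HW : forall x, x ∈ W <-> x ∈ x0 \/ exists c u, c ∈ a /\ level c u /\ K x u).
  { intros x. unfold W. rewrite union_iff, bigcup_iff.
    split; (intros [Hx | Hx]; [auto | right]).
    - destruct Hx as [k [Hk Hx]]. apply Hh in Hk as [c [Hc [u [Hu Hk]]]].
      exists c, u. rewrite <- Hk. auto.
    - destruct Hx as [c [u [Hc [Hu Hx]]]]. destruct (K_set u) as [k Hk].
      exists k. split; [apply Hh; exists c; split; [exact Hc | exists u; auto] | apply Hk, Hx]. }
  set (f := union g (sing (pair a W))).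
  assert (Hf : forall b w, maps E f b w <-> (b ∈ a /\ level b w) \/ (b = a /\ w = W)).
  { intros b w. unfold f. rewrite maps_iff, union_iff, sing_iff, Hg. split.
    - intros [[c [Hc [u [Hu Hp]]]] | Hp]; apply pair_inj in Hp as [-> ->]; auto.
    - intros [[Hb Hw] | [-> ->]]; [left | auto]. exists b. split; [exact Hb |].
      exists w. auto. }
  exists W, f. split; [split; [split |] |].
  - intros p Hp. unfold f in Hp. apply union_iff in Hp as [Hp | Hp].
    + apply Hg in Hp as [c [Hc [u [Hu ->]]]]. exists c, u.
      rewrite is_pair_iff. unfold upto. auto.
    + apply sing_iff in Hp as ->. exists a, W. rewrite is_pair_iff. unfold upto. auto.
  - intros b [Hb | ->].
    + destruct (IH b Hb) as [w Hw]. exists w. split; [apply Hf; auto |].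
      intros w' Hw'. apply Hf in Hw' as [[_ Hw'] | [-> _]].
      * exact (Un b Hb w w' Hw Hw').
      * destruct (foundation_irrefl Hb).
    + exists W. split; [apply Hf; auto |].
      intros w' Hw'. apply Hf in Hw' as [[Hb _] | [_ ->]]; [| reflexivity].
      destruct (foundation_irrefl Hb).
  - intros b w Hw x. apply Hf in Hw as [[Hb Hw] | [-> ->]].
    + rewrite (level_iff (ordinal_mem Ha Hb) Hw).
      split; (intros [Hx | [c [u [Hc [Hu Hx]]]]]; [auto | right]); exists c, u;
        (split; [exact Hc |]; split; [| exact Hx]).
      * apply Hf. left. split; [exact (ordinal_trans Ha Hc Hb) | exact Hu].
      * apply Hf in Hu as [[_ Hu] | [-> _]]; [exact Hu |].
        destruct (foundation_asym Hb Hc).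
    + rewrite HW. split; (intros [Hx | [c [u [Hc [Hu Hx]]]]]; [auto | right]); exists c, u;
        (split; [exact Hc |]; split; [| exact Hx]).
      * apply Hf. auto.
      * apply Hf in Hu as [[_ Hu] | [-> _]]; [exact Hu |]. destruct (foundation_irrefl Hc).
  - apply Hf. auto.
Qed.

End Recursion.

(** * Transitive closure and class induction *)

(** The level of index omega of the recursion that starts from [x] and adds the elements of
    elements: if y is in the level c, its elements are in the level c + 1. *)
Lemma transitive_closure (x : U) : exists t, transitive E t /\ subset E x t.
Proof.
  set (K := fun z u : U => exists y, y ∈ u /\ z ∈ y).
  assert (HK : DEF (fun e => K (e 0) (e 1))) by (unfold K; dfn).
  assert (KS : forall u, exists k, forall z, z ∈ k <-> K z u).
  { intros u. exists (bigcup u). intros z. apply bigcup_iff. }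
  destruct (level_exists K x HK KS ordinal_omega) as [t Ht].
  pose proof (level_iff HK ordinal_omega Ht) as Hm.
  exists t. split; [| intros z Hz; apply Hm; auto].
  intros y Hy z Hz. apply Hm. right. apply Hm in Hy as [Hy | [c [u [Hc [Hu Hy]]]]].
  - destruct (level_exists K x HK KS ordinal_emp) as [u Hu]. exists emp, u.
    split; [apply omega_iff, is_nat_emp |]. split; [exact Hu |].
    exists y. split; [| exact Hz]. apply (level_iff HK ordinal_emp Hu). auto.
  - assert (Hs : ordinal E (succ c)).
    { apply ordinal_succ, is_nat_ordinal, omega_iff, Hc. }
    destruct (level_exists K x HK KS Hs) as [u' Hu'].
    exists (succ c), u'. split; [apply omega_iff, is_nat_succ, omega_iff, Hc |].
    split; [exact Hu' |]. exists y. split; [| exact Hz].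
    apply (level_iff HK Hs Hu'). right. exists c, u. split; [apply mem_succ |]. auto.
Qed.

Lemma mem_ind (P : U -> Prop) : DEF (fun e => P (e 0)) ->
  (forall x, (forall y, y ∈ x -> P y) -> P x) -> forall x, P x.
Proof.
  intros HP H x. apply NNPP. intros N.
  destruct (transitive_closure (sing x)) as [t [Ht Hx]].
  destruct (@separation (fun z => ~ P z)) with (x := t) as [d Hd]; [apply Def_not, HP |].
  destruct (zfc_foundation HZ (x := d)) as [m [Hm Hmin]].
  - apply not_empty. exists x. apply Hd. split; [apply Hx, sing_iff; reflexivity | exact N].
  - apply Hd in Hm as [H1 H2]. apply H2, H. intros y Hy. apply NNPP. intros Hn.
    apply (Hmin y); [| exact Hy]. apply Hd. split; [exact (Ht m H1 y Hy) | exact Hn].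
Qed.

(** * The cumulative hierarchy *)

Lemma is_V_level (a v : U) : is_V E a v <-> ordinal E a /\ level (subset E) emp a v.
Proof.
  unfold is_V, level, is_rec, upto. split; intros [H1 [f Hf]]; (split; [exact H1 |]); exists f.
  - destruct Hf as [F1 [F2 F3]]. split; [split |]; [exact F1 | | exact F3].
    intros b w Hb x. rewrite (F2 b w Hb x), emp_iff. tauto.
  - destruct Hf as [[F1 F2] F3]. split; [exact F1 | split; [| exact F3]].
    intros b w Hb x. rewrite (F2 b w Hb x), emp_iff. tauto.
Qed.

Lemma Def_subset01 : DEF (fun e => subset E (e 0) (e 1)).
Proof. dfn. Qed.

(** The condition on [a] stands inside the existential to make [V] a total function; outside the
    ordinals its value is arbitrary. *)
Lemma is_V_exists (a : U) : exists v, ordinal E a -> is_V E a v.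
Proof.
  destruct (classic (ordinal E a)) as [Ha | Ha]; [| exists a; tauto].
  destruct (@level_exists (subset E) emp Def_subset01) with (a := a) as [v Hv].
  - intros u. exists (pow u). apply pow_iff.
  - exact Ha.
  - exists v. intros _. apply is_V_level. auto.
Qed.

Definition V (a : U) : U := the (is_V_exists a).

Lemma is_V_iff (a v : U) : is_V E a v <-> ordinal E a /\ v = V a.
Proof.
  split.
  - intros H. pose proof H as [Ha _]. split; [exact Ha |].
    pose proof (the_spec _ (is_V_exists a) Ha) as G. fold (V a) in G.
    apply is_V_level in G as [_ G]. apply is_V_level in H as [_ H].
    exact (level_unique Def_subset01 Ha H G).
  - intros [Ha ->]. exact (the_spec _ (is_V_exists a) Ha).
Qed.

Lemma V_iff (a x : U) : ordinal E a -> x ∈ V a <-> exists c, c ∈ a /\ subset E x (V c).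
Proof.
  intros Ha. assert (H : level (subset E) emp a (V a)).
  { apply is_V_level, is_V_iff. auto. }
  rewrite (level_iff Def_subset01 Ha H x), emp_iff. split.
  - intros [[] | [c [u [Hc [Hu Hx]]]]]. exists c. split; [exact Hc |].
    assert (Hoc : ordinal E c) by exact (ordinal_mem Ha Hc).
    assert (G : is_V E c u) by (apply is_V_level; auto).
    apply is_V_iff in G as [_ ->]. exact Hx.
  - intros [c [Hc Hx]]. right. exists c, (V c). split; [exact Hc |]. split; [| exact Hx].
    apply is_V_level, is_V_iff. split; [exact (ordinal_mem Ha Hc) | reflexivity].
Qed.

Lemma V_mono (a b : U) : ordinal E b -> a ∈ b -> subset E (V a) (V b).
Proof.
  intros Hb Hab x Hx. apply V_iff in Hx as [c [Hc Hx]]; [| exact (ordinal_mem Hb Hab)].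
  apply V_iff; [exact Hb |]. exists c. split; [exact (ordinal_trans Hb Hc Hab) | exact Hx].
Qed.

Lemma V_mono_le (a b : U) : ordinal E b -> a = b \/ a ∈ b -> subset E (V a) (V b).
Proof. intros Hb [-> | H]; [apply subset_refl | exact (V_mono Hb H)]. Qed.

Lemma V_transitive (a : U) : ordinal E a -> transitive E (V a).
Proof.
  intros Ha y Hy z Hz. apply V_iff in Hy as [c [Hc Hy]]; [| exact Ha].
  exact (V_mono Ha Hc (Hy z Hz)).
Qed.

Lemma V_subset (a x y : U) : ordinal E a -> x ∈ V a -> subset E y x -> y ∈ V a.
Proof.
  intros Ha Hx Hy. apply V_iff in Hx as [c [Hc Hx]]; [| exact Ha].
  apply V_iff; [exact Ha |]. exists c. split; [exact Hc | exact (subset_trans Hy Hx)].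
Qed.

Lemma mem_V_of_subset (a b x : U) : ordinal E b -> a ∈ b -> subset E x (V a) -> x ∈ V b.
Proof. intros Hb Ha Hx. apply V_iff; [exact Hb |]. exists a. auto. Qed.

Lemma Def_is_V A t u : term A t -> term A u -> Def E A (fun e => is_V E (t e) (u e)).
Proof. intros. unfold is_V, is_fun. dfn. Qed.
#[local] Hint Resolve Def_is_V : dfn.

(** As [V] is not a term, the ordinal induction is carried out on a statement about the definable
    relation [is_V], and translated back at the end. *)
Lemma ordinal_V_iff (a b : U) : ordinal E a -> ordinal E b -> b ∈ V a <-> b ∈ a.
Proof.
  intros Ha. revert b. revert a Ha.
  assert (G : forall a, ordinal E a -> exists v, is_V E a v /\
    forall b, ordinal E b -> b ∈ v <-> b ∈ a).
  { apply (@ordinal_ind (fun a => exists v, is_V E a v /\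
      forall b, ordinal E b -> b ∈ v <-> b ∈ a)); [dfn |].
    intros a Ha IH. exists (V a). split; [apply is_V_iff; auto |].
    intros b Hb. rewrite V_iff by exact Ha. split.
    - intros [c [Hc Hs]]. destruct (IH c Hc) as [v [Hv Hm]].
      apply is_V_iff in Hv as [Hoc ->].
      destruct (proj1 (ordinal_subset Hb Hoc)) as [-> | Hbc]; [| exact Hc |].
      + intros z Hz. apply Hm; [exact (ordinal_mem Hb Hz) | exact (Hs z Hz)].
      + exact (ordinal_trans Ha Hbc Hc).
    - intros Hba. exists b. split; [exact Hba |]. intros z Hz.
      destruct (IH b Hba) as [v [Hv Hm]]. apply is_V_iff in Hv as [_ ->].
      apply Hm; [exact (ordinal_mem Hb Hz) | exact Hz]. }
  intros a Ha b Hb. destruct (G a Ha) as [v [Hv Hm]]. apply is_V_iff in Hv as [_ ->].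
  apply Hm, Hb.
Qed.

(** Induction on membership: replacement collects, for the elements of [x], the least index of a
    level that contains them, and the level of a common bound includes [x]. *)
Lemma mem_some_V (x : U) : exists a, ordinal E a /\ x ∈ V a.
Proof.
  assert (G : exists a v, is_V E a v /\ x ∈ v).
  { revert x. apply (@mem_ind (fun x => exists a v, is_V E a v /\ x ∈ v)); [dfn |].
    intros x IH.
    set (P := fun y a => (exists v, is_V E a v /\ y ∈ v) /\
      forall b, b ∈ a -> ~ exists v, is_V E b v /\ y ∈ v).
    destruct (@replacement P) with (a := x) as [s Hs].
    - unfold P. dfn.
    - intros y Hy. destruct (IH y Hy) as [a0 [v [Hv Hyv]]].
      destruct (@ordinal_least (fun a => exists v, is_V E a v /\ y ∈ v)) as [a [Ha [H1 H2]]].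
      + dfn.
      + exists a0. split; [apply Hv | exists v; auto].
      + exists a. split; [split; assumption |].
        intros b [[v' [Hb K1]] K2].
        destruct (ordinal_trichotomy Ha (proj1 Hb)) as [G | [G | G]]; [| exact G |].
        * destruct (K2 a G H1).
        * destruct (H2 b G). exists v'. auto.
    - destruct (@ordinal_bound s) as [b [Hb Hbound]].
      { intros a Ha. apply Hs in Ha as [y [_ [[v [Hv _]] _]]]. apply Hv. }
      exists (succ b), (V (succ b)). pose proof (ordinal_succ Hb) as Hsb.
      split; [apply is_V_iff; auto |].
      apply mem_V_of_subset with b; [exact Hsb | apply mem_succ |].
      intros y Hy. destruct (IH y Hy) as [a0 [v0 [Hv0 Hyv0]]].
      destruct (@ordinal_least (fun a => exists v, is_V E a v /\ y ∈ v)) as [a [Ha [H1 H2]]].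
      + dfn.
      + exists a0. split; [apply Hv0 | exists v0; auto].
      + assert (Has : a ∈ s) by (apply Hs; exists y; split; [exact Hy | split; assumption]).
        destruct H1 as [v [Hv H1]]. apply is_V_iff in Hv as [_ ->].
        exact (V_mono Hb (Hbound a Has) H1). }
  destruct G as [a [v [Hv Hx]]]. apply is_V_iff in Hv as [Ha ->]. exists a. auto.
Qed.

Lemma pair_in_V (a x y : U) : ordinal E a -> x ∈ V a -> y ∈ V a -> pair x y ∈ V (succ (succ a)).
Proof.
  intros Ha Hx Hy. pose proof (ordinal_succ Ha) as H1. pose proof (ordinal_succ H1) as H2.
  assert (G : forall u v, u ∈ V a -> v ∈ V a -> upair u v ∈ V (succ a)).
  { intros u v Hu Hv. apply mem_V_of_subset with a; [exact H1 | apply mem_succ |].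
    intros z Hz. apply upair_iff in Hz as [-> | ->]; assumption. }
  apply mem_V_of_subset with (succ a); [exact H2 | apply mem_succ |].
  intros z Hz. apply upair_iff in Hz as [-> | ->]; apply G; assumption.
Qed.

Definition limit (a : U) : Prop := ordinal E a /\ (exists b, b ∈ a) /\ forall b, b ∈ a -> succ b ∈ a.

Lemma limit_pair (a x y : U) : limit a -> x ∈ V a -> y ∈ V a -> pair x y ∈ V a.
Proof.
  intros [Ha [_ Hs]] Hx Hy.
  pose proof Hx as Gx. pose proof Hy as Gy.
  apply V_iff in Gx as [c [Hc Gx]]; [| exact Ha].
  apply V_iff in Gy as [d [Hd Gy]]; [| exact Ha].
  pose proof (ordinal_mem Ha Hc) as Oc. pose proof (ordinal_mem Ha Hd) as Od.
  assert (G : exists m, m ∈ a /\ x ∈ V m /\ y ∈ V m).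
  { destruct (ordinal_trichotomy Oc Od) as [G | [G | G]].
    - exists (succ d). split; [auto |]. pose proof (ordinal_succ Od) as Os.
      split; apply mem_V_of_subset with d; auto using mem_succ.
      apply subset_trans with (V c); [exact Gx | exact (V_mono Od G)].
    - subst d. exists (succ c). split; [auto |]. pose proof (ordinal_succ Od) as Os.
      split; apply mem_V_of_subset with c; auto using mem_succ.
    - exists (succ c). split; [auto |]. pose proof (ordinal_succ Oc) as Os.
      split; apply mem_V_of_subset with c; auto using mem_succ.
      apply subset_trans with (V d); [exact Gy | exact (V_mono Oc G)]. }
  destruct G as [m [Hm [G1 G2]]].
  apply (V_mono Ha (Hs _ (Hs _ Hm))). apply pair_in_V; auto. exact (ordinal_mem Ha Hm).
Qed.
(** * Coded formulas *)

Lemma limit_omega : limit omega.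
Proof.
  split; [apply ordinal_omega |]. split; [exists emp; apply omega_iff, is_nat_emp |].
  intros b. rewrite !omega_iff. apply is_nat_succ.
Qed.

Lemma nat_in_V_omega (k : U) : is_nat E k -> k ∈ V omega.
Proof.
  intros H. apply ordinal_V_iff; [apply ordinal_omega | apply H | apply omega_iff, H].
Qed.

Definition c1 (k : nat) (x : U) : U := pair (num k) x.
Definition c2 (k : nat) (x y : U) : U := pair (num k) (pair x y).

Lemma c1_inj (k j : nat) (x y : U) : c1 k x = c1 j y -> k = j /\ x = y.
Proof. intros H. apply pair_inj in H as [H1 H2]. apply num_inj in H1. auto. Qed.

Lemma c2_inj (k j : nat) (x y x' y' : U) :
  c2 k x y = c2 j x' y' -> k = j /\ x = x' /\ y = y'.
Proof. intros H. apply c1_inj in H as [H1 H2]. apply pair_inj in H2 as [H2 H3]. auto. Qed.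

Lemma code1_iff (k : nat) (c x : U) : code1 E k c x <-> c = c1 k x.
Proof.
  split.
  - intros [t [Ht Hc]]. apply is_numeral_iff in Ht. apply is_pair_iff in Hc. subst. reflexivity.
  - intros ->. exists (num k). rewrite is_numeral_iff, is_pair_iff. auto.
Qed.

Lemma code2_iff (k : nat) (c x y : U) : code2 E k c x y <-> c = c2 k x y.
Proof.
  split.
  - intros [q [Hq Hc]]. apply is_pair_iff in Hq. apply code1_iff in Hc. subst. reflexivity.
  - intros ->. exists (pair x y). rewrite code1_iff, is_pair_iff. auto.
Qed.

Definition var (i : U) : U := c1 0 i.
Definition cst (j : nat) : U := c1 1 (num j).

Lemma is_term_iff (k : nat) (m t : U) :
  is_term E k m t <-> (exists i, i ∈ m /\ t = var i) \/ (exists j, j < k /\ t = cst j).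
Proof.
  unfold is_term. split; (intros [[i [Hi Ht]] | H]; [left; exists i | right]).
  - apply code1_iff in Ht. auto.
  - destruct H as [j [x [Hj [Hx Ht]]]]. apply is_numeral_iff in Hx. apply code1_iff in Ht.
    subst. exists j. auto.
  - rewrite code1_iff. auto.
  - destruct H as [j [Hj ->]]. exists j, (num j). rewrite is_numeral_iff, code1_iff. auto.
Qed.

Lemma Def_code1 A k t u : term A t -> term A u -> Def E A (fun e => code1 E k (t e) (u e)).
Proof. intros. unfold code1. dfn. Qed.
#[local] Hint Resolve Def_code1 : dfn.

Lemma Def_eq_c1 A k t u : term A t -> term A u -> Def E A (fun e => t e = c1 k (u e)).
Proof.
  intros. apply Def_ext with (fun e => code1 E k (t e) (u e)); [| dfn].
  intros e. apply code1_iff.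
Qed.

Lemma Def_code2 A k t u v : term A t -> term A u -> term A v ->
  Def E A (fun e => code2 E k (t e) (u e) (v e)).
Proof. intros. unfold code2. dfn. Qed.
#[local] Hint Resolve Def_code2 : dfn.

Lemma Def_eq_c2 A k t u v : term A t -> term A u -> term A v ->
  Def E A (fun e => t e = c2 k (u e) (v e)).
Proof.
  intros. apply Def_ext with (fun e => code2 E k (t e) (u e) (v e)); [| dfn].
  intros e. apply code2_iff.
Qed.
#[local] Hint Resolve Def_eq_c1 Def_eq_c2 : dfn.

(** The bound [k] is an external number, so the quantifier is a finite disjunction. *)
Lemma Def_ex_lt A (k : nat) (P : nat -> (nat -> U) -> Prop) :
  (forall j, Def E A (P j)) -> Def E A (fun e => exists j, j < k /\ P j e).
Proof.
  intros H. induction k as [| k IH].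
  - apply Def_ext with (fun _ => False); [| apply Def_false].
    intros e. split; [tauto |]. intros [j [Hj _]]. lia.
  - apply Def_ext with (fun e => (exists j, j < k /\ P j e) \/ P k e); [| dfn; auto].
    intros e. split.
    + intros [[j [Hj HP]] | HP]; [exists j | exists k]; split; auto; lia.
    + intros [j [Hj HP]]. destruct (Nat.eq_dec j k) as [-> | N]; [auto |].
      left. exists j. split; [lia | exact HP].
Qed.

Lemma Def_is_term A k t u : term A t -> term A u -> Def E A (fun e => is_term E k (t e) (u e)).
Proof.
  intros. unfold is_term.
  apply Def_or; [dfn |].
  apply Def_ext with (fun e => exists j, j < k /\ exists x, is_numeral E j x /\ code1 E 1 (u e) x).
  - intros e. split; intros [j H']; exists j.
    + destruct H' as [Hj [x Hx]]. exists x. tauto.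
    + destruct H' as [x Hx]. split; [tauto |]. exists x. tauto.
  - apply Def_ex_lt. intros j. dfn.
Qed.
#[local] Hint Resolve Def_is_term : dfn.

Lemma Def_formula_closed A k t : term A t -> Def E A (fun e => formula_closed E k (t e)).
Proof. intros. unfold formula_closed. dfn. Qed.
#[local] Hint Resolve Def_formula_closed : dfn.

Lemma Def_is_formula A k t u : term A t -> term A u ->
  Def E A (fun e => is_formula E k (t e) (u e)).
Proof. intros. unfold is_formula. dfn. Qed.
#[local] Hint Resolve Def_is_formula : dfn.

Section Formulas.

Variable k : nat.
Local Notation fml := (is_formula E k).

Lemma is_formula_mem m t u : is_nat E m -> is_term E k m t -> is_term E k m u ->
  fml m (c2 0 t u).
Proof.
  intros Hm Ht Hu. split; [exact Hm |]. intros F HF.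
  apply (proj1 (HF m Hm) t u); auto. apply code2_iff. reflexivity.
Qed.

Lemma is_formula_eq m t u : is_nat E m -> is_term E k m t -> is_term E k m u ->
  fml m (c2 1 t u).
Proof.
  intros Hm Ht Hu. split; [exact Hm |]. intros F HF.
  apply (proj1 (proj2 (HF m Hm)) t u); auto. apply code2_iff. reflexivity.
Qed.

Lemma is_formula_not m p : fml m p -> fml m (c1 2 p).
Proof.
  intros [Hm Hp]. split; [exact Hm |]. intros F HF.
  apply (proj1 (proj2 (proj2 (HF m Hm))) p); auto. apply code1_iff. reflexivity.
Qed.

Lemma is_formula_and m p q : fml m p -> fml m q -> fml m (c2 3 p q).
Proof.
  intros [Hm Hp] [_ Hq]. split; [exact Hm |]. intros F HF.
  apply (proj1 (proj2 (proj2 (proj2 (HF m Hm)))) p q); auto. apply code2_iff. reflexivity.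
Qed.

Lemma is_formula_ex m p : is_nat E m -> fml (succ m) p -> fml m (c1 4 p).
Proof.
  intros Hm [_ Hp]. split; [exact Hm |]. intros F HF.
  apply (proj2 (proj2 (proj2 (proj2 (HF m Hm)))) p _ (succ m)); auto.
  - apply is_succ_iff. reflexivity.
  - apply code1_iff. reflexivity.
Qed.

Lemma num_in_V_omega n : num n ∈ V omega.
Proof. apply nat_in_V_omega, is_nat_num. Qed.

Lemma c1_in_V_omega n x : x ∈ V omega -> c1 n x ∈ V omega.
Proof. intros Hx. apply limit_pair; [apply limit_omega | apply num_in_V_omega | exact Hx]. Qed.

Lemma c2_in_V_omega n x y : x ∈ V omega -> y ∈ V omega -> c2 n x y ∈ V omega.
Proof. intros Hx Hy. apply c1_in_V_omega, limit_pair; auto using limit_omega. Qed.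

Lemma is_term_in_V_omega m t : is_nat E m -> is_term E k m t -> t ∈ V omega.
Proof.
  intros Hm Ht. apply is_term_iff in Ht as [[i [Hi ->]] | [j [_ ->]]]; apply c1_in_V_omega.
  - exact (nat_in_V_omega (is_nat_mem Hm Hi)).
  - apply num_in_V_omega.
Qed.

(** Formulas are what all closed sets have in common, so it is enough that the formulas with
    property [P] form a closed set. They form a set by separation, because all codes lie in
    [V omega]. *)
Lemma formula_ind (P : U -> U -> Prop) : DEF (fun e => P (e 0) (e 1)) ->
  (forall m t u, is_nat E m -> is_term E k m t -> is_term E k m u -> P m (c2 0 t u)) ->
  (forall m t u, is_nat E m -> is_term E k m t -> is_term E k m u -> P m (c2 1 t u)) ->
  (forall m p, fml m p -> P m p -> P m (c1 2 p)) ->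
  (forall m p q, fml m p -> fml m q -> P m p -> P m q -> P m (c2 3 p q)) ->
  (forall m p, is_nat E m -> fml (succ m) p -> P (succ m) p -> P m (c1 4 p)) ->
  forall m c, fml m c -> P m c.
Proof.
  intros HP H0 H1 H2 H3 H4 m c [Hm Hc].
  destruct (@separation (fun z => exists m c, z = pair m c /\ fml m c /\ P m c))
    with (x := V omega) as [F HF].
  { dfn. exact (Def_comp2 P HP (term_var _ 1) (term_var _ 0)). }
  assert (G : forall m c, maps E F m c <-> c ∈ V omega /\ fml m c /\ P m c).
  { clear m c Hm Hc. intros m c. rewrite maps_iff, HF. split.
    - intros [Hz [m' [c' [Hp HPc]]]]. apply pair_inj in Hp as [<- <-]. split; [| exact HPc].
      assert (Hv : upair m c ∈ V omega).
      { apply (V_transitive ordinal_omega Hz). apply upair_iff. auto. }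
      apply (V_transitive ordinal_omega Hv). apply upair_iff. auto.
    - intros [Hc [Hf Hp]]. split; [| exists m, c; auto].
      apply limit_pair; [apply limit_omega | apply nat_in_V_omega, Hf | exact Hc]. }
  apply (G m c), Hc. clear m c Hm Hc. intros m Hm.
  split; [| split; [| split; [| split]]].
  - intros t u c Ht Hu Hc. apply code2_iff in Hc. subst. apply G.
    split; [| split; [apply is_formula_mem | apply H0]; assumption].
    apply c2_in_V_omega; eapply is_term_in_V_omega; eassumption.
  - intros t u c Ht Hu Hc. apply code2_iff in Hc. subst. apply G.
    split; [| split; [apply is_formula_eq | apply H1]; assumption].
    apply c2_in_V_omega; eapply is_term_in_V_omega; eassumption.
  - intros p c Hp Hc. apply code1_iff in Hc. subst. apply G in Hp as [K1 [K2 K3]]. apply G.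
    auto using c1_in_V_omega, is_formula_not.
  - intros p q c Hp Hq Hc. apply code2_iff in Hc. subst.
    apply G in Hp as [K1 [K2 K3]]. apply G in Hq as [K4 [K5 K6]]. apply G.
    auto using c2_in_V_omega, is_formula_and.
  - intros p c m' Hs Hp Hc. apply code1_iff in Hc. apply is_succ_iff in Hs. subst.
    apply G in Hp as [K1 [K2 K3]]. apply G.
    auto using c1_in_V_omega, is_formula_ex.
Qed.

Lemma is_formula_in_V_omega m c : fml m c -> c ∈ V omega.
Proof.
  revert m c. apply (@formula_ind (fun _ c => c ∈ V omega)); [dfn | | | | |]; intros;
    eauto using c1_in_V_omega, c2_in_V_omega, is_term_in_V_omega.
Qed.

End Formulas.

(** * Satisfaction classes *)

Lemma is_fun_iff (f a b : U) : is_fun E f (fun x => x ∈ a) (fun y => y ∈ b) <->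
  (forall p, p ∈ f -> exists x y, x ∈ a /\ y ∈ b /\ p = pair x y) /\
  (forall x, x ∈ a -> exists y, pair x y ∈ f) /\
  (forall x y y', pair x y ∈ f -> pair x y' ∈ f -> y = y').
Proof.
  split.
  - intros [H1 H2].
    assert (G : forall p, p ∈ f -> exists x y, x ∈ a /\ y ∈ b /\ p = pair x y).
    { intros p Hp. destruct (H1 p Hp) as [x [y [Hx [Hy Hxy]]]].
      exists x, y. rewrite <- is_pair_iff. auto. }
    split; [exact G | split].
    + intros x Hx. destruct (H2 x Hx) as [y [Hy _]]. exists y. apply maps_iff, Hy.
    + intros x y y' Hy Hy'. destruct (G _ Hy) as [x0 [y0 [Hx [_ Hp]]]].
      apply pair_inj in Hp as [<- _]. destruct (H2 x Hx) as [z [_ Hz]].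
      transitivity z; [symmetry |]; apply Hz, maps_iff; assumption.
  - intros [H1 [H2 H3]]. split.
    + intros p Hp. destruct (H1 p Hp) as [x [y H]]. exists x, y.
      rewrite is_pair_iff. exact H.
    + intros x Hx. destruct (H2 x Hx) as [y Hy]. exists y. split; [apply maps_iff, Hy |].
      intros y' Hy'. apply maps_iff in Hy'. exact (H3 x y y' Hy Hy').
Qed.

Definition seq (A m s : U) : Prop := is_fun E s (fun i => i ∈ m) (fun x => x ∈ A).

Lemma seq_dom_unique (A B m m' s : U) : seq A m s -> seq B m' s -> m = m'.
Proof.
  assert (G : forall A B m m', seq A m s -> seq B m' s -> subset E m m').
  { clear A B m m'. intros A B m m' H H' i Hi. apply is_fun_iff in H, H'.
    destruct (proj1 (proj2 H) i Hi) as [x Hx].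
    destruct (proj1 H' _ Hx) as [j [y [Hj [_ Hp]]]]. apply pair_inj in Hp as [-> _]. exact Hj. }
  intros H H'. apply subset_antisym; [exact (G A B m m' H H') | exact (G B A m' m H' H)].
Qed.

Lemma is_snoc_iff (s' s m x : U) : is_snoc E s' s m x <-> s' = union s (sing (pair m x)).
Proof.
  split.
  - intros H. apply extensionality. intros p. rewrite (H p), union_iff, sing_iff, is_pair_iff.
    reflexivity.
  - intros -> p. rewrite union_iff, sing_iff, is_pair_iff. reflexivity.
Qed.

Definition snoc (s m x : U) : U := union s (sing (pair m x)).

Lemma snoc_seq (A m s x : U) : seq A m s -> x ∈ A -> seq A (succ m) (snoc s m x).
Proof.
  intros H Hx. apply is_fun_iff in H as [H1 [H2 H3]]. unfold snoc. apply is_fun_iff.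
  assert (G : forall y, ~ pair m y ∈ s).
  { intros y Hy. destruct (H1 _ Hy) as [i [z [Hi [_ Hp]]]]. apply pair_inj in Hp as [<- _].
    exact (foundation_irrefl Hi). }
  split; [| split].
  - intros p Hp. apply union_iff in Hp as [Hp | Hp].
    + destruct (H1 p Hp) as [i [y [Hi [Hy ->]]]]. exists i, y. rewrite succ_iff. auto.
    + apply sing_iff in Hp as ->. exists m, x. rewrite succ_iff. auto.
  - intros i Hi. apply succ_iff in Hi as [Hi | ->].
    + destruct (H2 i Hi) as [y Hy]. exists y. apply union_iff. auto.
    + exists x. apply union_iff. right. apply sing_iff. reflexivity.
  - intros i y y' Hy Hy'. apply union_iff in Hy, Hy'. rewrite sing_iff in Hy, Hy'.
    destruct Hy as [Hy | Hy]; destruct Hy' as [Hy' | Hy'].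
    + exact (H3 i y y' Hy Hy').
    + apply pair_inj in Hy' as [-> _]. destruct (G _ Hy).
    + apply pair_inj in Hy as [-> _]. destruct (G _ Hy').
    + apply pair_inj in Hy as [_ ->]. apply pair_inj in Hy' as [_ ->]. reflexivity.
Qed.

(** An assignment consists of pairs from a level that contains the natural numbers and the elements
    of [A]. The bound allows sets of assignments to be formed by separation. *)
Lemma seq_bound (A : U) : exists B, forall m s, is_nat E m -> seq A m s -> s ∈ B.
Proof.
  destruct (mem_some_V (pair omega A)) as [b [Hb Hp]].
  exists (V (succ (succ (succ b)))). intros m s Hm Hs.
  pose proof (ordinal_succ Hb) as Hb1. pose proof (ordinal_succ Hb1) as Hb2.
  assert (Ho : upair omega A ∈ V b).
  { apply (V_transitive Hb Hp). apply upair_iff. auto. }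
  apply mem_V_of_subset with (succ (succ b)); [apply ordinal_succ, Hb2 | apply mem_succ |].
  intros z Hz. apply is_fun_iff in Hs as [Hs _].
  destruct (Hs z Hz) as [i [x [Hi [Hx ->]]]].
  apply pair_in_V; [exact Hb | |].
  - apply (V_transitive Hb (y := omega)).
    + apply (V_transitive Hb Ho). apply upair_iff. auto.
    + apply omega_iff, (is_nat_mem Hm Hi).
  - apply (V_transitive Hb (y := A)); [| exact Hx].
    apply (V_transitive Hb Ho). apply upair_iff. auto.
Qed.

Lemma Def_seq A t u v : term A t -> term A u -> term A v ->
  Def E A (fun e => seq (t e) (u e) (v e)).
Proof. intros. unfold seq. dfn. Qed.

Lemma Def_is_snoc A t u v w : term A t -> term A u -> term A v -> term A w ->
  Def E A (fun e => is_snoc E (t e) (u e) (v e) (w e)).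
Proof. intros. unfold is_snoc. dfn. Qed.
#[local] Hint Resolve Def_seq Def_is_snoc : dfn.

Lemma term_val_iff (cs : list U) (s t x : U) : term_val E cs s t x <->
  (exists i, t = var i /\ pair i x ∈ s) \/ (exists j, j < length cs /\ t = cst j /\ nth_error cs j = Some x).
Proof.
  unfold term_val. split; (intros [[i [H1 H2]] | H]; [left; exists i | right]).
  - apply code1_iff in H1. apply maps_iff in H2. auto.
  - destruct H as [j [z [H1 [H2 H3]]]]. apply is_numeral_iff in H1. apply code1_iff in H2.
    subst. exists j. split; [| auto]. apply nth_error_Some. rewrite H3. discriminate.
  - rewrite code1_iff, maps_iff. auto.
  - destruct H as [j [_ [-> H]]]. exists j, (num j). rewrite is_numeral_iff, code1_iff. auto.
Qed.

Lemma Def_term_val (A : U -> Prop) cs t u v : Forall A cs -> term A t -> term A u -> term A v ->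
  Def E A (fun e => term_val E cs (t e) (u e) (v e)).
Proof.
  intros Hcs Ht Hu Hv.
  apply Def_ext with (fun e => (exists i, u e = c1 0 i /\ pair i (v e) ∈ t e) \/
    exists j, j < length cs /\ ((exists z, is_numeral E j z /\ u e = c1 1 z) /\
      nth_error cs j = Some (v e))).
  - intros e. rewrite term_val_iff. apply or_iff_compat_l.
    split; intros [j [H1 [H2 H3]]]; exists j; (split; [exact H1 |]; split; [| exact H3]).
    + destruct H2 as [z [Hz ->]]. apply is_numeral_iff in Hz as ->. reflexivity.
    + exists (num j). rewrite is_numeral_iff. auto.
  - apply Def_or; [dfn |]. apply Def_ex_lt. intros j. apply Def_and; [dfn |].
    destruct (nth_error cs j) as [y |] eqn:Hj.
    + apply Def_ext with (fun e => v e = y).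
      * intros e. split; [intros ->; reflexivity | intros H; injection H; auto].
      * apply Def_eq; [exact Hv |]. apply term_const.
        rewrite Forall_forall in Hcs. apply Hcs. eapply nth_error_In, Hj.
    + apply Def_ext with (fun _ => False); [| apply Def_false].
      intros e. split; [tauto | discriminate].
Qed.
Lemma bigger_V (x a : U) : ordinal E a -> exists b, ordinal E b /\ x ∈ V b /\ subset E (V a) (V b).
Proof.
  intros Ha. destruct (mem_some_V (pair x a)) as [b [Hb Hp]]. exists b.
  assert (Hu : upair x a ∈ V b) by (apply (V_transitive Hb Hp), upair_iff; auto).
  split; [exact Hb |]. split.
  - apply (V_transitive Hb Hu), upair_iff. auto.
  - apply V_mono; [exact Hb |]. apply (ordinal_V_iff Hb Ha).
    apply (V_transitive Hb Hu), upair_iff. auto.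
Qed.

Section Satisfaction.

Variables (A : U) (cs : list U).
Local Notation k := (length cs).
Local Notation fml := (is_formula E k).

Definition atom_mem (s t u : U) : Prop :=
  exists x y, term_val E cs s t x /\ term_val E cs s u y /\ x ∈ y.

Definition atom_eq (s t u : U) : Prop :=
  exists x y, term_val E cs s t x /\ term_val E cs s u y /\ x = y.

Lemma Forall_everything (l : list U) : Forall (@everything U) l.
Proof. apply Forall_forall. intros x _. exact I. Qed.

Lemma Def_atom_mem t u v : term (@everything U) t -> term (@everything U) u ->
  term (@everything U) v -> DEF (fun e => atom_mem (t e) (u e) (v e)).
Proof.
  intros. unfold atom_mem. dfn; apply Def_term_val; auto using Forall_everything with dfn.
Qed.

Lemma Def_atom_eq t u v : term (@everything U) t -> term (@everything U) u ->
  term (@everything U) v -> DEF (fun e => atom_eq (t e) (u e) (v e)).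
Proof.
  intros. unfold atom_eq. dfn; apply Def_term_val; auto using Forall_everything with dfn.
Qed.
#[local] Hint Resolve Def_atom_mem Def_atom_eq : dfn.

Definition is_triple (z m c X : U) : Prop := exists q, z = pair m q /\ q = pair c X.
Definition triple (m c X : U) : U := pair m (pair c X).

Lemma is_triple_iff z m c X : is_triple z m c X <-> z = triple m c X.
Proof.
  split; [intros [q [-> ->]]; reflexivity | intros ->]. exists (pair c X). split; reflexivity.
Qed.

Lemma triple_inj m c X m' c' X' :
  triple m c X = triple m' c' X' -> m = m' /\ c = c' /\ X = X'.
Proof. intros H. apply pair_inj in H as [H1 H]. apply pair_inj in H as [H2 H]. auto. Qed.

Lemma Def_triple_mem D t u v w : term D t -> term D u -> term D v -> term D w ->
  Def E D (fun e => triple (u e) (v e) (w e) ∈ t e).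
Proof.
  intros. apply Def_ext with (fun e => exists z, is_triple z (u e) (v e) (w e) /\ z ∈ t e).
  - intros e. split.
    + intros [z [Hz H']]. apply is_triple_iff in Hz as ->. exact H'.
    + intros H'. exists (triple (u e) (v e) (w e)). rewrite is_triple_iff. auto.
  - unfold is_triple. dfn.
Qed.
#[local] Hint Resolve Def_triple_mem : dfn.

(* One step of the computation of the set X of the assignments that satisfy the
   formula c in context m, from the triples already in Z. *)
Definition step (Z m c X : U) : Prop :=
  (exists t u, c = c2 0 t u /\ forall s, s ∈ X <-> seq A m s /\ atom_mem s t u) \/
  (exists t u, c = c2 1 t u /\ forall s, s ∈ X <-> seq A m s /\ atom_eq s t u) \/
  (exists p Y, c = c1 2 p /\ triple m p Y ∈ Z /\
     forall s, s ∈ X <-> seq A m s /\ ~ s ∈ Y) \/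
  (exists p q Y Y', c = c2 3 p q /\ triple m p Y ∈ Z /\ triple m q Y' ∈ Z /\
     forall s, s ∈ X <-> seq A m s /\ s ∈ Y /\ s ∈ Y') \/
  (exists p Y m', c = c1 4 p /\ m' = succ m /\ triple m' p Y ∈ Z /\
     forall s, s ∈ X <-> seq A m s /\ exists x s', x ∈ A /\ is_snoc E s' s m x /\ s' ∈ Y).

Lemma Def_step t u v w : term (@everything U) t -> term (@everything U) u ->
  term (@everything U) v -> term (@everything U) w ->
  DEF (fun e => step (t e) (u e) (v e) (w e)).
Proof. intros. unfold step. dfn. Qed.
#[local] Hint Resolve Def_step : dfn.

(** The clause for negation is monotone as well: the complement is taken of the complete set [Y]
    recorded for the subformula, and [Z] itself occurs only positively. *)
Lemma step_mono Z Z' m c X : subset E Z Z' -> step Z m c X -> step Z' m c X.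
Proof.
  intros HZZ [H | [H | [H | [H | H]]]]; unfold step.
  - tauto.
  - tauto.
  - do 2 right. left. destruct H as [p [Y [H1 [H2 H3]]]]. exists p, Y. auto.
  - do 3 right. left. destruct H as [p [q [Y [Y' [H1 [H2 [H3 H4]]]]]]]. exists p, q, Y, Y'. auto.
  - do 4 right. destruct H as [p [Y [m' [H1 [H2 [H3 H4]]]]]]. exists p, Y, m'. auto.
Qed.

Lemma step_seq Z m c X s : step Z m c X -> s ∈ X -> seq A m s.
Proof.
  intros [H | [H | [H | [H | H]]]] Hs.
  - destruct H as [t [u [_ H]]]. apply H, Hs.
  - destruct H as [t [u [_ H]]]. apply H, Hs.
  - destruct H as [p [Y [_ [_ H]]]]. apply H, Hs.
  - destruct H as [p [q [Y [Y' [_ [_ [_ H]]]]]]]. apply H, Hs.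
  - destruct H as [p [Y [m' [_ [_ [_ H]]]]]]. apply H, Hs.
Qed.

(** [T] is the least set closed under [step], an intersection taken inside a bounding set. The
    elements of [T] that come from a step form a closed set too, hence there are no others. *)
Lemma step_fixpoint : exists T, forall m c X,
  triple m c X ∈ T <-> is_nat E m /\ c ∈ V omega /\ step T m c X.
Proof.
  destruct (seq_bound A) as [B HB].
  destruct (bigger_V B ordinal_omega) as [b [Hb [HBb Hob]]].
  set (closed := fun Z => forall m c X, is_nat E m -> c ∈ V omega -> step Z m c X ->
    triple m c X ∈ Z).
  (* Any [X] produced by a step is a set of assignments, so it is included in [B], and all triples
     lie in one level. *)
  assert (HW : exists W, forall Z m c X, is_nat E m -> c ∈ V omega -> step Z m c X ->
    triple m c X ∈ W).
  { exists (V (succ (succ (succ (succ b))))). intros Z m c X Hm Hc Hst.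
    assert (HX : X ∈ V b).
    { apply (V_subset Hb HBb). intros s Hs. apply (HB m); [exact Hm |].
      exact (step_seq Hst Hs). }
    pose proof (ordinal_succ Hb) as Hb1. pose proof (ordinal_succ Hb1) as Hb2.
    apply pair_in_V; [exact Hb2 | | apply pair_in_V; [exact Hb | exact (Hob c Hc) | exact HX]].
    apply (V_mono Hb2 (mem_succ _)), (V_mono Hb1 (mem_succ _)).
    apply Hob, nat_in_V_omega, Hm. }
  destruct HW as [W HW].
  destruct (@separation (fun z => forall Z, closed Z -> z ∈ Z)) with (x := W) as [T HT].
  { unfold closed. dfn. }
  assert (Sub : forall Z, closed Z -> subset E T Z).
  { intros Z HZ' z Hz. apply HT in Hz as [_ Hz]. apply Hz, HZ'. }
  assert (CT : closed T).
  { intros m c X Hm Hc Hst. apply HT. split; [exact (HW T m c X Hm Hc Hst) |].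
    intros Z HZ'. apply HZ'; [exact Hm | exact Hc |]. exact (step_mono (Sub Z HZ') Hst). }
  destruct (@separation (fun z => exists m c X, is_triple z m c X /\
    is_nat E m /\ c ∈ V omega /\ step T m c X)) with (x := T) as [T' HT'].
  { unfold is_triple. dfn. }
  assert (CT' : closed T').
  { assert (Sub' : subset E T' T) by (intros z Hz; apply HT', Hz).
    intros m c X Hm Hc Hst. apply (step_mono Sub') in Hst.
    apply HT'. split; [exact (CT m c X Hm Hc Hst) |].
    exists m, c, X. rewrite is_triple_iff. auto. }
  exists T. intros m c X. split; [| intros [H1 [H2 H3]]; exact (CT m c X H1 H2 H3)].
  intros H. apply (Sub T' CT'), HT' in H as [_ [m' [c' [X' [H1 H2]]]]].
  apply is_triple_iff, triple_inj in H1 as [-> [-> ->]]. exact H2.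
Qed.

Ltac code_clash := match goal with
  | H : c1 _ _ = c1 _ _ |- _ => apply c1_inj in H as [H _]; discriminate H
  | H : c1 _ _ = c2 _ _ _ |- _ => apply c1_inj in H as [H _]; discriminate H
  | H : c2 _ _ _ = c1 _ _ |- _ => apply c1_inj in H as [H _]; discriminate H
  | H : c2 _ _ _ = c2 _ _ _ |- _ => apply c2_inj in H as [H _]; discriminate H
  end.

(** By induction on codes, [T] attaches exactly one set of assignments to each formula. This
    uniqueness turns the clauses of [step] into Tarski's equivalences. *)
Lemma tarski_exists : exists S, tarski E A cs S.
Proof.
  destruct step_fixpoint as [T HT]. destruct (seq_bound A) as [B HB].
  assert (Sep : forall m P, is_nat E m -> DEF (fun e => P (e 0)) -> exists X, forall s,
    s ∈ X <-> seq A m s /\ P s).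
  { intros m P Hm HP. destruct (@separation (fun s => seq A m s /\ P s)) with (x := B) as [X HX].
    - dfn.
    - exists X. intros s. rewrite HX. split; [tauto |]. intros H. split; [| exact H].
      apply (HB m); tauto. }
  assert (I0 : forall m t u X, triple m (c2 0 t u) X ∈ T ->
    forall s, s ∈ X <-> seq A m s /\ atom_mem s t u).
  { intros m t u X H. apply HT in H as [_ [_ [H | [H | [H | [H | H]]]]]].
    - destruct H as [t' [u' [H1 H2]]]. apply c2_inj in H1 as [_ [-> ->]]. exact H2.
    - destruct H as [t' [u' [H1 H2]]]. code_clash.
    - destruct H as [p [Y [H1 _]]]. code_clash.
    - destruct H as [p [q [Y [Y' [H1 _]]]]]. code_clash.
    - destruct H as [p [Y [m' [H1 _]]]]. code_clash. }
  assert (I1 : forall m t u X, triple m (c2 1 t u) X ∈ T ->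
    forall s, s ∈ X <-> seq A m s /\ atom_eq s t u).
  { intros m t u X H. apply HT in H as [_ [_ [H | [H | [H | [H | H]]]]]].
    - destruct H as [t' [u' [H1 H2]]]. code_clash.
    - destruct H as [t' [u' [H1 H2]]]. apply c2_inj in H1 as [_ [-> ->]]. exact H2.
    - destruct H as [p [Y [H1 _]]]. code_clash.
    - destruct H as [p [q [Y [Y' [H1 _]]]]]. code_clash.
    - destruct H as [p [Y [m' [H1 _]]]]. code_clash. }
  assert (I2 : forall m p X, triple m (c1 2 p) X ∈ T -> exists Y, triple m p Y ∈ T /\
    forall s, s ∈ X <-> seq A m s /\ ~ s ∈ Y).
  { intros m p X H. apply HT in H as [_ [_ [H | [H | [H | [H | H]]]]]].
    - destruct H as [t' [u' [H1 H2]]]. code_clash.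
    - destruct H as [t' [u' [H1 H2]]]. code_clash.
    - destruct H as [p' [Y [H1 H2]]]. apply c1_inj in H1 as [_ ->]. exists Y. exact H2.
    - destruct H as [p' [q [Y [Y' [H1 _]]]]]. code_clash.
    - destruct H as [p' [Y [m' [H1 _]]]]. code_clash. }
  assert (I3 : forall m p q X, triple m (c2 3 p q) X ∈ T -> exists Y Y',
    triple m p Y ∈ T /\ triple m q Y' ∈ T /\
    forall s, s ∈ X <-> seq A m s /\ s ∈ Y /\ s ∈ Y').
  { intros m p q X H. apply HT in H as [_ [_ [H | [H | [H | [H | H]]]]]].
    - destruct H as [t' [u' [H1 H2]]]. code_clash.
    - destruct H as [t' [u' [H1 H2]]]. code_clash.
    - destruct H as [p' [Y [H1 H2]]]. code_clash.
    - destruct H as [p' [q' [Y [Y' [H1 H2]]]]]. apply c2_inj in H1 as [_ [-> ->]].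
      exists Y, Y'. exact H2.
    - destruct H as [p' [Y [m' [H1 _]]]]. code_clash. }
  assert (I4 : forall m p X, triple m (c1 4 p) X ∈ T -> exists Y, triple (succ m) p Y ∈ T /\
    forall s, s ∈ X <-> seq A m s /\ exists x s', x ∈ A /\ is_snoc E s' s m x /\ s' ∈ Y).
  { intros m p X H. apply HT in H as [_ [_ [H | [H | [H | [H | H]]]]]].
    - destruct H as [t' [u' [H1 H2]]]. code_clash.
    - destruct H as [t' [u' [H1 H2]]]. code_clash.
    - destruct H as [p' [Y [H1 H2]]]. code_clash.
    - destruct H as [p' [q [Y [Y' [H1 _]]]]]. code_clash.
    - destruct H as [p' [Y [m' [H1 [-> H2]]]]]. apply c1_inj in H1 as [_ ->]. exists Y. exact H2. }
  assert (Ex : forall m c, fml m c -> exists! X, triple m c X ∈ T).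
  { apply (@formula_ind k (fun m c => exists! X, triple m c X ∈ T)).
    - dfn.
    - intros m t u Hm Ht Hu.
      destruct (Sep m (fun s => atom_mem s t u) Hm) as [X HX]; [dfn |]. exists X. split.
      + apply HT. split; [exact Hm |].
        split; [apply (@is_formula_in_V_omega k m), is_formula_mem; assumption |].
        left. exists t, u. auto.
      + intros X' HX'. apply extensionality. intros s. rewrite HX, (I0 _ _ _ _ HX'). reflexivity.
    - intros m t u Hm Ht Hu.
      destruct (Sep m (fun s => atom_eq s t u) Hm) as [X HX]; [dfn |]. exists X. split.
      + apply HT. split; [exact Hm |].
        split; [apply (@is_formula_in_V_omega k m), is_formula_eq; assumption |].
        right; left. exists t, u. auto.
      + intros X' HX'. apply extensionality. intros s. rewrite HX, (I1 _ _ _ _ HX'). reflexivity.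
    - intros m p Hp [Y [HY1 HY2]]. pose proof (proj1 Hp) as Hm.
      destruct (Sep m (fun s => ~ s ∈ Y) Hm) as [X HX]; [dfn |]. exists X. split.
      + apply HT. split; [exact Hm |].
        split; [apply (@is_formula_in_V_omega k m), is_formula_not; assumption |].
        do 2 right; left. exists p, Y. auto.
      + intros X' HX'. apply extensionality. intros s. rewrite HX.
        destruct (I2 _ _ _ HX') as [Y' [HY' ->]]. rewrite (HY2 Y' HY'). reflexivity.
    - intros m p q Hp Hq [Y [HY1 HY2]] [Z [HZ1 HZ2]]. pose proof (proj1 Hp) as Hm.
      destruct (Sep m (fun s => s ∈ Y /\ s ∈ Z) Hm) as [X HX]; [dfn |]. exists X. split.
      + apply HT. split; [exact Hm |].
        split; [apply (@is_formula_in_V_omega k m), is_formula_and; assumption |].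
        do 3 right; left. exists p, q, Y, Z. auto.
      + intros X' HX'. apply extensionality. intros s. rewrite HX.
        destruct (I3 _ _ _ _ HX') as [Y' [Z' [HY' [HZ' ->]]]].
        rewrite (HY2 Y' HY'), (HZ2 Z' HZ'). reflexivity.
    - intros m p Hm Hp [Y [HY1 HY2]].
      destruct (Sep m (fun s => exists x s', x ∈ A /\ is_snoc E s' s m x /\ s' ∈ Y) Hm)
        as [X HX]; [dfn |]. exists X. split.
      + apply HT. split; [exact Hm |].
        split; [apply (@is_formula_in_V_omega k m), is_formula_ex; assumption |].
        do 4 right. exists p, Y, (succ m). auto.
      + intros X' HX'. apply extensionality. intros s. rewrite HX.
        destruct (I4 _ _ _ HX') as [Y' [HY' ->]]. rewrite (HY2 Y' HY'). reflexivity. }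
  (* The satisfaction class does not record the context [m]: it is recovered as the domain of the
     assignment. *)
  destruct (@separation (fun z => exists c s, z = pair c s /\ exists m X, triple m c X ∈ T /\ s ∈ X))
    with (x := V (succ (succ (the (bigger_V B ordinal_omega))))) as [S HS]; [dfn |].
  pose proof (the_spec _ (bigger_V B ordinal_omega)) as Hb.
  set (b := the (bigger_V B ordinal_omega)) in *. destruct Hb as [Hb [HBb Hob]].
  assert (HSat : forall m c s X, fml m c -> seq A m s -> triple m c X ∈ T ->
    maps E S c s <-> s ∈ X).
  { intros m c s X Hf Hs HX. rewrite maps_iff, HS. split.
    - intros [_ [c' [s' [Hp [m' [X' [HX' Hs']]]]]]]. apply pair_inj in Hp as [<- <-].
      pose proof (proj2 (proj2 (proj1 (HT _ _ _) HX'))) as Hst.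
      pose proof (seq_dom_unique Hs (step_seq Hst Hs')) as <-.
      destruct (Ex m c Hf) as [X0 [_ HX0]].
      rewrite <- (HX0 X HX), (HX0 X' HX'). exact Hs'.
    - intros Hsx. pose proof (proj1 (HT _ _ _) HX) as [Hm [Hc _]]. split.
      + apply pair_in_V; [exact Hb | exact (Hob c Hc) |].
        apply (V_transitive Hb HBb), (HB m); assumption.
      + exists c, s. split; [reflexivity |]. exists m, X. auto. }
  assert (Get : forall m c, fml m c -> exists X, triple m c X ∈ T).
  { intros m c Hc. destruct (Ex m c Hc) as [X [HX _]]. exists X. exact HX. }
  exists S. intros m s Hm Hs. fold (seq A m s) in Hs.
  split; [| split; [| split; [| split]]].
  - intros t u c Ht Hu Hc. apply code2_iff in Hc. subst c.
    assert (Hf : fml m (c2 0 t u)) by (apply is_formula_mem; assumption).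
    destruct (Get _ _ Hf) as [X HX]. rewrite (HSat _ _ _ _ Hf Hs HX), (I0 _ _ _ _ HX).
    unfold atom_mem. tauto.
  - intros t u c Ht Hu Hc. apply code2_iff in Hc. subst c.
    assert (Hf : fml m (c2 1 t u)) by (apply is_formula_eq; assumption).
    destruct (Get _ _ Hf) as [X HX]. rewrite (HSat _ _ _ _ Hf Hs HX), (I1 _ _ _ _ HX).
    unfold atom_eq. tauto.
  - intros p c Hp Hc. apply code1_iff in Hc. subst c.
    pose proof (is_formula_not Hp) as Hf.
    destruct (Get _ _ Hf) as [X HX]. destruct (I2 _ _ _ HX) as [Y [HY HXY]].
    rewrite (HSat _ _ _ _ Hf Hs HX), (HSat _ _ _ _ Hp Hs HY), HXY. tauto.
  - intros p q c Hp Hq Hc. apply code2_iff in Hc. subst c.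
    pose proof (is_formula_and Hp Hq) as Hf.
    destruct (Get _ _ Hf) as [X HX]. destruct (I3 _ _ _ _ HX) as [Y [Y' [HY [HY' HXY]]]].
    rewrite (HSat _ _ _ _ Hf Hs HX), (HSat _ _ _ _ Hp Hs HY), (HSat _ _ _ _ Hq Hs HY'), HXY.
    tauto.
  - intros p c m' Hm' Hp Hc. apply code1_iff in Hc. apply is_succ_iff in Hm'. subst c m'.
    pose proof (is_formula_ex Hm Hp) as Hf.
    destruct (Get _ _ Hf) as [X HX]. destruct (I4 _ _ _ HX) as [Y [HY HXY]].
    rewrite (HSat _ _ _ _ Hf Hs HX), HXY.
    assert (G : forall x s', x ∈ A -> is_snoc E s' s m x -> maps E S p s' <-> s' ∈ Y).
    { intros x s' Hx Hs'. apply is_snoc_iff in Hs' as ->.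
      apply (HSat _ _ _ _ Hp (snoc_seq Hs Hx) HY). }
    split.
    + intros [_ [x [s' [Hx [Hs' H]]]]]. exists x, s'. rewrite (G x s' Hx Hs'). auto.
    + intros [x [s' [Hx [Hs' H]]]]. split; [exact Hs |]. exists x, s'.
      rewrite <- (G x s' Hx Hs'). auto.
Qed.

End Satisfaction.
(** * Codes of external formulas *)

Fixpoint holds_in (D : U -> Prop) (e : nat -> U) (p : form) : Prop :=
  match p with
  | FMem i j => e i ∈ e j
  | FEq i j => e i = e j
  | FNot p => ~ holds_in D e p
  | FAnd p q => holds_in D e p /\ holds_in D e q
  | FEx p => exists x, D x /\ holds_in D (scons x e) p
  end.

(** External environments are infinite, coded assignments finite; [N] tells how much of an
    environment has to be coded. *)
Lemma holds_in_bound (p : form) : exists N, forall D e e',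
  (forall i, i < N -> e i = e' i) -> holds_in D e p <-> holds_in D e' p.
Proof.
  induction p as [i j | i j | p [N IH] | p [N IHp] q [M IHq] | p [N IH]]; simpl.
  - exists (S (i + j)). intros D e e' H. rewrite (H i), (H j) by lia. reflexivity.
  - exists (S (i + j)). intros D e e' H. rewrite (H i), (H j) by lia. reflexivity.
  - exists N. intros D e e' H. rewrite (IH D e e' H). reflexivity.
  - exists (N + M). intros D e e' H.
    rewrite (IHp D e e'), (IHq D e e'); [reflexivity | |]; intros i Hi; apply H; lia.
  - exists N. intros D e e' H.
    assert (G : forall x, holds_in D (scons x e) p <-> holds_in D (scons x e') p).
    { intros x. apply IH. intros [| i] Hi; [reflexivity | apply H; lia]. }
    split; intros [x [Hx Hp]]; exists x; (split; [exact Hx | apply G, Hp]).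
Qed.

Lemma holds_in_ext (p : form) D (e e' : nat -> U) :
  (forall i, e i = e' i) -> holds_in D e p <-> holds_in D e' p.
Proof.
  intros H. replace e' with e by (apply functional_extensionality; exact H). reflexivity.
Qed.

Lemma holds_in_ren (p : form) : forall D r (e : nat -> U),
  holds_in D e (ren r p) <-> holds_in D (fun i => e (r i)) p.
Proof.
  induction p as [i j | i j | p IH | p IHp q IHq | p IH]; intros D r e; simpl.
  - reflexivity.
  - reflexivity.
  - rewrite IH. reflexivity.
  - rewrite IHp, IHq. reflexivity.
  - assert (G : forall x, holds_in D (scons x e) (ren (scons 0 (fun i => S (r i))) p) <->
      holds_in D (scons x (fun i => e (r i))) p).
    { intros x. rewrite IH. apply holds_in_ext. intros [| i]; reflexivity. }
    split; intros [x [Hx Hp]]; exists x; (split; [exact Hx | apply G; exact Hp]).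
Qed.

Inductive index : Type := IVar (i : nat) | ICst (j : nat).

Definition valid (k m : nat) (v : index) : Prop :=
  match v with IVar i => i < m | ICst j => j < k end.

Definition value (cs l : list U) (v : index) : U :=
  match v with IVar i => nth i l emp | ICst j => nth j cs emp end.

Definition index_code (v : index) : U :=
  match v with IVar i => var (num i) | ICst j => cst j end.

(* External formulas use de Bruijn indices, coded ones de Bruijn levels. *)
Fixpoint code (p : form) (v : nat -> index) (m : nat) : U :=
  match p with
  | FMem i j => c2 0 (index_code (v i)) (index_code (v j))
  | FEq i j => c2 1 (index_code (v i)) (index_code (v j))
  | FNot p => c1 2 (code p v m)
  | FAnd p q => c2 3 (code p v m) (code q v m)
  | FEx p => c1 4 (code p (scons (IVar m) v) (S m))
  end.

Lemma index_code_term k m v : valid k m v -> is_term E k (num m) (index_code v).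
Proof.
  intros H. apply is_term_iff. destruct v as [i | j]; simpl in *.
  - left. exists (num i). split; [apply mem_num; exists i; auto | reflexivity].
  - right. exists j. auto.
Qed.

Lemma scons_valid k m v : (forall i, valid k m (v i)) ->
  forall i, valid k (S m) (scons (IVar m) v i).
Proof.
  intros H [| i]; simpl; [lia |]. specialize (H i). destruct (v i); simpl in *; lia.
Qed.

Lemma code_formula k (p : form) : forall v m, (forall i, valid k m (v i)) ->
  is_formula E k (num m) (code p v m).
Proof.
  induction p as [i j | i j | p IH | p IHp q IHq | p IH]; intros v m Hv; simpl.
  - apply is_formula_mem; auto using is_nat_num, index_code_term.
  - apply is_formula_eq; auto using is_nat_num, index_code_term.
  - apply is_formula_not, IH, Hv.
  - apply is_formula_and; [apply IHp | apply IHq]; exact Hv.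
  - apply is_formula_ex; [apply is_nat_num |]. apply (IH _ (S m)), scons_valid, Hv.
Qed.

Fixpoint mkseq (k : nat) (l : list U) : U :=
  match l with
  | [] => emp
  | x :: l => union (sing (pair (num k) x)) (mkseq (S k) l)
  end.

Lemma mkseq_iff (l : list U) : forall k p,
  p ∈ mkseq k l <-> exists j x, nth_error l j = Some x /\ p = pair (num (k + j)) x.
Proof.
  induction l as [| y l IH]; intros k p; simpl.
  - rewrite emp_iff. split; [tauto |]. intros [j [x [H _]]]. destruct j; discriminate.
  - rewrite union_iff, sing_iff, IH. split.
    + intros [-> | [j [x [H ->]]]].
      * exists 0, y. rewrite Nat.add_0_r. auto.
      * exists (S j), x. rewrite Nat.add_succ_r. auto.
    + intros [[| j] [x [H ->]]].
      * left. injection H as ->. rewrite Nat.add_0_r. reflexivity.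
      * right. exists j, x. rewrite Nat.add_succ_r. auto.
Qed.

Lemma mkseq_maps (l : list U) (i : nat) (x : U) :
  pair (num i) x ∈ mkseq 0 l <-> nth_error l i = Some x.
Proof.
  rewrite mkseq_iff. split.
  - intros [j [y [H Hp]]]. apply pair_inj in Hp as [H1 ->]. apply num_inj in H1 as ->. exact H.
  - intros H. exists i, x. auto.
Qed.

Lemma mkseq_seq (A : U) (l : list U) :
  Forall (fun x => x ∈ A) l -> seq A (num (length l)) (mkseq 0 l).
Proof.
  intros H. rewrite Forall_forall in H. apply is_fun_iff. split; [| split].
  - intros p Hp. apply mkseq_iff in Hp as [j [x [Hj ->]]]. exists (num j), x.
    split; [| split; [apply H; eapply nth_error_In, Hj | reflexivity]].
    apply mem_num. exists j. split; [| reflexivity]. apply nth_error_Some. rewrite Hj. discriminate.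
  - intros i Hi. apply mem_num in Hi as [j [Hj ->]].
    destruct (nth_error l j) as [x |] eqn:Hx.
    + exists x. apply mkseq_maps, Hx.
    + apply nth_error_None in Hx. lia.
  - intros i x y Hx Hy. pose proof Hx as Hi. apply mkseq_iff in Hi as [j [z [_ Hp]]].
    apply pair_inj in Hp as [-> _]. simpl in *. apply mkseq_maps in Hx, Hy. congruence.
Qed.

Lemma mkseq_snoc (l : list U) (x : U) :
  snoc (mkseq 0 l) (num (length l)) x = mkseq 0 (l ++ [x]).
Proof.
  apply extensionality. intros p. unfold snoc. rewrite union_iff, sing_iff, !mkseq_iff. split.
  - intros [[j [y [Hj ->]]] | ->].
    + exists j, y. split; [| reflexivity]. rewrite nth_error_app1; [exact Hj |].
      apply nth_error_Some. rewrite Hj. discriminate.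
    + exists (length l), x. split; [| reflexivity].
      rewrite nth_error_app2, Nat.sub_diag by lia. reflexivity.
  - intros [j [y [Hj ->]]]. destruct (Nat.lt_ge_cases j (length l)) as [G | G].
    + left. exists j, y. rewrite nth_error_app1 in Hj by lia. auto.
    + right. rewrite nth_error_app2 in Hj by lia.
      destruct (j - length l) as [| i] eqn:Hi; simpl in Hj.
      * injection Hj as ->. replace j with (length l) by lia. reflexivity.
      * destruct i; discriminate.
Qed.

Lemma index_code_val (cs l : list U) (v : index) (x : U) :
  valid (length cs) (length l) v ->
  term_val E cs (mkseq 0 l) (index_code v) x <-> x = value cs l v.
Proof.
  intros Hv. rewrite term_val_iff. destruct v as [i | j]; simpl in *.
  - split.
    + intros [[a [H1 H2]] | [j [_ [H1 _]]]]; apply c1_inj in H1 as [H0 H1]; [| discriminate].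
      subst. apply mkseq_maps in H2. symmetry. apply nth_error_nth, H2.
    + intros ->. left. exists (num i). split; [reflexivity |]. apply mkseq_maps, nth_error_nth', Hv.
  - split.
    + intros [[a [H1 H2]] | [j' [_ [H1 H2]]]]; apply c1_inj in H1 as [H0 H1]; [discriminate |].
      apply num_inj in H1 as ->. symmetry. apply nth_error_nth, H2.
    + intros ->. right. exists j. split; [exact Hv |]. split; [reflexivity |].
      apply nth_error_nth', Hv.
Qed.

(** Induction on the external formula, with [l] growing at its end: a newly quantified variable gets
    the level [length l], which is the place where the assignment is extended. *)
Lemma code_tarski (A : U) (cs : list U) (S : U) : tarski E A cs S ->
  forall p v l, (forall i, valid (length cs) (length l) (v i)) -> Forall (fun x => x ∈ A) l ->
  maps E S (code p v (length l)) (mkseq 0 l) <->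
  holds_in (fun x => x ∈ A) (fun i => value cs l (v i)) p.
Proof.
  intros HS p.
  induction p as [i j | i j | p IH | p IHp q IHq | p IH]; intros v l Hv Hl; simpl;
    destruct (HS _ _ (is_nat_num (length l)) (mkseq_seq Hl)) as [T0 [T1 [T2 [T3 T4]]]].
  - rewrite (T0 _ _ _ (index_code_term _ _ _ (Hv i)) (index_code_term _ _ _ (Hv j))
      (proj2 (code2_iff _ _ _ _) eq_refl)).
    split.
    + intros [x [y [Hx [Hy H]]]]. apply index_code_val in Hx, Hy; auto. subst. exact H.
    + intros H. exists (value cs l (v i)), (value cs l (v j)).
      rewrite !index_code_val by auto. auto.
  - rewrite (T1 _ _ _ (index_code_term _ _ _ (Hv i)) (index_code_term _ _ _ (Hv j))
      (proj2 (code2_iff _ _ _ _) eq_refl)).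
    split.
    + intros [x [y [Hx [Hy H]]]]. apply index_code_val in Hx, Hy; auto. subst. exact H.
    + intros H. exists (value cs l (v i)), (value cs l (v j)).
      rewrite !index_code_val by auto. auto.
  - rewrite (T2 _ _ (code_formula _ p _ _ Hv) (proj2 (code1_iff _ _ _) eq_refl)).
    rewrite IH by assumption. reflexivity.
  - rewrite (T3 _ _ _ (code_formula _ p _ _ Hv) (code_formula _ q _ _ Hv)
      (proj2 (code2_iff _ _ _ _) eq_refl)).
    rewrite IHp, IHq by assumption. reflexivity.
  - rewrite (T4 _ _ _ (proj2 (is_succ_iff _ _) eq_refl)
      (code_formula _ p _ _ (scons_valid _ _ _ Hv)) (proj2 (code1_iff _ _ _) eq_refl)).
    assert (G : forall x, x ∈ A ->
      maps E S (code p (scons (IVar (length l)) v) (Datatypes.S (length l)))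
        (snoc (mkseq 0 l) (num (length l)) x) <->
      holds_in (fun x => x ∈ A) (scons x (fun i => value cs l (v i))) p).
    { intros x Hx. rewrite mkseq_snoc.
      assert (Hlen : length (l ++ [x]) = Datatypes.S (length l)) by (rewrite length_app; simpl; lia).
      rewrite <- Hlen, IH.
      - apply holds_in_ext. intros [| i]; simpl.
        + rewrite app_nth2, Nat.sub_diag by lia. reflexivity.
        + specialize (Hv i). destruct (v i) as [a | j]; simpl in *; [| reflexivity].
          apply app_nth1, Hv.
      - rewrite Hlen. apply scons_valid, Hv.
      - apply Forall_app. auto. }
    split.
    + intros [x [s' [Hx [Hs' H]]]]. apply is_snoc_iff in Hs' as ->. exists x.
      split; [exact Hx |]. apply (G x Hx), H.
    + intros [x [Hx H]]. exists x, (snoc (mkseq 0 l) (num (length l)) x).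
      rewrite is_snoc_iff. split; [exact Hx |]. split; [reflexivity |]. apply (G x Hx), H.
Qed.

(** On codes of external formulas every satisfaction class computes [holds_in], so it does not
    matter which one witnesses [satisfies]; [tarski_exists] provides one. *)
Lemma code_satisfies (A : U) (cs : list U) (p : form) (v : nat -> index) (l : list U) :
  (forall i, valid (length cs) (length l) (v i)) -> Forall (fun x => x ∈ A) l ->
  satisfies E A cs (code p v (length l)) (mkseq 0 l) <->
  holds_in (fun x => x ∈ A) (fun i => value cs l (v i)) p.
Proof.
  intros Hv Hl. split.
  - intros [S [HS H]]. apply (code_tarski HS p v Hv Hl), H.
  - intros H. destruct (tarski_exists A cs) as [S HS]. exists S. split; [exact HS |].
    apply (code_tarski HS p v Hv Hl), H.
Qed.

Lemma same_theory_holds (A P : U) (cs ds : list U) (p : form) (v : nat -> index) (l : list U) :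
  same_theory E A cs ds P -> length cs = length ds -> subset E P A ->
  (forall i, valid (length cs) (length l) (v i)) -> Forall (fun x => x ∈ P) l ->
  holds_in (fun x => x ∈ A) (fun i => value cs l (v i)) p <->
  holds_in (fun x => x ∈ A) (fun i => value ds l (v i)) p.
Proof.
  intros H Hlen HPA Hv Hl.
  assert (HlA : Forall (fun x => x ∈ A) l).
  { revert Hl. apply Forall_impl. intros x Hx. exact (HPA x Hx). }
  rewrite <- (code_satisfies cs p v Hv HlA).
  rewrite <- (code_satisfies ds p v); [| rewrite <- Hlen; exact Hv | exact HlA].
  apply (H (num (length l))); [apply code_formula, Hv | apply mkseq_seq, Hl].
Qed.
(** * The hierarchy inside its own limit levels *)

Definition FAll (p : form) : form := FNot (FEx (FNot p)).
Definition FImp (p q : form) : form := FNot (FAnd p (FNot q)).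
Definition FIff (p q : form) : form := FAnd (FImp p q) (FImp q p).
Definition FOr (p q : form) : form := FNot (FAnd (FNot p) (FNot q)).
Definition FUpair (p x y : nat) : form :=
  FAll (FIff (FMem 0 (S p)) (FOr (FEq 0 (S x)) (FEq 0 (S y)))).
Definition FPair (p x y : nat) : form :=
  FEx (FEx (FAnd (FUpair 1 (S (S x)) (S (S x)))
    (FAnd (FUpair 0 (S (S x)) (S (S y))) (FUpair (S (S p)) 1 0)))).
Definition FMaps (f x y : nat) : form :=
  FEx (FAnd (FPair 0 (S x) (S y)) (FMem 0 (S f))).
Definition FSubset (x y : nat) : form := FAll (FImp (FMem 0 (S x)) (FMem 0 (S y))).

(* x belongs to the level of index c of the hierarchy: witnessed by any f that
   maps each b to a set of subsets of values of f at elements of b. *)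
Definition FInV (x c : nat) : form :=
  FEx (FAnd
    (FAll (FAll (FImp (FMaps 2 1 0)
      (FAll (FImp (FMem 0 1) (FEx (FAnd (FMem 0 3)
        (FEx (FAnd (FMaps 5 1 0) (FSubset 2 0))))))))))
    (FEx (FAnd (FMaps 1 (S (S c)) 0) (FMem (S (S x)) 0)))).

Fixpoint relativize (c : nat) (p : form) : form :=
  match p with
  | FMem i j => FMem i j
  | FEq i j => FEq i j
  | FNot p => FNot (relativize c p)
  | FAnd p q => FAnd (relativize c p) (relativize c q)
  | FEx p => FEx (FAnd (FInV 0 (S c)) (relativize (S c) p))
  end.

Section HoldsIn.

Variable D : U -> Prop.

Lemma holds_in_FAll e p : holds_in D e (FAll p) <-> forall x, D x -> holds_in D (scons x e) p.
Proof.
  simpl. split.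
  - intros H x Hx. apply NNPP. intros N. apply H. exists x. auto.
  - intros H [x [Hx N]]. apply N, H, Hx.
Qed.

Lemma holds_in_FImp e p q :
  holds_in D e (FImp p q) <-> (holds_in D e p -> holds_in D e q).
Proof. simpl. tauto. Qed.

Lemma holds_in_FIff e p q :
  holds_in D e (FIff p q) <-> (holds_in D e p <-> holds_in D e q).
Proof. simpl. tauto. Qed.

Lemma holds_in_FOr e p q :
  holds_in D e (FOr p q) <-> (holds_in D e p \/ holds_in D e q).
Proof. simpl. tauto. Qed.

Hypothesis HD : forall x y, D x -> y ∈ x -> D y.

Lemma holds_in_FUpair e p x y : D (e p) -> D (e x) -> D (e y) ->
  holds_in D e (FUpair p x y) <-> e p = upair (e x) (e y).
Proof.
  intros Hp Hx Hy. rewrite <- is_upair_iff. unfold FUpair. rewrite holds_in_FAll. split.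
  - intros H z.
    assert (G : D z -> z ∈ e p <-> z = e x \/ z = e y).
    { intros Hz. specialize (H z Hz). rewrite holds_in_FIff, holds_in_FOr in H. exact H. }
    split; intros Hz; apply G; auto.
    + exact (HD Hp Hz).
    + destruct Hz as [-> | ->]; assumption.
  - intros H z Hz. rewrite holds_in_FIff, holds_in_FOr. exact (H z).
Qed.

Lemma holds_in_FPair e p x y : D (e p) -> D (e x) -> D (e y) ->
  holds_in D e (FPair p x y) <-> e p = pair (e x) (e y).
Proof.
  intros Hp Hx Hy. split.
  - intros [u [Hu [v [Hv [H1 [H2 H3]]]]]].
    apply holds_in_FUpair in H1; auto. apply holds_in_FUpair in H2; auto.
    apply holds_in_FUpair in H3; auto. simpl in *. subst. exact H3.
  - intros H.
    assert (Hu : D (upair (e x) (e x))) by (refine (HD Hp _); rewrite H; apply upair_iff; auto).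
    assert (Hv : D (upair (e x) (e y))) by (refine (HD Hp _); rewrite H; apply upair_iff; auto).
    exists (upair (e x) (e x)). split; [exact Hu |].
    exists (upair (e x) (e y)). split; [exact Hv |].
    split; [| split]; apply holds_in_FUpair; auto.
Qed.

Lemma holds_in_FMaps e f x y : D (e f) -> D (e x) -> D (e y) ->
  holds_in D e (FMaps f x y) <-> pair (e x) (e y) ∈ e f.
Proof.
  intros Hf Hx Hy. split.
  - intros [p [Hp [H1 H2]]]. apply holds_in_FPair in H1; auto. simpl in *. subst. exact H2.
  - intros H. assert (Hp : D (pair (e x) (e y))) by exact (HD Hf H).
    exists (pair (e x) (e y)). split; [exact Hp |]. split; [| exact H].
    apply holds_in_FPair; auto.
Qed.

Lemma holds_in_FSubset e x y : D (e x) ->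
  holds_in D e (FSubset x y) <-> subset E (e x) (e y).
Proof.
  intros Hx. unfold FSubset. rewrite holds_in_FAll. split.
  - intros H z Hz. specialize (H z (HD Hx Hz)). rewrite holds_in_FImp in H. exact (H Hz).
  - intros H z _. rewrite holds_in_FImp. exact (H z).
Qed.

Lemma holds_in_FInV e x c : D (e x) -> D (e c) ->
  holds_in D e (FInV x c) <-> exists f, D f /\
    (forall b w y, pair b w ∈ f -> y ∈ w ->
      exists d u, d ∈ b /\ pair d u ∈ f /\ subset E y u) /\
    exists w, pair (e c) w ∈ f /\ e x ∈ w.
Proof.
  intros Hx Hc.
  assert (HP : forall f b w, D f -> pair b w ∈ f -> D b /\ D w).
  { intros f b w Hf Hp.
    assert (Hu : D (upair b w)) by (refine (HD (HD Hf Hp) _); apply upair_iff; auto).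
    split; refine (HD Hu _); apply upair_iff; auto. }
  split; intros [f [Hf [H1 H2]]]; exists f; (split; [exact Hf |]; split).
  - intros b w y Hp Hy. destruct (HP f b w Hf Hp) as [Hb Hw].
    rewrite holds_in_FAll in H1. specialize (H1 b Hb).
    rewrite holds_in_FAll in H1. specialize (H1 w Hw).
    rewrite holds_in_FImp, holds_in_FMaps in H1 by assumption. specialize (H1 Hp).
    rewrite holds_in_FAll in H1. specialize (H1 y (HD Hw Hy)).
    rewrite holds_in_FImp in H1. destruct (H1 Hy) as [d [Hd [Hdb [u [Hu [K1 K2]]]]]].
    exists d, u. rewrite holds_in_FMaps in K1 by assumption.
    rewrite holds_in_FSubset in K2 by exact (HD Hw Hy). auto.
  - destruct H2 as [w [Hw [K1 K2]]]. exists w. rewrite holds_in_FMaps in K1 by assumption. auto.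
  - rewrite holds_in_FAll. intros b Hb. rewrite holds_in_FAll. intros w Hw.
    rewrite holds_in_FImp, holds_in_FMaps by assumption. intros Hp.
    rewrite holds_in_FAll. intros y Hy. rewrite holds_in_FImp. intros Hyw.
    destruct (H1 b w y Hp Hyw) as [d [u [Hdb [K1 K2]]]]. destruct (HP f d u Hf K1) as [Hd Hu].
    exists d. split; [exact Hd |]. split; [exact Hdb |]. exists u. split; [exact Hu |].
    split; [apply holds_in_FMaps | apply holds_in_FSubset]; assumption.
  - destruct H2 as [w [K1 K2]]. destruct (HP f _ w Hf K1) as [_ Hw].
    exists w. split; [exact Hw |]. split; [apply holds_in_FMaps; assumption | exact K2].
Qed.

End HoldsIn.

Lemma limit_succ (b c : U) : limit b -> c ∈ b -> succ c ∈ b.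
Proof. intros [_ [_ H]]. apply H. Qed.

(** By induction on the index, the values of any witness [f] at ordinals are included in the true
    levels. Conversely, the hierarchy up to [e c] is a witness, and it belongs to [V b] because [b]
    is a limit. *)
Lemma FInV_iff (b : U) (e : nat -> U) (x c : nat) : limit b -> e c ∈ b -> e x ∈ V b ->
  holds_in (fun y => y ∈ V b) e (FInV x c) <-> e x ∈ V (e c).
Proof.
  intros Lb Hc Hx. pose proof (proj1 Lb) as Hb.
  assert (HD : forall y z, y ∈ V b -> z ∈ y -> z ∈ V b).
  { intros y z Hy Hz. exact (V_transitive Hb Hy Hz). }
  pose proof (ordinal_mem Hb Hc) as Oc.
  rewrite holds_in_FInV; [| exact HD | exact Hx | apply (ordinal_V_iff Hb Oc), Hc].
  split.
  - intros [f [_ [H1 [w [H2 H3]]]]].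
    assert (G : forall d, ordinal E d -> forall w y, pair d w ∈ f -> y ∈ w ->
      exists v, is_V E d v /\ y ∈ v).
    { apply (@ordinal_ind (fun d => forall w y, pair d w ∈ f -> y ∈ w ->
        exists v, is_V E d v /\ y ∈ v)); [dfn |].
      intros d Hd IH w' y Hp Hy. exists (V d). split; [apply is_V_iff; auto |].
      destruct (H1 d w' y Hp Hy) as [d' [u [Hd' [Hu Hyu]]]].
      apply mem_V_of_subset with d'; [exact Hd | exact Hd' |].
      intros z Hz. destruct (IH d' Hd' u z Hu (Hyu z Hz)) as [v [Hv Hzv]].
      apply is_V_iff in Hv as [_ ->]. exact Hzv. }
    destruct (G (e c) Oc w (e x) H2 H3) as [v [Hv Hxv]]. apply is_V_iff in Hv as [_ ->]. exact Hxv.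
  - intros Hxc. destruct (proj2 (is_V_iff (e c) (V (e c))) (conj Oc eq_refl)) as [_ [f [F1 [F2 F3]]]].
    assert (G : forall d, ordinal E d -> d = e c \/ d ∈ e c -> forall w, maps E f d w ->
      exists v, is_V E d v /\ w = v).
    { apply (@ordinal_ind (fun d => d = e c \/ d ∈ e c -> forall w, maps E f d w ->
        exists v, is_V E d v /\ w = v)); [dfn |].
      intros d Hd IH Hdc w Hw. exists (V d). split; [apply is_V_iff; auto |].
      apply extensionality. intros z. rewrite (F2 d w Hw z), (V_iff z Hd).
      assert (Hlow : forall d', d' ∈ d -> d' ∈ e c).
      { intros d' Hd'. destruct Hdc as [<- | Hdc]; [exact Hd' |].
        exact (ordinal_trans Oc Hd' Hdc). }
      split.
      - intros [d' [u [Hd' [Hu Hz]]]]. exists d'. split; [exact Hd' |].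
        destruct (IH d' Hd' (or_intror (Hlow d' Hd')) u Hu) as [v [Hv ->]].
        apply is_V_iff in Hv as [_ ->]. exact Hz.
      - intros [d' [Hd' Hz]].
        destruct (proj2 F1 d' (or_introl (Hlow d' Hd'))) as [u [Hu _]].
        exists d', u. split; [exact Hd' |]. split; [exact Hu |].
        destruct (IH d' Hd' (or_intror (Hlow d' Hd')) u Hu) as [v [Hv ->]].
        apply is_V_iff in Hv as [_ ->]. exact Hz. }
    exists f. split; [| split].
    + pose proof (ordinal_succ Oc) as O1. pose proof (ordinal_succ O1) as O2.
      pose proof (ordinal_succ O2) as O3.
      (* Both d and its level lie in the level of index [succ (e c)], and their pair two levels
         higher. *)
      apply mem_V_of_subset with (succ (succ (succ (e c)))); [exact Hb | |].
      * do 3 apply (limit_succ Lb). exact Hc.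
      * intros p Hp. destruct (proj1 F1 p Hp) as [d [w [Hd [_ Hdw]]]].
        assert (Hw : maps E f d w) by (exists p; auto).
        apply is_pair_iff in Hdw as ->.
        assert (Od : ordinal E d).
        { destruct Hd as [Hd | ->]; [exact (ordinal_mem Oc Hd) | exact Oc]. }
        assert (Hd' : d = e c \/ d ∈ e c) by tauto.
        destruct (G d Od Hd' w Hw) as [v [Hv ->]]. apply is_V_iff in Hv as [_ ->].
        apply pair_in_V; [exact O1 | |].
        -- apply (ordinal_V_iff O1 Od), succ_iff. tauto.
        -- apply mem_V_of_subset with (e c); [exact O1 | apply mem_succ |].
           apply V_mono_le; assumption.
    + intros d w y Hp Hy. apply maps_iff in Hp.
      destruct (proj1 (F2 d w Hp y) Hy) as [d' [u [Hd' [Hu Hyu]]]].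
      apply maps_iff in Hu. exists d', u. auto.
    + exists (V (e c)). split; [apply maps_iff, F3 | exact Hxc].
Qed.

Lemma relativize_iff (b : U) (p : form) : limit b -> forall (e : nat -> U) (c : nat),
  e c ∈ b -> (forall i, e i ∈ V b) ->
  holds_in (fun y => y ∈ V b) e (relativize c p) <-> holds_in (fun y => y ∈ V (e c)) e p.
Proof.
  intros Lb. induction p as [i j | i j | p IH | p IHp q IHq | p IH]; intros e c Hc He; simpl.
  - reflexivity.
  - reflexivity.
  - rewrite IH by assumption. reflexivity.
  - rewrite IHp, IHq by assumption. reflexivity.
  - assert (G : forall x, x ∈ V b -> holds_in (fun y => y ∈ V b) (scons x e) (FInV 0 (S c)) /\
      holds_in (fun y => y ∈ V b) (scons x e) (relativize (S c) p) <->
      x ∈ V (e c) /\ holds_in (fun y => y ∈ V (e c)) (scons x e) p).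
    { intros x Hx. rewrite FInV_iff; [| exact Lb | exact Hc | exact Hx].
      rewrite IH; [reflexivity | exact Hc |]. intros [| i]; [exact Hx | apply He]. }
    split; intros [x Hx]; exists x.
    + apply (G x (proj1 Hx)), (proj2 Hx).
    + assert (Hxb : x ∈ V b) by exact (V_mono (proj1 Lb) Hc (proj1 Hx)).
      split; [exact Hxb |]. apply (G x Hxb), Hx.
Qed.
(** * Reflection and indiscernibility *)

Section Reflection.

Variables (R : U -> Prop) (n : nat).
Hypothesis HA1 : A1 E R.
Hypothesis HA2 : A2 E R.
Hypothesis HA4 : A4 E R.
Hypothesis HB7a : B7a E R (n + 1).

(** If [R] were bounded by an ordinal, A1 would make it a set, against A4. *)
Lemma R_unbounded (a : U) : ordinal E a -> exists c, R c /\ a ∈ c.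
Proof.
  intros Ha. apply NNPP. intros N. apply HA4.
  destruct (HA1 (succ a)) as [y Hy]. exists y. intros z. rewrite Hy.
  split; [tauto |]. intros Hz. split; [| exact Hz]. apply succ_iff.
  destruct (ordinal_trichotomy Ha (HA2 Hz)) as [G | [G | G]]; [| auto | auto].
  exfalso. apply N. exists z. auto.
Qed.

Lemma R_above (L : list U) : Forall (ordinal E) L ->
  exists c, R c /\ Forall (fun a => a ∈ c) L.
Proof.
  induction L as [| a L IH]; intros HL.
  - destruct (R_unbounded ordinal_emp) as [c [Hc _]]. exists c. auto.
  - apply Forall_cons_iff in HL as [Ha HL]. destruct (IH HL) as [c [Hc Hcl]].
    assert (Hm : exists m, ordinal E m /\ (a = m \/ a ∈ m) /\ (c = m \/ c ∈ m)).
    { destruct (ordinal_trichotomy Ha (HA2 Hc)) as [G | [G | G]];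
        [exists c | exists c | exists a]; auto. }
    destruct Hm as [m [Hm [H1 H2]]].
    destruct (R_unbounded Hm) as [d [Hd Hmd]]. pose proof (HA2 Hd) as Od.
    exists d. split; [exact Hd |]. constructor.
    + destruct H1 as [-> | H1]; [exact Hmd | exact (ordinal_trans Od H1 Hmd)].
    + assert (Hcd : c ∈ d) by (destruct H2 as [-> | H2];
        [exact Hmd | exact (ordinal_trans Od H2 Hmd)]).
      revert Hcl. apply Forall_impl. intros x Hx. exact (ordinal_trans Od Hx Hcd).
Qed.

Lemma Forall_R_ordinal (L : list U) : Forall R L -> Forall (ordinal E) L.
Proof. apply Forall_impl. intros a Ha. exact (HA2 Ha). Qed.

Lemma StronglySorted_snoc (L : list U) (c : U) :
  StronglySorted E L -> Forall (fun a => a ∈ c) L -> StronglySorted E (L ++ [c]).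
Proof.
  induction L as [| a L IH]; intros HL Hc; simpl.
  - repeat constructor.
  - apply StronglySorted_inv in HL as [H1 H2]. apply Forall_cons_iff in Hc as [H3 H4].
    constructor; [apply IH; assumption |]. apply Forall_app. auto.
Qed.

Lemma StronglySorted_last (L : list U) (b x : U) :
  StronglySorted E (L ++ [b]) -> In x L -> x ∈ b.
Proof.
  induction L as [| y L IH]; intros HS Hx; [destruct Hx |].
  simpl in HS. apply StronglySorted_inv in HS as [H1 H2].
  destruct Hx as [-> | Hx]; [| auto].
  apply Forall_app in H2 as [_ H2]. inversion H2. assumption.
Qed.

Lemma R_extend (N : nat) : forall L, Forall R L -> StronglySorted E L ->
  exists M, length M = N /\ Forall R M /\ StronglySorted E (L ++ M).
Proof.
  induction N as [| N IH]; intros L HL HS.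
  - exists []. rewrite app_nil_r. auto.
  - destruct (R_above (Forall_R_ordinal HL)) as [c [Hc Hcl]].
    destruct (IH (L ++ [c])) as [M [H1 [H2 H3]]].
    + apply Forall_app. auto.
    + apply StronglySorted_snoc; assumption.
    + exists (c :: M). simpl. rewrite <- app_assoc in H3. auto.
Qed.

(** One direction of the reflection axiom, brought from codes to external formulas; [a'], the n
    entries of [l] and [b] are its n + 2 ordinals. *)
Lemma R_same_theory (a a' b : U) (l : list U) (p : form) (v : nat -> index) (ps : list U) :
  R a -> length l = n -> Forall R (a' :: l ++ [b]) -> (a = a' \/ a ∈ a') ->
  StronglySorted E (a' :: l ++ [b]) ->
  (forall i, valid (n + 1) (length ps) (v i)) -> Forall (fun x => x ∈ V a) ps ->
  holds_in (fun x => x ∈ V b) (fun i => value (a :: l) ps (v i)) p <->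
  holds_in (fun x => x ∈ V b) (fun i => value (a' :: l) ps (v i)) p.
Proof.
  intros Ra Hl HR Haa HS Hv Hps.
  assert (Rb : R b).
  { apply Forall_cons_iff in HR as [_ HR]. apply Forall_app in HR as [_ HR].
    inversion HR. assumption. }
  assert (Hab : a ∈ b).
  { assert (Ha'b : a' ∈ b).
    { apply StronglySorted_inv in HS as [_ HS]. apply Forall_app in HS as [_ HS].
      inversion HS. assumption. }
    destruct Haa as [-> | Haa]; [exact Ha'b | exact (ordinal_trans (HA2 Rb) Haa Ha'b)]. }
  apply same_theory_holds with (V a).
  - apply (proj1 (HB7a (HA2 Ra)) Ra a' l b); auto.
    + simpl. lia.
    + apply is_V_iff. split; [exact (HA2 Ra) | reflexivity].
    + apply is_V_iff. split; [exact (HA2 Rb) | reflexivity].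
  - reflexivity.
  - exact (V_mono (HA2 Rb) Hab).
  - simpl. rewrite Hl. replace (S n) with (n + 1) by lia. exact Hv.
  - exact Hps.
Qed.

Lemma R_chain (a : U) : R a -> exists a' l b, R a' /\ a ∈ a' /\ length l = n /\
  Forall R (a' :: l ++ [b]) /\ StronglySorted E (a' :: l ++ [b]).
Proof.
  (* The n + 2 new elements are [a'], the n entries of [l], and [b]. *)
  intros Ra. destruct (@R_extend (n + 2) [a]) as [M [H1 [H2 H3]]].
  - auto.
  - repeat constructor.
  - destruct M as [| a' M]; [simpl in H1; lia |].
    destruct (exists_last (l := M)) as [l [b ->]].
    { intros ->. simpl in H1. lia. }
    exists a', l, b. simpl in H3. apply StronglySorted_inv in H3 as [H3 H4].
    simpl in H1. rewrite length_app in H1. simpl in H1.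
    inversion H4; subst. inversion H2; subst.
    repeat split; auto; lia.
Qed.

(** Three existential facts about a larger [a'] in [R] are witnessed by [a] itself and transfer down
    to [a]: it has an element, it has an element above any given c in [a], and it has a limit
    ordinal as an element. *)
Lemma R_limit (a : U) : R a -> limit a /\ omega ∈ a.
Proof.
  intros Ra. pose proof (HA2 Ra) as Oa.
  destruct (R_chain Ra) as [a' [l [b [Ra' [Ha' [Hl [HR HS]]]]]]].
  assert (Rb : R b).
  { apply Forall_cons_iff in HR as [_ HR]. apply Forall_app in HR as [_ HR].
    inversion HR. assumption. }
  pose proof (HA2 Ra') as Oa'. pose proof (HA2 Rb) as Ob.
  assert (Hb : a' ∈ b).
  { apply StronglySorted_inv in HS as [_ HS]. apply Forall_app in HS as [_ HS].
    inversion HS. assumption. }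
  assert (Vb : forall x, x ∈ a' -> x ∈ V b).
  { intros x Hx. apply (ordinal_V_iff Ob (ordinal_mem Oa' Hx)).
    exact (ordinal_trans Ob Hx Hb). }
  pose proof (fun p v ps => @R_same_theory a a' b l p v ps Ra Hl HR (or_intror Ha') HS) as T.
  assert (Hpos : exists x, x ∈ a).
  { destruct (T (FEx (FMem 0 1)) (fun _ => ICst 0) []) as [_ T1].
    - intros i. simpl. lia.
    - constructor.
    - simpl in T1. destruct T1 as [x [_ Hx]]; [| exists x; exact Hx].
      exists a. split; [apply Vb, Ha' | exact Ha']. }
  assert (Hsucc : forall c, c ∈ a -> succ c ∈ a).
  { intros c Hc.
    destruct (T (FEx (FAnd (FMem 0 1) (FMem 2 0)))
      (fun i => match i with 0 => ICst 0 | _ => IVar 0 end) [c]) as [_ T1].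
    - intros [| i]; simpl; lia.
    - constructor; [| constructor]. apply (ordinal_V_iff Oa (ordinal_mem Oa Hc)), Hc.
    - simpl in T1. destruct T1 as [x [_ [Hx Hcx]]].
      + exists a. split; [apply Vb, Ha' | auto].
      + pose proof (ordinal_mem Oa Hx) as Ox.
        destruct (proj1 (ordinal_subset (ordinal_succ (ordinal_mem Oa Hc)) Ox)) as [-> | G].
        * intros z Hz. apply succ_iff in Hz as [Hz | ->]; [| exact Hcx].
          exact (ordinal_trans Ox Hz Hcx).
        * exact Hx.
        * exact (ordinal_trans Oa G Hx). }
  split; [split; [exact Oa | split; assumption] |].
  (* The formula says that the constant has a nonempty element without largest element. For [a']
     this is [a], by the two facts already obtained. *)
  destruct (T (FEx (FAnd (FMem 0 1) (FAnd (FEx (FMem 0 1))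
    (FNot (FEx (FAnd (FMem 0 1) (FNot (FEx (FAnd (FMem 0 2) (FMem 1 0)))))))))) (fun _ => ICst 0) [])
    as [_ T1].
  - intros i. simpl. lia.
  - constructor.
  - simpl in T1. destruct T1 as [x [_ [Hx [[y [_ Hy]] Hx']]]].
    + exists a. split; [apply Vb, Ha' |]. split; [exact Ha' |]. split.
      * destruct Hpos as [z Hz]. exists z. split; [| exact Hz].
        exact (Vb _ (ordinal_trans Oa' Hz Ha')).
      * intros [z [_ [Hz N]]]. apply N. exists (succ z).
        split; [exact (Vb _ (ordinal_trans Oa' (Hsucc z Hz) Ha')) |].
        split; [exact (Hsucc z Hz) | apply mem_succ].
    + pose proof (ordinal_mem Oa Hx) as Ox.
      assert (Hup : forall z, z ∈ x -> exists w, w ∈ x /\ z ∈ w).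
      { intros z Hz. apply NNPP. intros N. apply Hx'. exists z.
        split; [exact (Vb _ (ordinal_trans Oa' (ordinal_trans Oa Hz Hx) Ha')) |].
        split; [exact Hz |]. intros [w [_ Hw]]. apply N. exists w. exact Hw. }
      assert (G : subset E omega x).
      { intros k Hk. apply omega_iff in Hk. revert k Hk.
        apply (@nat_ind_def (fun k => k ∈ x)); [dfn | |].
        - destruct (ordinal_trichotomy ordinal_emp Ox) as [G | [<- | G]]; [exact G | |].
          + destruct (proj1 (emp_iff y) Hy).
          + destruct (proj1 (emp_iff x) G).
        - intros k Hk Hkx. destruct (Hup k Hkx) as [w [Hw Hkw]].
          pose proof (ordinal_mem Ox Hw) as Ow.
          destruct (proj1 (ordinal_subset (ordinal_succ (is_nat_ordinal Hk)) Ow)) as [-> | G].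
          + intros z Hz. apply succ_iff in Hz as [Hz | ->]; [| exact Hkw].
            exact (ordinal_trans Ow Hz Hkw).
          + exact Hw.
          + exact (ordinal_trans Ox G Hw). }
      apply ordinal_subset in G; [| apply ordinal_omega | exact Ox].
      destruct G as [-> | G]; [exact Hx | exact (ordinal_trans Oa G Hx)].
Qed.

(** Beyond the end of a nonempty list the environment repeats its head, so it takes no value outside
    the list. *)
Definition lenv (L : list U) : nat -> U := fun i => nth i L (hd emp L).

Lemma R_same_holds (a a' b : U) (l : list U) (p : form) (rho : nat -> U) :
  R a -> length l = n -> Forall R (a' :: l ++ [b]) -> (a = a' \/ a ∈ a') ->
  StronglySorted E (a' :: l ++ [b]) -> (forall i, rho i ∈ V a) ->
  holds_in (fun x => x ∈ V b) (mix (lenv (a :: l)) rho) p <->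
  holds_in (fun x => x ∈ V b) (mix (lenv (a' :: l)) rho) p.
Proof.
  intros Ra Hl HR Haa HS Hrho.
  destruct (holds_in_bound p) as [N HN].
  (* One entry more than the bound, so that the default index 0 in [v] is valid even if [N] is 0. *)
  set (ps := map rho (List.seq 0 (S N))).
  assert (Hlen : length ps = S N) by (unfold ps; rewrite length_map, length_seq; reflexivity).
  set (v := fun i => if Nat.even i
    then ICst (if Nat.ltb (Nat.div2 i) (n + 1) then Nat.div2 i else 0)
    else IVar (if Nat.ltb (Nat.div2 i) (S N) then Nat.div2 i else 0)).
  assert (Hv : forall i, valid (n + 1) (length ps) (v i)).
  { intros i. unfold v. rewrite Hlen. destruct (Nat.even i); unfold valid.
    - destruct (Nat.ltb_spec (Nat.div2 i) (n + 1)); lia.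
    - destruct (Nat.ltb_spec (Nat.div2 i) (S N)); lia. }
  assert (Hval : forall c, holds_in (fun x => x ∈ V b) (mix (lenv (c :: l)) rho) p <->
    holds_in (fun x => x ∈ V b) (fun i => value (c :: l) ps (v i)) p).
  { intros c. apply HN. intros i Hi. unfold mix, v. destruct (Nat.even i).
    - unfold value, lenv. destruct (Nat.ltb_spec (Nat.div2 i) (n + 1)) as [G | G].
      + apply nth_indep. simpl. lia.
      + rewrite nth_overflow by (simpl; lia). reflexivity.
    - unfold value. assert (Hi2 : Nat.div2 i < S N).
      { pose proof (Nat.div2_decr i N). lia. }
      destruct (Nat.ltb_spec (Nat.div2 i) (S N)) as [_ | G]; [| lia].
      unfold ps. rewrite nth_indep with (d' := rho 0) by (rewrite length_map, length_seq; lia).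
      rewrite map_nth, seq_nth by lia. reflexivity. }
  rewrite !Hval. apply R_same_theory; auto.
  unfold ps. apply Forall_map, Forall_forall. intros i _. apply Hrho.
Qed.

Lemma R_V_elementary (a a' : U) (p : form) (e : nat -> U) : R a -> R a' -> a ∈ a' ->
  (forall i, e i ∈ V a) ->
  holds_in (fun x => x ∈ V a) e p <-> holds_in (fun x => x ∈ V a') e p.
Proof.
  intros Ra Ra' Haa He.
  destruct (@R_extend (n + 1) [a']) as [M [H1 [H2 H3]]]; [auto | repeat constructor |].
  destruct (exists_last (l := M)) as [l [b ->]]; [intros ->; simpl in H1; lia |].
  rewrite length_app in H1. simpl in H1.
  assert (Rb : R b) by (apply Forall_app in H2 as [_ H2]; inversion H2; assumption).
  destruct (R_limit Rb) as [Lb _]. pose proof (proj1 Lb) as Ob.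
  assert (Hb : a' ∈ b).
  { apply StronglySorted_inv in H3 as [_ H3]. apply Forall_app in H3 as [_ H3].
    inversion H3. assumption. }
  assert (Hab : a ∈ b) by exact (ordinal_trans Ob Haa Hb).
  (* In [V b], the formula [q] says that the level indexed by the first constant satisfies [p],
     whose variables have become parameters. The entries of [l] only fill up the tuple. *)
  set (q := relativize 0 (ren (fun i => S (2 * i)) p)).
  assert (G : holds_in (fun x => x ∈ V b) (mix (lenv (a :: l)) e) q <->
    holds_in (fun x => x ∈ V b) (mix (lenv (a' :: l)) e) q).
  { apply R_same_holds; auto; lia. }
  assert (K : forall c, R c -> (c = a' \/ c ∈ a') ->
    holds_in (fun x => x ∈ V b) (mix (lenv (c :: l)) e) q <-> holds_in (fun x => x ∈ V c) e p).
  { intros c Rc Hc.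
    assert (Hcb : c ∈ b) by (destruct Hc as [-> | Hc];
      [exact Hb | exact (ordinal_trans Ob Hc Hb)]).
    unfold q. rewrite relativize_iff; [| exact Lb | exact Hcb |].
    - change (mix (lenv (c :: l)) e 0) with c. rewrite holds_in_ren.
      apply holds_in_ext. intros i. apply mix_odd.
    - assert (Hlow : forall x, ordinal E x -> x ∈ b -> x ∈ V b).
      { intros x Ox Hx. apply ordinal_V_iff; assumption. }
      assert (HcV : c ∈ V b) by exact (Hlow c (HA2 Rc) Hcb).
      intros i. unfold mix. destruct (Nat.even i); [| exact (V_mono Ob Hab (He _))].
      unfold lenv. simpl hd. destruct (nth_in_or_default (Nat.div2 i) (c :: l) c) as [Hi | ->];
        [| exact HcV].
      destruct Hi as [<- | Hi]; [exact HcV |].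
      apply StronglySorted_inv in H3 as [H3 _].
      apply Forall_app in H2 as [H2 _]. rewrite Forall_forall in H2.
      apply Hlow; [apply HA2, H2, Hi |].
      exact (StronglySorted_last _ _ _ H3 Hi). }
  rewrite <- (K a Ra (or_intror Haa)), <- (K a' Ra' (or_introl eq_refl)). exact G.
Qed.

Lemma mem_R_V (x : U) (b : U) : R b -> exists c, R c /\ b ∈ c /\ x ∈ V c.
Proof.
  intros Rb. destruct (bigger_V x (HA2 Rb)) as [c0 [Oc0 [Hx Hs]]].
  destruct (@R_above [c0; b]) as [c [Rc Hc]]; [auto |].
  inversion Hc as [| ? ? G1 G2]; subst. inversion G2; subst.
  exists c. split; [exact Rc |]. split; [assumption |]. exact (V_mono (HA2 Rc) G1 Hx).
Qed.

(* The V_b with R b form an elementary chain with union U. *)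
Lemma R_elementary (p : form) : forall b e, R b -> (forall i, e i ∈ V b) ->
  holds_in (fun x => x ∈ V b) e p <-> holds E e p.
Proof.
  induction p as [i j | i j | p IH | p IHp q IHq | p IH]; intros b e Rb He; simpl.
  - reflexivity.
  - reflexivity.
  - rewrite IH by assumption. reflexivity.
  - rewrite IHp, IHq by assumption. reflexivity.
  - assert (G : forall c x, R c -> (b = c \/ b ∈ c) -> x ∈ V c ->
      holds_in (fun x => x ∈ V c) (scons x e) p <-> holds E (scons x e) p).
    { intros c x Rc Hbc Hx. apply IH; [exact Rc |].
      intros [| i]; [exact Hx | exact (V_mono_le (HA2 Rc) Hbc (He i))]. }
    split.
    + intros [x [Hx H]]. exists x. apply (G b x); auto.
    + intros [x H]. destruct (mem_R_V x Rb) as [c [Rc [Hbc Hx]]].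
      (* The witness may lie outside [V b]. It lies in a larger level [V c], and elementarity
         between the two levels brings the existential statement back. *)
      apply (proj2 (R_V_elementary (FEx p) e Rb Rc Hbc He)). exists x.
      split; [exact Hx |]. apply (G c x); auto.
Qed.

(** * Indiscernibility *)

Definition DefL (A : U -> Prop) (N : nat) (P : list U -> Prop) : Prop :=
  Def E A (fun e => P (map e (List.seq 0 N))).

Lemma map_lenv (L M : list U) : map (lenv (L ++ M)) (List.seq 0 (length L)) = L.
Proof.
  apply nth_ext with (d := emp) (d' := emp).
  - rewrite length_map, length_seq. reflexivity.
  - rewrite length_map, length_seq. intros i Hi.
    rewrite nth_indep with (d' := lenv (L ++ M) 0) by (rewrite length_map, length_seq; exact Hi).
    rewrite map_nth, seq_nth by exact Hi. unfold lenv. simpl.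
    rewrite app_nth1 by exact Hi. apply nth_indep, Hi.
Qed.

(** The tuple is padded by [l2] to the length required by the axiom and topped by [b]. Since [V b]
    is elementary in the universe, the truth of [P] is a matter of the theory of [V b]. *)
Lemma move_first (a a' : U) (l : list U) (P : list U -> Prop) :
  R a -> (a = a' \/ a ∈ a') -> Forall R (a' :: l) -> StronglySorted E (a' :: l) ->
  length l <= n -> DefL (fun x => x ∈ V a) (S (length l)) P ->
  P (a :: l) <-> P (a' :: l).
Proof.
  intros Ra Haa HR HS Hl HP.
  destruct (R_extend (S (n - length l)) HR HS) as [M [HM [RM SM]]].
  destruct (exists_last (l := M)) as [l2 [b ->]]; [intros ->; discriminate HM |].
  rewrite length_app in HM. simpl in HM.
  assert (HR' : Forall R (a' :: (l ++ l2) ++ [b])).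
  { rewrite <- app_assoc. exact (proj2 (Forall_app R (a' :: l) _) (conj HR RM)). }
  assert (SM' : StronglySorted E (a' :: (l ++ l2) ++ [b])).
  { rewrite <- app_assoc. exact SM. }
  assert (Rb : R b) by (apply Forall_app in RM as [_ RM]; inversion RM; assumption).
  pose proof (HA2 Rb) as Ob.
  assert (Low : forall x, In x (a' :: (l ++ l2)) -> x ∈ V b).
  { intros x Hx.
    assert (Rx : R x).
    { rewrite Forall_forall in HR'. apply HR'. rewrite app_comm_cons. apply in_or_app. auto. }
    apply (ordinal_V_iff Ob (HA2 Rx)). rewrite app_comm_cons in SM'.
    exact (StronglySorted_last _ _ _ SM' Hx). }
  assert (HaV : a ∈ V b).
  { apply (ordinal_V_iff Ob (HA2 Ra)).
    assert (a' ∈ b).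
    { apply (ordinal_V_iff Ob); [| apply Low; left; reflexivity].
      apply HA2. inversion HR. assumption. }
    destruct Haa as [-> | Haa]; [assumption |]. eapply ordinal_trans; eassumption. }
  assert (Hsub : forall x, x ∈ V a -> x ∈ V b).
  { intros x Hx. apply (V_mono Ob (proj1 (ordinal_V_iff Ob (HA2 Ra)) HaV) Hx). }
  assert (Hne : exists x, x ∈ V a).
  { exists emp. destruct (R_limit Ra) as [La Ha]. apply (ordinal_V_iff (HA2 Ra) ordinal_emp).
    apply (ordinal_trans (HA2 Ra) (b := omega)); [apply omega_iff, is_nat_emp | exact Ha]. }
  destruct (Def_form Hne HP) as [p [rho [Hrho Hp]]].
  assert (G : forall c, In c [a; a'] -> holds_in (fun x => x ∈ V b)
    (mix (lenv (c :: l ++ l2)) rho) p <-> P (c :: l)).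
  { intros c Hc.
    assert (HcV : c ∈ V b).
    { destruct Hc as [<- | [<- | []]]; [exact HaV | apply Low; left; reflexivity]. }
    rewrite R_elementary; [| exact Rb |].
    - rewrite Hp, app_comm_cons. change (S (length l)) with (length (c :: l)).
      rewrite map_lenv. reflexivity.
    - intros i. unfold mix. destruct (Nat.even i); [| apply Hsub, Hrho].
      unfold lenv. simpl hd.
      destruct (nth_in_or_default (Nat.div2 i) (c :: l ++ l2) c) as [[<- | Hi] | ->]; auto.
      apply Low. right. exact Hi. }
  rewrite <- (G a), <- (G a') by (simpl; auto).
  apply R_same_holds; auto. rewrite length_app. lia.
Qed.

Lemma DefL_cons (A B : U -> Prop) (N : nat) (P : list U -> Prop) (a : U) :
  (forall x, A x -> B x) -> B a -> DefL A (S N) P -> DefL B N (fun L => P (a :: L)).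
Proof.
  intros HAB Ha HP. unfold DefL in *. pose proof (@Def_mono _ _ A B _ HAB HP) as HP'.
  pose (s := fun i => match i with 0 => fun _ : nat -> U => a | S i => fun e => e i end).
  apply Def_ext with (fun e => P (map (fun i => s i e) (List.seq 0 (S N)))).
  - intros e. simpl. rewrite <- seq_shift, map_map. reflexivity.
  - apply (Def_subst HP' s). intros [| i]; simpl; [apply (term_const B _ Ha) | apply (term_var B i)].
Qed.

(** The tail moves first: the head [c] is below the next entry d, hence an admissible parameter from
    [V d]. Afterwards the head moves in front of the new tail. *)
Lemma move_all (L : list U) : forall (L' : list U) (a : U) (P : list U -> Prop),
  R a -> Forall (fun c => a = c \/ a ∈ c) L -> Forall2 (fun c c' => c = c' \/ c ∈ c') L L' ->
  Forall R L -> Forall R L' -> StronglySorted E L -> StronglySorted E L' ->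
  length L <= S n -> DefL (fun x => x ∈ V a) (length L) P -> P L <-> P L'.
Proof.
  induction L as [| c L IH]; intros L' a P Ra HaL H2 RL RL' SL SL' Hlen HP;
    inversion H2 as [| ? c' ? M' Hc HM]; subst; [reflexivity |].
  apply Forall_cons_iff in HaL as [Hac HaL]. apply Forall_cons_iff in RL as [Rc RL].
  pose proof RL' as RL0. apply Forall_cons_iff in RL' as [Rc' RM].
  pose proof SL' as SL0. apply StronglySorted_inv in SL as [SL HcL].
  apply StronglySorted_inv in SL' as [SM HcM]. simpl in Hlen, HP.
  assert (Hsub : forall x, x ∈ V a -> x ∈ V c).
  { intros x Hx. exact (V_mono_le (HA2 Rc) Hac Hx). }
  assert (HlenM : length M' = length L) by (symmetry; apply (Forall2_length HM)).
  transitivity (P (c :: M')).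
  - destruct L as [| d L].
    + inversion HM. reflexivity.
    + inversion RL as [| ? ? Rd RL1]; subst.
      inversion HcL as [| ? ? Hcd HcL1]; subst.
      apply (IH M' d (fun l => P (c :: l))); auto.
      * constructor; [auto |]. apply StronglySorted_inv in SL as [_ SL].
        revert SL. apply Forall_impl. auto.
      * simpl in *. lia.
      * apply DefL_cons with (fun x => x ∈ V a); [| | exact HP].
        -- intros x Hx. exact (V_mono (HA2 Rd) Hcd (Hsub x Hx)).
        -- apply (ordinal_V_iff (HA2 Rd) (HA2 Rc)), Hcd.
  - apply move_first; auto; [lia |]. rewrite HlenM.
    unfold DefL in *. revert HP. apply Def_mono, Hsub.
Qed.

Lemma Forall2_above (L : list U) : forall M, length L = length M ->
  (forall x y, In x L -> In y M -> x ∈ y) -> Forall2 (fun c c' => c = c' \/ c ∈ c') L M.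
Proof.
  induction L as [| x L IH]; intros [| y M] Hlen H; try discriminate; constructor.
  - right. apply H; left; reflexivity.
  - apply IH; [injection Hlen; auto |]. intros x' y' Hx Hy. apply H; right; assumption.
Qed.

Lemma indiscernible (a : U) (L L' : list U) (P : list U -> Prop) : R a ->
  Forall (fun c => R c /\ (a = c \/ a ∈ c)) L -> Forall (fun c => R c /\ (a = c \/ a ∈ c)) L' ->
  StronglySorted E L -> StronglySorted E L' -> length L = length L' -> length L <= S n ->
  DefL (fun x => x ∈ V a) (length L) P -> P L <-> P L'.
Proof.
  intros Ra HL HL' SL SL' Hlen Hn' HP.
  assert (Split : forall M, Forall (fun c => R c /\ (a = c \/ a ∈ c)) M ->
    Forall R M /\ Forall (fun c => a = c \/ a ∈ c) M).
  { intros M HM. split; revert HM; apply Forall_impl; tauto. }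
  apply Split in HL as [RL aL], HL' as [RL' aL'].
  destruct (@R_above (L ++ L')) as [c [Rc Hc]].
  { apply Forall_R_ordinal, Forall_app. auto. }
  destruct (@R_extend (length L) [c]) as [M [HM [RM SM]]]; [auto | repeat constructor |].
  simpl in SM. apply StronglySorted_inv in SM as [SM HcM].
  rewrite Forall_forall in Hc, HcM.
  assert (Up : forall x y, In x (L ++ L') -> In y M -> x ∈ y).
  { intros x y Hx Hy. rewrite Forall_forall in RM.
    exact (ordinal_trans (HA2 (RM y Hy)) (Hc x Hx) (HcM y Hy)). }
  transitivity (P M).
  - apply (@move_all L M a P); auto. apply Forall2_above; [auto |].
    intros x y Hx Hy. apply Up; [apply in_or_app; auto | exact Hy].
  - symmetry. apply (@move_all L' M a P); auto; [| lia | rewrite <- Hlen; exact HP].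
    apply Forall2_above; [lia |].
    intros x y Hx Hy. apply Up; [apply in_or_app; auto | exact Hy].
Qed.
(** * Ordinal definability *)

Lemma holds_iff_in (p : form) : forall e, holds E e p <-> holds_in (fun _ => True) e p.
Proof.
  induction p as [i j | i j | p IH | p IHp q IHq | p IH]; intros e; simpl.
  - reflexivity.
  - reflexivity.
  - rewrite IH. reflexivity.
  - rewrite IHp, IHq. reflexivity.
  - split; intros [x H]; exists x.
    + split; [exact I | apply IH, H].
    + apply IH, H.
Qed.

(** A level [V b] with [b] in [R], above [x] and the parameters, plays the part of the reflection
    theorem: being elementary in the universe, it evaluates the definition of [x] correctly. *)
Lemma OD_of_Def (P : U -> Prop) (x : U) : Def E (ordinal E) (fun e => P (e 0)) ->
  (forall y, P y <-> y = x) -> OD E x.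
Proof.
  intros HP Hx. destruct (Def_form (ex_intro _ emp ordinal_emp) HP) as [p [rho [Hrho Hp]]].
  destruct (holds_in_bound p) as [N HN].
  set (ps := map rho (List.seq 0 N)).
  assert (Hlen : length ps = N) by (unfold ps; rewrite length_map, length_seq; reflexivity).
  assert (Hps : Forall (ordinal E) ps).
  { unfold ps. apply Forall_map, Forall_forall. intros i _. apply Hrho. }
  destruct (R_above Hps) as [b0 [Rb0 Hb0]].
  destruct (mem_R_V x Rb0) as [b [Rb [Hb Hxb]]]. pose proof (HA2 Rb) as Ob.
  assert (Hpb : Forall (fun a => a ∈ b) ps).
  { revert Hb0. apply Forall_impl. intros a Ha. exact (ordinal_trans Ob Ha Hb). }
  (* The parameters are the variables of levels below [N]. Every variable of the formula stands for
     the defined set, which comes last, as [OD] requires. *)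
  set (v := fun i => if Nat.even i then IVar N else
    IVar (if Nat.ltb (Nat.div2 i) N then Nat.div2 i else N)).
  assert (Hv : forall i, valid 0 (S N) (v i)).
  { intros i. unfold v. destruct (Nat.even i); unfold valid; [lia |].
    destruct (Nat.ltb_spec (Nat.div2 i) N); lia. }
  exists b, (V b), (num N), (num (S N)), (code p v (S N)), (mkseq 0 ps).
  split; [apply is_V_iff; auto |]. split; [exact Hxb |].
  split; [rewrite <- Hlen; exact (mkseq_seq Hpb) |].
  split; [apply is_succ_iff; reflexivity |].
  split; [exact (code_formula 0 p v (S N) Hv) |].
  intros y s' Hy Hs'. apply is_snoc_iff in Hs' as ->.
  fold (snoc (mkseq 0 ps) (num N) y). rewrite <- Hlen, mkseq_snoc, Hlen.
  assert (Hl : length (ps ++ [y]) = S N) by (rewrite length_app, Hlen; simpl; lia).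
  assert (HlV : Forall (fun z => z ∈ V b) (ps ++ [y])).
  { apply Forall_app. split; [| auto]. rewrite Forall_forall in *. intros a Ha.
    apply ordinal_V_iff; auto. }
  rewrite <- Hl, code_satisfies; [| intros i; rewrite Hl; apply Hv | exact HlV].
  rewrite R_elementary; [| exact Rb |].
  - rewrite <- Hx, <- (Hp (fun _ => y)), !holds_iff_in. apply HN. intros i Hi.
    unfold v, mix. destruct (Nat.even i).
    + unfold value. rewrite app_nth2, Hlen, Nat.sub_diag by lia. reflexivity.
    + assert (Hi2 : Nat.div2 i < N).
      { destruct N as [| N']; [lia |]. pose proof (Nat.div2_decr i N'). lia. }
      destruct (Nat.ltb_spec (Nat.div2 i) N) as [_ | G]; [| lia].
      unfold value. rewrite app_nth1 by lia. unfold ps.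
      rewrite nth_indep with (d' := rho 0) by (rewrite length_map, length_seq; lia).
      rewrite map_nth, seq_nth by lia. reflexivity.
  - intros i. specialize (Hv i). destruct (v i) as [j | j]; simpl in *; [| lia].
    rewrite Forall_forall in HlV. apply HlV, nth_In. lia.
Qed.

(** * Ordinals and sets of ordinals in HOD *)

Lemma OD_ordinal (a : U) : ordinal E a -> OD E a.
Proof.
  intros Ha. apply (@OD_of_Def (fun y => y = a)); [dfn | reflexivity].
Qed.

Lemma HOD_mem (x y : U) : HOD E x -> y ∈ x -> HOD E y.
Proof. intros Hx Hy z Hz. apply Hx. intros t Ht Hxt. apply Hz; [exact Ht |]. exact (Ht x Hxt y Hy). Qed.

Lemma HOD_OD (x : U) : HOD E x -> OD E x.
Proof. intros H. apply H. intros t _ Ht. exact Ht. Qed.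

Lemma HOD_ordinal (a : U) : ordinal E a -> HOD E a.
Proof.
  intros Ha y Hy. apply OD_ordinal.
  assert (H : y ∈ succ a) by (apply Hy; [apply ordinal_succ, Ha | apply mem_succ]).
  apply succ_iff in H as [H | ->]; [exact (ordinal_mem Ha H) | exact Ha].
Qed.

(** With [b] an ordinal above all elements of [x], the union of {x} and [b] is transitive, so
    everything in the transitive closure of {x} is [x] or an ordinal. *)
Lemma HOD_set_of_ordinals (x : U) : OD E x -> (forall a, a ∈ x -> ordinal E a) -> HOD E x.
Proof.
  intros Hx Ho y Hy. destruct (ordinal_bound Ho) as [b [Hb Hxb]].
  assert (H : y ∈ union (sing x) b).
  { apply Hy.
    - intros u Hu w Hw. apply union_iff. right. apply union_iff in Hu as [Hu | Hu].
      + apply sing_iff in Hu as ->. exact (Hxb w Hw).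
      + exact (ordinal_trans Hb Hw Hu).
    - apply union_iff. left. apply sing_iff. reflexivity. }
  apply union_iff in H as [H | H].
  - apply sing_iff in H as ->. exact Hx.
  - apply OD_ordinal, (ordinal_mem Hb H).
Qed.

(** * Definability of OD and HOD *)

Lemma Def_satisfies A t u v : term A t -> term A u -> term A v ->
  Def E A (fun e => satisfies E (t e) [] (u e) (v e)).
Proof.
  intros. unfold satisfies, tarski. cbv zeta. cbn [length].
  dfn; apply Def_term_val; auto 30 with dfn.
Qed.
#[local] Hint Resolve Def_satisfies : dfn.

(** The matrix of [OD]. The number of parameters [m] and the code [c] are separated from the level
    [b] and the parameters [s], as the former will be held fixed and the latter minimized. *)
Definition defines (m c b s y : U) : Prop :=
  exists A m', is_V E b A /\ y ∈ A /\ seq b m s /\ is_succ E m' m /\ is_formula E 0 m' c /\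
    forall z s', z ∈ A -> is_snoc E s' s m z -> (satisfies E A [] c s' <-> z = y).

Lemma Def_defines A t u v w z : term A t -> term A u -> term A v -> term A w -> term A z ->
  Def E A (fun e => defines (t e) (u e) (v e) (w e) (z e)).
Proof. intros. unfold defines. dfn. Qed.
#[local] Hint Resolve Def_defines : dfn.

Lemma OD_iff (y : U) : OD E y <-> exists m c b s, defines m c b s y.
Proof.
  split.
  - intros [b [A [m [m' [c [s H]]]]]]. exists m, c, b, s, A, m'. exact H.
  - intros [m [c [b [s [A [m' H]]]]]]. exists b, A, m, m', c, s. exact H.
Qed.

Lemma Def_OD A t : term A t -> Def E A (fun e => OD E (t e)).
Proof.
  intros. apply Def_ext with (fun e => exists m c b s, defines m c b s (t e)); [| dfn].
  intros e. symmetry. apply OD_iff.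
Qed.
#[local] Hint Resolve Def_OD : dfn.

Lemma Def_HOD A t : term A t -> Def E A (fun e => HOD E (t e)).
Proof. intros. unfold HOD. dfn. Qed.
#[local] Hint Resolve Def_HOD : dfn.

Lemma defines_unique m c b s y y' : defines m c b s y -> defines m c b s y' -> y = y'.
Proof.
  intros [A [m' [H1 [H2 [H3 [H4 [H5 H6]]]]]]] [A' [m'' [K1 [K2 [K3 [K4 [K5 K6]]]]]]].
  apply is_V_iff in H1 as [_ ->], K1 as [_ ->].
  pose proof (proj2 (is_snoc_iff (snoc s m y) s m y) eq_refl) as Hs.
  apply (K6 y _ H2 Hs), (H6 y _ H2 Hs). reflexivity.
Qed.

Lemma defines_formula m c b s y : defines m c b s y -> is_nat E m /\ is_formula E 0 (succ m) c.
Proof.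
  intros [A [m' [_ [_ [_ [H4 [H5 _]]]]]]]. apply is_succ_iff in H4 as ->.
  split; [| exact H5]. apply (is_nat_mem (proj1 H5)), mem_succ.
Qed.

Lemma defines_seq m c b s y : defines m c b s y -> ordinal E b /\ seq b m s.
Proof.
  intros [A [m' [H1 [_ [H3 _]]]]]. split; [apply H1 | exact H3].
Qed.

(** * Selection of ordinal definable sets *)

Definition agree (k s s' : U) : Prop :=
  forall j w, j ∈ k -> (pair j w ∈ s <-> pair j w ∈ s').

Definition lex_lt (k s s' : U) : Prop :=
  exists i v v', i ∈ k /\ pair i v ∈ s /\ pair i v' ∈ s' /\ v ∈ v' /\ agree i s s'.

Lemma Def_agree A t u v : term A t -> term A u -> term A v ->
  Def E A (fun e => agree (t e) (u e) (v e)).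
Proof. intros. unfold agree. dfn. Qed.
#[local] Hint Resolve Def_agree : dfn.

Lemma Def_lex_lt A t u v : term A t -> term A u -> term A v ->
  Def E A (fun e => lex_lt (t e) (u e) (v e)).
Proof. intros. unfold lex_lt. dfn. Qed.
#[local] Hint Resolve Def_lex_lt : dfn.

Lemma agree_sym k s s' : agree k s s' -> agree k s' s.
Proof. intros H j w Hj. symmetry. exact (H j w Hj). Qed.

Lemma agree_trans k s s' s'' : agree k s s' -> agree k s' s'' -> agree k s s''.
Proof. intros H H' j w Hj. rewrite (H j w Hj). exact (H' j w Hj). Qed.

Lemma agree_eq b m s s' : seq b m s -> seq b m s' -> agree m s s' -> s = s'.
Proof.
  intros H H' G. apply is_fun_iff in H as [H _], H' as [H' _].
  apply extensionality. intros p. split; intros Hp.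
  - destruct (H p Hp) as [i [x [Hi [_ ->]]]]. apply (G i x Hi), Hp.
  - destruct (H' p Hp) as [i [x [Hi [_ ->]]]]. apply (G i x Hi), Hp.
Qed.

Lemma lex_lt_asym b m s s' : is_nat E m -> seq b m s -> seq b m s' ->
  lex_lt m s s' -> ~ lex_lt m s' s.
Proof.
  intros Hm Hs Hs' [i [v [v' [H1 [H2 [H3 [H4 H5]]]]]]] [j [w [w' [K1 [K2 [K3 [K4 K5]]]]]]].
  apply is_fun_iff in Hs as [_ [_ F]], Hs' as [_ [_ F']].
  destruct (ordinal_trichotomy (ordinal_mem (is_nat_ordinal Hm) H1)
    (ordinal_mem (is_nat_ordinal Hm) K1)) as [G | [G | G]].
  - apply (K5 i v' G) in H3. rewrite (F i v v' H2 H3) in H4. exact (foundation_irrefl H4).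
  - subst j. rewrite (F i v w' H2 K3), (F' i v' w H3 K2) in H4. exact (foundation_asym H4 K4).
  - apply (H5 j w' G) in K3. rewrite (F' j w w' K2 K3) in K4. exact (foundation_irrefl K4).
Qed.

(** Induction on the length k up to which a sequence is minimal, inside the structure because [m]
    may be nonstandard. Among the elements of [Q] that agree with the current one below k, one with
    least value at k is kept. *)
Lemma lex_min (Q : U -> Prop) (b m : U) : DEF (fun e => Q (e 0)) -> ordinal E b -> is_nat E m ->
  (forall s, Q s -> seq b m s) -> (exists s, Q s) ->
  exists s, Q s /\ forall s', Q s' -> s = s' \/ lex_lt m s s'.
Proof.
  intros HQ Hb Hm Hseq [s0 Hs0].
  assert (G : forall k, is_nat E k -> k ∈ succ m -> exists s, Q s /\
    forall s', Q s' -> agree k s s' \/ lex_lt k s s').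
  { apply (@nat_ind_def (fun k => k ∈ succ m -> exists s, Q s /\
      forall s', Q s' -> agree k s s' \/ lex_lt k s s')).
    - dfn.
    - intros _. exists s0. split; [exact Hs0 |]. intros s' _. left.
      intros j w Hj. destruct (proj1 (emp_iff j) Hj).
    - intros k Hk IH Hkm.
      assert (Hkm' : k ∈ m).
      { apply succ_iff in Hkm as [Hkm | <-]; [| apply mem_succ].
        exact (ordinal_trans (is_nat_ordinal Hm) (mem_succ k) Hkm). }
      destruct IH as [s [Qs Hs]]; [apply succ_iff; auto |].
      destruct (@ordinal_least (fun v => exists s', Q s' /\ agree k s s' /\ pair k v ∈ s'))
        as [v [Hv [[s1 [Q1 [A1' P1]]] Hmin]]].
      + dfn.
      + pose proof (Hseq s Qs) as F. apply is_fun_iff in F as [F1 [F2 _]].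
        destruct (F2 k Hkm') as [v Hv]. exists v. split.
        * destruct (F1 _ Hv) as [i [x [_ [Hx Hp]]]]. apply pair_inj in Hp as [_ ->].
          exact (ordinal_mem Hb Hx).
        * exists s. split; [exact Qs |]. split; [| exact Hv]. intros j w _. reflexivity.
      + exists s1. split; [exact Q1 |]. intros s' Q'.
        destruct (Hs s' Q') as [G | [i [u [u' [K1 [K2 [K3 [K4 K5]]]]]]]].
        * pose proof (Hseq s' Q') as F. apply is_fun_iff in F as [F1 [F2 F3]].
          destruct (F2 k Hkm') as [v' Hv'].
          assert (Ov' : ordinal E v').
          { destruct (F1 _ Hv') as [i [x [_ [Hx Hp]]]]. apply pair_inj in Hp as [_ ->].
            exact (ordinal_mem Hb Hx). }
          assert (G1 : agree k s1 s') by (apply agree_trans with s; [apply agree_sym |]; assumption).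
          destruct (ordinal_trichotomy Hv Ov') as [T | [T | T]].
          -- right. exists k, v, v'. split; [apply mem_succ |]. auto.
          -- left. subst v'. intros j w Hj. apply succ_iff in Hj as [Hj | ->]; [exact (G1 j w Hj) |].
             pose proof (Hseq s1 Q1) as F'. apply is_fun_iff in F' as [_ [_ F3']].
             split; intros Hw.
             ++ rewrite (F3' k w v Hw P1). exact Hv'.
             ++ rewrite (F3 k w v Hw Hv'). exact P1.
          -- destruct (Hmin v' T). exists s'. auto.
        * right. exists i, u, u'. split; [apply succ_iff; auto |].
          split; [apply (A1' i u K1), K2 |]. split; [exact K3 |]. split; [exact K4 |].
          intros j w Hj. rewrite <- (K5 j w Hj). symmetry. apply A1'.
          exact (ordinal_trans (is_nat_ordinal Hk) Hj K1). }
  destruct (G m Hm (mem_succ m)) as [s [Qs Hs]]. exists s. split; [exact Qs |].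
  intros s' Q'. destruct (Hs s' Q') as [H | H]; [left | auto].
  exact (agree_eq (Hseq s Qs) (Hseq s' Q') H).
Qed.

Definition candidate (m c : U) (P : U -> Prop) (b s : U) : Prop :=
  exists y, defines m c b s y /\ P y.

(* A choice of a set with property P among those definable by the formula c with
   m parameters.  Since c and m belong to every V_a with R a, they may be fixed
   once and for all, and no global well-ordering of HOD is needed. *)
Definition selected (m c : U) (P : U -> Prop) (y : U) : Prop :=
  exists b s, candidate m c P b s /\
    (forall b' s', b' ∈ b -> ~ candidate m c P b' s') /\
    (forall s', candidate m c P b s' -> s = s' \/ lex_lt m s s') /\
    defines m c b s y.

Lemma selected_spec m c P y : selected m c P y -> P y /\ OD E y.
Proof.
  intros [b [s [[y' [H1 H2]] [_ [_ H3]]]]]. rewrite (defines_unique H3 H1).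
  split; [exact H2 |]. apply OD_iff. exists m, c, b, s. exact H1.
Qed.

Lemma selected_formula m c P y :
  selected m c P y -> is_nat E m /\ is_formula E 0 (succ m) c.
Proof. intros [b [s [_ [_ [_ H]]]]]. exact (defines_formula H). Qed.

Lemma selected_unique m c P y y' : selected m c P y -> selected m c P y' -> y = y'.
Proof.
  intros [b [s [H1 [H2 [H3 H4]]]]] [b' [s' [K1 [K2 [K3 K4]]]]].
  destruct (defines_seq H4) as [Ob Hs]. destruct (defines_seq K4) as [Ob' Hs'].
  destruct (defines_formula H4) as [Hm _].
  assert (b' = b) as ->.
  { destruct (ordinal_trichotomy Ob Ob') as [G | [G | G]]; [| auto |].
    - destruct (K2 b s G H1).
    - destruct (H2 b' s' G K1). }
  assert (s' = s) as ->.
  { destruct (H3 s' K1) as [G | G]; [auto |]. destruct (K3 s H1) as [G' | G']; [auto |].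
    destruct (lex_lt_asym Hm Hs Hs' G G'). }
  exact (defines_unique H4 K4).
Qed.

Lemma Def_candidate A (P : (nat -> U) -> U -> Prop) t u v w :
  Def E A (fun e => P (fun i => e (S i)) (e 0)) ->
  term A t -> term A u -> term A v -> term A w ->
  Def E A (fun e => candidate (t e) (u e) (P e) (v e) (w e)).
Proof. intros HP Ht Hu Hv Hw. unfold candidate. dfn. Qed.

Lemma Def_selected A (P : (nat -> U) -> U -> Prop) t u v :
  Def E A (fun e => P (fun i => e (S i)) (e 0)) ->
  term A t -> term A u -> term A v ->
  Def E A (fun e => selected (t e) (u e) (P e) (v e)).
Proof.
  intros HP Ht Hu Hv. unfold selected.
  (* The predicate [P] depends on the environment and occurs under quantifiers that shift it, so its
     definability is needed up to renaming. *)
  assert (HP' : forall r, Def E A (fun e => P (fun i => e (S (r i))) (e 0))).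
  { intros r. apply (Def_subst HP (fun i => match i with 0 => fun e => e 0 | S i => fun e => e (S (r i)) end)).
    intros [| i]; apply term_var. }
  dfn.
  - apply Def_candidate with (P := fun e => P (fun i => e (S (S i)))); auto 30 with dfn.
  - apply Def_candidate with (P := fun e => P (fun i => e (S (S (S (S i)))))); auto 30 with dfn.
  - apply Def_candidate with (P := fun e => P (fun i => e (S (S (S i))))); auto 30 with dfn.
Qed.

Lemma selected_exists m c b s y (P : U -> Prop) : DEF (fun e => P (e 0)) ->
  defines m c b s y -> P y -> exists y', selected m c P y'.
Proof.
  intros HP Hd Hy. destruct (defines_seq Hd) as [Ob _]. destruct (defines_formula Hd) as [Hm _].
  destruct (@ordinal_least (fun b => exists s, candidate m c P b s)) as [b0 [Ob0 [Hex Hmin]]].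
  - dfn; apply (@Def_candidate _ (fun _ => P)); auto 30 with dfn.
  - exists b. split; [exact Ob |]. exists s, y. auto.
  - destruct (@lex_min (candidate m c P b0) b0 m) as [s0 [Hs0 Hlex]]; [| exact Ob0 | exact Hm | | exact Hex |].
    + apply (@Def_candidate _ (fun _ => P)); auto 30 with dfn.
    + intros s' [y' [H _]]. apply (defines_seq H).
    + pose proof Hs0 as [y0 [H0 H1]]. exists y0, b0, s0. split; [exact Hs0 |].
      split; [| split; [exact Hlex | exact H0]].
      intros b' s' Hb' Hc. apply (Hmin b' Hb'). exists s'. exact Hc.
Qed.
(** * Definability with finite lists *)

(** Terms whose values are external lists of a fixed length. As [n] is an external number, a
    quantifier over n-tuples is a finite block of quantifiers, and such lists may enter definable
    predicates. *)
Definition tlist (A : U -> Prop) (G : (nat -> U) -> list U) : Prop :=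
  exists ts, Forall (term A) ts /\ forall e, G e = map (fun t => t e) ts.

Section ListDef.

Variable A : U -> Prop.

Lemma tlist_const l : Forall A l -> tlist A (fun _ => l).
Proof.
  intros H. exists (map (fun a _ => a) l). split.
  - apply Forall_map. revert H. apply Forall_impl. intros a Ha. apply (term_const A a Ha).
  - intros e. rewrite map_map, map_id. reflexivity.
Qed.

Lemma tlist_vars s : tlist A (fun e => map e s).
Proof.
  exists (map (fun i e => e i) s). split.
  - apply Forall_map, Forall_forall. intros i _. apply (term_var A i).
  - intros e. rewrite map_map. reflexivity.
Qed.

Lemma tlist_nil : tlist A (fun _ => []).
Proof. exists []. auto. Qed.

Lemma tlist_cons t G : term A t -> tlist A G -> tlist A (fun e => t e :: G e).
Proof.
  intros Ht [ts [H1 H2]]. exists (t :: ts). split; [auto |].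
  intros e. simpl. rewrite H2. reflexivity.
Qed.

Lemma tlist_app G G' : tlist A G -> tlist A G' -> tlist A (fun e => G e ++ G' e).
Proof.
  intros [ts [H1 H2]] [ts' [H1' H2']]. exists (ts ++ ts'). split; [apply Forall_app; auto |].
  intros e. rewrite map_app, H2, H2'. reflexivity.
Qed.

Lemma tlist_firstn k G : tlist A G -> tlist A (fun e => firstn k (G e)).
Proof.
  intros [ts [H1 H2]]. exists (firstn k ts). split.
  - rewrite <- (firstn_skipn k ts) in H1. apply Forall_app in H1. apply H1.
  - intros e. rewrite H2, firstn_map. reflexivity.
Qed.

Lemma tlist_ren (r : nat -> nat) G : tlist A G -> tlist A (fun e => G (fun i => e (r i))).
Proof.
  intros [ts [H1 H2]]. exists (map (fun t e => t (fun i => e (r i))) ts). split.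
  - apply Forall_map. revert H1. apply Forall_impl. intros t Ht. apply (term_ren r Ht).
  - intros e. rewrite H2, map_map. reflexivity.
Qed.

Lemma term_nth j G d : A d -> tlist A G -> term A (fun e => nth j (G e) d).
Proof.
  intros Hd [ts [H1 H2]].
  replace (fun e => nth j (G e) d) with (nth j ts (fun _ => d)).
  - destruct (nth_in_or_default j ts (fun _ => d)) as [Hi | ->].
    + rewrite Forall_forall in H1. apply H1, Hi.
    + apply term_const, Hd.
  - apply functional_extensionality. intros e. rewrite H2.
    symmetry. exact (map_nth (fun t => t e) ts (fun _ => d) j).
Qed.

Lemma Def_In t G : term A t -> tlist A G -> Def E A (fun e => In (t e) (G e)).
Proof.
  intros Ht [ts [H1 H2]]. apply Def_ext with (fun e => In (t e) (map (fun u => u e) ts)).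
  - intros e. rewrite H2. reflexivity.
  - clear H2. induction H1 as [| u ts Hu _ IH]; simpl; [apply Def_false |].
    apply Def_or; [apply (Def_eq E Hu Ht) | exact IH].
Qed.

Lemma Def_NoDup G : tlist A G -> Def E A (fun e => NoDup (G e)).
Proof.
  intros [ts [H1 H2]]. apply Def_ext with (fun e => NoDup (map (fun u => u e) ts)).
  - intros e. rewrite H2. reflexivity.
  - clear H2. induction H1 as [| u ts Hu Hts IH]; simpl.
    + apply Def_ext with (fun _ => True); [| apply Def_true].
      intros e. split; [constructor | auto].
    + apply Def_ext with (fun e => ~ In (u e) (map (fun u => u e) ts) /\ NoDup (map (fun u => u e) ts)).
      * intros e. symmetry. apply NoDup_cons_iff.
      * apply Def_and; [apply Def_not, Def_In; [exact Hu | exists ts; auto] | exact IH].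
Qed.

(** Each quantifier of the block shifts the environment; the renaming [r] in the hypothesis absorbs
    these shifts. *)
Lemma Def_ex_list N : forall (Q : list U -> (nat -> U) -> Prop),
  (forall G r, tlist A G -> Def E A (fun e => Q (G e) (fun i => e (r i)))) ->
  Def E A (fun e => exists l, length l = N /\ Q l e).
Proof.
  induction N as [| N IH]; intros Q HQ.
  - apply Def_ext with (fun e => Q [] e).
    + intros e. split; [exists []; auto |]. intros [l [Hl H]]. destruct l; [exact H | discriminate].
    + apply (HQ (fun _ => []) (fun i => i)), tlist_nil.
  - apply Def_ext with (fun e => exists x l, length l = N /\ Q (x :: l) e).
    + intros e. split.
      * intros [x [l [Hl H]]]. exists (x :: l). simpl. auto.
      * intros [[| x l] [Hl H]]; [discriminate |]. injection Hl as Hl. exists x, l. auto.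
    + apply (@Def_ex _ _ _ (fun x e => exists l, length l = N /\ Q (x :: l) e)).
      apply (IH (fun l e => Q (e 0 :: l) (fun i => e (S i)))).
      intros G r HG. apply (HQ (fun e => e (r 0) :: G e) (fun i => r (S i))).
      apply tlist_cons; [apply (term_var A (r 0)) | exact HG].
Qed.

Lemma Def_all_list N (Q : list U -> (nat -> U) -> Prop) :
  (forall G r, tlist A G -> Def E A (fun e => Q (G e) (fun i => e (r i)))) ->
  Def E A (fun e => forall l, length l = N -> Q l e).
Proof.
  intros HQ. apply Def_ext with (fun e => ~ exists l, length l = N /\ ~ Q l e).
  - intros e. split.
    + intros H l Hl. apply NNPP. intros G. apply H. exists l. auto.
    + intros H [l [Hl G]]. apply G, H, Hl.
  - apply Def_not, Def_ex_list. intros G r HG. apply Def_not, HQ, HG.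
Qed.

Lemma Def_all_lt (k : nat) (P : nat -> (nat -> U) -> Prop) :
  (forall j, Def E A (P j)) -> Def E A (fun e => forall j, j < k -> P j e).
Proof.
  intros H. apply Def_ext with (fun e => ~ exists j, j < k /\ ~ P j e).
  - intros e. split.
    + intros G j Hj. apply NNPP. intros N. apply G. exists j. auto.
    + intros G [j [Hj N]]. apply N, G, Hj.
  - apply Def_not, Def_ex_lt. intros j. apply Def_not, H.
Qed.

Lemma Def_Forall (Q : U -> (nat -> U) -> Prop) G :
  Def E A (fun e => Q (e 0) (fun i => e (S i))) -> tlist A G ->
  Def E A (fun e => Forall (fun x => Q x e) (G e)).
Proof.
  intros HQ HG. apply Def_ext with (fun e => forall x, In x (G e) -> Q x e).
  - intros e. symmetry. apply Forall_forall.
  - dfn. apply Def_In; [apply (term_var A 0) | apply (tlist_ren S HG)].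
Qed.

End ListDef.

#[local] Hint Resolve tlist_nil tlist_vars tlist_cons tlist_app tlist_firstn tlist_ren
  Def_In Def_NoDup : dfn.

Lemma Def_n_subset A k t u : term A t -> term A u ->
  Def E A (fun e => n_subset E k (t e) (u e)).
Proof.
  intros Ht Hu. unfold n_subset. apply Def_and; [dfn |].
  apply Def_ext with (fun e => exists l, length l = k /\ (NoDup l /\ forall z, z ∈ u e <-> In z l)).
  - intros e. split; intros [l H]; exists l; tauto.
  - apply Def_ex_list with (Q := fun l e => NoDup l /\ forall z, z ∈ u e <-> In z l).
    intros G r HG. dfn.
Qed.
#[local] Hint Resolve Def_n_subset : dfn.

Definition set_of (x : U) (l : list U) : Prop := forall z, z ∈ x <-> In z l.

Lemma Def_set_of A t G : term A t -> tlist A G -> Def E A (fun e => set_of (t e) (G e)).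
Proof. intros. unfold set_of. dfn. Qed.
#[local] Hint Resolve Def_set_of : dfn.

(** * Counterexamples to ineffability in HOD *)

Definition HOD_stationary (a H : U) : Prop :=
  subset E H a /\ forall C, HOD E C -> club E a C -> exists z, z ∈ C /\ z ∈ H.

(** Stated in the universe with quantifiers bounded by HOD, instead of in the substructure, so that
    its definability over the universe is immediate. *)
Definition counterexample (a f : U) : Prop :=
  HOD E f /\ (forall x, n_subset E n a x -> exists! y, maps E f x y) /\
  forall H, HOD E H -> HOD_stationary a H -> ~ homogeneous E n f H.

Lemma Def_club A t u : term A t -> term A u -> Def E A (fun e => club E (t e) (u e)).
Proof. intros. unfold club. dfn. Qed.
#[local] Hint Resolve Def_club : dfn.

Lemma Def_counterexample A t u : term A t -> term A u ->
  Def E A (fun e => counterexample (t e) (u e)).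
Proof.
  intros. unfold counterexample, HOD_stationary, homogeneous, is_min. dfn.
Qed.
#[local] Hint Resolve Def_counterexample : dfn.

(** In the notation of the overview: xi belongs to f_a(s), where f_a is selected by means of the
    code [c] with [m] parameters. *)
Definition sel_val (m c a : U) (s : list U) (xi : U) : Prop :=
  exists f x y, selected m c (counterexample a) f /\ set_of x s /\ maps E f x y /\ xi ∈ y.

Lemma Def_sel_val A t u v G w : term A t -> term A u -> term A v -> tlist A G -> term A w ->
  Def E A (fun e => sel_val (t e) (u e) (v e) (G e) (w e)).
Proof.
  intros. unfold sel_val. dfn.
  apply Def_selected with (P := fun e => counterexample (v (fun i => e (S (S (S i)))))); auto 30 with dfn.
Qed.
#[local] Hint Resolve Def_sel_val : dfn.

(* C lists a_0 < ... < a_n.  Replacing the last argument al below a_0 by a_0, and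
   shifting the indices of the other a_i and of the function, does not change the
   value below the arguments.  The codes m and c are quantified in order that the
   set of the good al be definable from ordinals only. *)
Definition good (C : list U) (al : U) : Prop :=
  al ∈ nth 0 C emp /\
  forall j, j < n -> forall s, length s = n - S j -> forall m c xi,
    Forall (fun x => x ∈ al) s -> Forall (fun x => xi ∈ x) s -> xi ∈ al ->
    (sel_val m c (nth (S j) C emp) (s ++ firstn (S j) C) xi <->
     sel_val m c (nth j C emp) (s ++ al :: firstn j C) xi).

Lemma Def_good (A : U -> Prop) G t : A emp -> tlist A G -> term A t ->
  Def E A (fun e => good (G e) (t e)).
Proof.
  intros HA HG Ht. unfold good.
  assert (Hnth : forall j r, term A (fun e => nth j (G (fun i => e (r i))) emp)).
  { intros j r. apply (@term_nth A j (fun e => G (fun i => e (r i))) emp HA).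
    apply (tlist_ren r HG). }
  apply Def_and.
  - apply Def_mem; [exact Ht | exact (Hnth 0 (fun i => i))].
  - apply Def_all_lt. intros j.
    apply Def_all_list with (Q := fun s e => forall m c xi,
      Forall (fun x => x ∈ t e) s -> Forall (fun x => xi ∈ x) s -> xi ∈ t e ->
      (sel_val m c (nth (S j) (G e) emp) (s ++ firstn (S j) (G e)) xi <->
       sel_val m c (nth j (G e) emp) (s ++ t e :: firstn j (G e)) xi)).
    intros G' r HG'. cbv beta.
    dfn.
    + apply Def_Forall with (Q := fun x e => x ∈ t (fun i => e (S (S (S (r i)))))); [dfn |].
      apply (tlist_ren (fun i => S (S (S i))) HG').
    + apply Def_Forall with (Q := fun x e => e 0 ∈ x); [dfn |].
      apply (tlist_ren (fun i => S (S (S i))) HG').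
Qed.

(** * The set of good ordinals: kappa as an element, homogeneity, membership in HOD *)

Lemma R_emp (a : U) : R a -> emp ∈ V a.
Proof.
  intros Ra. destruct (R_limit Ra) as [[Oa _] Ho].
  apply (ordinal_V_iff Oa ordinal_emp), (ordinal_trans Oa (b := omega)); [| exact Ho].
  apply omega_iff, is_nat_emp.
Qed.

Lemma R_formula_code (a m c : U) : R a -> is_nat E m -> is_formula E 0 (succ m) c ->
  m ∈ V a /\ c ∈ V a.
Proof.
  intros Ra Hm Hc. destruct (R_limit Ra) as [[Oa _] Ho].
  split; apply (V_mono Oa Ho); [apply nat_in_V_omega, Hm | exact (is_formula_in_V_omega Hc)].
Qed.

Lemma mem_R_in_V (a x : U) : R a -> x ∈ a -> x ∈ V a.
Proof.
  intros Ra Hx. apply ordinal_V_iff; [exact (HA2 Ra) | exact (ordinal_mem (HA2 Ra) Hx) | exact Hx].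
Qed.

Lemma sel_val_formula m c a s xi : sel_val m c a s xi ->
  is_nat E m /\ is_formula E 0 (succ m) c.
Proof. intros [f [x [y [H _]]]]. exact (selected_formula H). Qed.

Lemma firstn_S_nth (C : list U) (j : nat) : j < length C ->
  firstn (S j) C = firstn j C ++ [nth j C emp].
Proof.
  revert j. induction C as [| c C IH]; intros j Hj; simpl in *; [lia |].
  destruct j as [| j]; [reflexivity |]. simpl. rewrite <- IH by lia. reflexivity.
Qed.

Lemma StronglySorted_firstn (C : list U) (j : nat) :
  StronglySorted E C -> StronglySorted E (firstn j C).
Proof.
  intros H. revert j. induction H as [| c C HC IH Hc]; intros [| j]; simpl; constructor; auto.
  rewrite Forall_forall in *. intros x Hx. apply Hc.
  rewrite <- (firstn_skipn j C). apply in_or_app. auto.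
Qed.

Lemma Forall_firstn (P : U -> Prop) (C : list U) (j : nat) : Forall P C -> Forall P (firstn j C).
Proof.
  intros H. rewrite <- (firstn_skipn j C) in H. apply Forall_app in H. apply H.
Qed.

(** The two sides of the condition of goodness at kappa are one and the same formula, evaluated at
    a_0, ..., a_(j+1) and at kappa, a_0, ..., a_j. These tuples are indiscernible over V_kappa,
    which contains [xi] and the entries of [s]. *)
Lemma good_kappa (k : U) (C : list U) : R k -> Forall (fun c => R c /\ k ∈ c) C ->
  StronglySorted E C -> length C = S n -> good C k.
Proof.
  intros Rk HC SC HlC. pose proof (HA2 Rk) as Ok.
  split.
  - rewrite Forall_forall in HC. apply HC, nth_In. lia.
  - intros j Hj s Hs m c xi Hsk _ Hxi.
    (* Genuine codes lie in [V k] and are admissible as parameters; for other [m] and [c] both sides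
       are false. *)
    assert (G : is_nat E m -> is_formula E 0 (succ m) c ->
      sel_val m c (nth (S j) C emp) (s ++ firstn (S j) C) xi <->
      sel_val m c (nth j C emp) (s ++ k :: firstn j C) xi).
    { intros Hm Hc. destruct (R_formula_code Rk Hm Hc) as [HmV HcV].
      set (P := fun T => sel_val m c (nth (S j) T emp) (s ++ firstn (S j) T) xi).
      assert (HP : P (firstn (S (S j)) C) <-> P (k :: firstn (S j) C)).
      { assert (Hl : length (firstn (S (S j)) C) = S (S j)) by (rewrite length_firstn; lia).
        assert (HC' : Forall (fun c => R c /\ (k = c \/ k ∈ c)) C).
        { revert HC. apply Forall_impl. tauto. }
        apply indiscernible with k; auto.
        - apply Forall_firstn, HC'.
        - constructor; [auto | apply Forall_firstn, HC'].
        - apply StronglySorted_firstn, SC.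
        - constructor; [apply StronglySorted_firstn, SC |].
          apply Forall_firstn. revert HC. apply Forall_impl. tauto.
        - rewrite Hl. change (S (S j) = S (length (firstn (S j) C))). rewrite length_firstn. lia.
        - rewrite Hl. lia.
        - rewrite Hl. unfold DefL, P.
          assert (HsV : tlist (fun x => x ∈ V k) (fun _ => s)).
          { apply tlist_const. revert Hsk. apply Forall_impl. intros x Hx.
            exact (mem_R_in_V Rk Hx). }
          assert (Hv : tlist (fun x => x ∈ V k) (fun e => map e (List.seq 0 (S (S j))))).
          { apply tlist_vars. }
          apply Def_sel_val.
          + apply term_const, HmV.
          + apply term_const, HcV.
          + apply (@term_nth _ (S j) _ emp (R_emp Rk) Hv).
          + apply tlist_app; [exact HsV | apply tlist_firstn, Hv].
          + apply term_const, (mem_R_in_V Rk Hxi). }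
      unfold P in HP. rewrite firstn_firstn, Nat.min_l in HP by lia.
      replace (nth (S j) (firstn (S (S j)) C) emp) with (nth (S j) C emp) in HP.
      - change (nth (S j) (k :: firstn (S j) C) emp) with (nth j (firstn (S j) C) emp) in HP.
        change (firstn (S j) (k :: firstn (S j) C)) with (k :: firstn j (firstn (S j) C)) in HP.
        rewrite firstn_firstn, Nat.min_l in HP by lia.
        rewrite HP. rewrite nth_firstn. destruct (Nat.ltb_spec j (S j)); [reflexivity | lia].
      - rewrite nth_firstn. destruct (Nat.ltb_spec (S j) (S (S j))); [reflexivity | lia]. }
    split; intros H; destruct (sel_val_formula H) as [Hm Hc]; apply (G Hm Hc), H.
Qed.

(** After j steps the j largest arguments have been replaced by a_0, ..., a_(j-1) and the function
    is the one selected at a_j. The next step is the goodness of the largest argument that remains,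
    with [s] the smaller ones. *)
Lemma good_chain (C A : list U) (m c xi : U) : length C = S n -> length A = n ->
  Forall (good C) A -> StronglySorted E A -> Forall (fun a => xi ∈ a) A ->
  sel_val m c (nth 0 C emp) A xi <-> sel_val m c (nth n C emp) (firstn n C) xi.
Proof.
  intros HC HA HgA SA Hxi.
  assert (G : forall j, j <= n -> sel_val m c (nth 0 C emp) A xi <->
    sel_val m c (nth j C emp) (firstn (n - j) A ++ firstn j C) xi).
  { induction j as [| j IH]; intros Hj.
    - rewrite Nat.sub_0_r, <- HA, firstn_all, app_nil_r. reflexivity.
    - rewrite IH by lia. set (al := nth (n - S j) A emp).
      assert (Hal : firstn (n - j) A = firstn (n - S j) A ++ [al]).
      { replace (n - j) with (S (n - S j)) by lia. apply firstn_S_nth. lia. }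
      rewrite Hal, <- app_assoc. simpl app.
      assert (Hin : In al A) by (apply nth_In; lia).
      rewrite Forall_forall in HgA, Hxi.
      destruct (HgA al Hin) as [_ Hg]. symmetry. apply Hg; auto.
      + rewrite length_firstn. lia.
      + apply Forall_forall. intros x Hx. apply (StronglySorted_last (firstn (n - S j) A)); [| exact Hx].
        rewrite <- Hal. apply StronglySorted_firstn, SA.
      + apply Forall_firstn, Forall_forall, Hxi. }
  rewrite (G n (le_n n)), Nat.sub_diag. reflexivity.
Qed.

Lemma sorted_insert (x : U) (A : list U) : ordinal E x -> Forall (ordinal E) A ->
  StronglySorted E A -> ~ In x A -> exists B, StronglySorted E B /\
  length B = S (length A) /\ forall z, In z B <-> z = x \/ In z A.
Proof.
  intros Ox OA SA Hx. induction SA as [| a A SA IH Ha].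
  - exists [x]. split; [repeat constructor |]. split; [reflexivity |].
    intros z. simpl. split; intros [-> | H]; auto.
  - apply Forall_cons_iff in OA as [Oa OA].
    destruct (ordinal_trichotomy Ox Oa) as [H | [H | H]].
    + exists (x :: a :: A). split; [| split; [reflexivity |]].
      * constructor; [constructor; assumption |]. constructor; [exact H |].
        rewrite Forall_forall in *. intros z Hz.
        exact (ordinal_trans (OA z Hz) H (Ha z Hz)).
      * intros z. simpl. split; intros [G | G]; auto.
    + subst. destruct Hx. left. reflexivity.
    + destruct IH as [B [H1 [H2 H3]]]; [exact OA | intros G; apply Hx; right; exact G |].
      exists (a :: B). split; [| split; [simpl; lia |]].
      * constructor; [exact H1 |]. rewrite Forall_forall in *. intros z Hz.
        apply H3 in Hz as [-> | Hz]; [exact H | exact (Ha z Hz)].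
      * intros z. simpl. rewrite H3. split; [intros [G | [G | G]] | intros [G | [G | G]]]; auto.
Qed.

Lemma sort_list (l : list U) : Forall (ordinal E) l -> NoDup l ->
  exists A, StronglySorted E A /\ length A = length l /\ forall z, In z A <-> In z l.
Proof.
  intros Ol Hl. induction Hl as [| x l Hx Hl IH].
  - exists []. split; [constructor |]. split; reflexivity.
  - apply Forall_cons_iff in Ol as [Ox Ol]. destruct (IH Ol) as [A [H1 [H2 H3]]].
    destruct (@sorted_insert x A) as [B [K1 [K2 K3]]]; auto.
    + rewrite Forall_forall in *. intros z Hz. apply Ol, H3, Hz.
    + rewrite H3. exact Hx.
    + exists B. split; [exact K1 |]. split; [simpl; lia |].
      intros z. rewrite K3, H3. simpl. split; intros [G | G]; auto.
Qed.

Lemma good_set (C : list U) : exists H, forall z, z ∈ H <-> good C z.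
Proof.
  destruct (@separation (good C)) with (x := nth 0 C emp) as [H HH].
  - apply Def_good; [exact I | | apply term_var].
    apply tlist_const, Forall_forall. intros; exact I.
  - exists H. intros z. rewrite HH. split; [tauto |]. intros Hz. split; [apply Hz | exact Hz].
Qed.

Lemma good_HOD (C : list U) (H : U) : Forall (ordinal E) C ->
  (forall z, z ∈ H <-> good C z) -> HOD E H.
Proof.
  intros OC HH.
  assert (O0 : ordinal E (nth 0 C emp)).
  { destruct (nth_in_or_default 0 C emp) as [Hi | ->]; [| apply ordinal_emp].
    rewrite Forall_forall in OC. apply OC, Hi. }
  apply HOD_set_of_ordinals.
  - apply (@OD_of_Def (fun y => forall z, z ∈ y <-> good C z)).
    + dfn. apply (@Def_good (ordinal E) (fun _ => C)); [apply ordinal_emp | | apply term_var].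
      apply tlist_const, OC.
    + intros y. split.
      * intros Hy. apply extensionality. intros z. rewrite Hy, HH. reflexivity.
      * intros -> z. apply HH.
  - intros a Ha. apply HH in Ha as [Ha _]. exact (ordinal_mem O0 Ha).
Qed.

(** Below the least argument, the value of [f] at any n-subset of [H] is that of the function
    selected at a_n, taken at a_0, ..., a_(n-1). This does not depend on the subset. *)
Lemma good_homogeneous (C : list U) (H m c f : U) : length C = S n -> Forall (ordinal E) C ->
  (forall z, z ∈ H <-> good C z) -> selected m c (counterexample (nth 0 C emp)) f ->
  homogeneous E n f H.
Proof.
  intros HlC OC HH Hf.
  assert (O0 : ordinal E (nth 0 C emp)).
  { rewrite Forall_forall in OC. apply OC, nth_In. lia. }
  destruct (selected_spec Hf) as [[_ [Hfun _]] _].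
  assert (G : forall x u m0, n_subset E n H x -> maps E f x u ->
    (forall z, z ∈ x -> m0 = z \/ m0 ∈ z) -> forall z, z ∈ m0 ->
    z ∈ u <-> sel_val m c (nth n C emp) (firstn n C) z).
  { intros x u m0 [HxH [l [Hl [Hln Hlx]]]] Hu Hm0 z Hz.
    assert (Ol : Forall (ordinal E) l).
    { apply Forall_forall. intros a Ha. apply Hlx, HxH, HH in Ha as [Ha _].
      exact (ordinal_mem O0 Ha). }
    destruct (sort_list Ol Hl) as [A [SA [HA1' HA2']]].
    assert (HgA : Forall (good C) A).
    { apply Forall_forall. intros a Ha. apply HH, HxH, Hlx, HA2', Ha. }
    assert (HzA : Forall (fun a => z ∈ a) A).
    { apply Forall_forall. intros a Ha. apply HA2' in Ha. pose proof Ha as Hax.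
      apply Hlx in Hax. destruct (Hm0 a Hax) as [-> | Hma]; [exact Hz |].
      rewrite Forall_forall in Ol. exact (ordinal_trans (Ol a Ha) Hz Hma). }
    rewrite <- (@good_chain C A m c z HlC); auto; [| lia].
    split.
    - intros Hzu. exists f, x, u. split; [exact Hf |]. split; [| auto].
      intros w. rewrite Hlx, HA2'. reflexivity.
    - intros [f' [x' [y [Hf' [Hx' [Hy Hzy]]]]]].
      rewrite (selected_unique Hf' Hf) in Hy.
      assert (x' = x) as ->.
      { apply extensionality. intros w. rewrite (Hx' w), HA2', Hlx. reflexivity. }
      assert (Hx : n_subset E n (nth 0 C emp) x).
      { split; [| exists l; auto]. intros w Hw. apply HxH, HH in Hw. apply Hw. }
      destruct (Hfun x Hx) as [y0 [_ Hy0]]. rewrite <- (Hy0 u Hu), (Hy0 y Hy). exact Hzy. }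
  intros x y u v m0 Hx Hy Hu Hv [_ Hmin] z.
  split; intros [Hz Hzm]; (split; [| exact Hzm]).
  - apply (G y v m0); auto. apply (G x u m0); auto.
  - apply (G x u m0); auto. apply (G y v m0); auto.
Qed.

(** * The contradiction from a counterexample *)

Definition good_club (C : list U) (D : U) : Prop :=
  HOD E D /\ club E (nth 0 C emp) D /\ forall z, z ∈ D -> ~ good C z.

Lemma Def_good_club (A : U -> Prop) G t : A emp -> tlist A G -> term A t ->
  Def E A (fun e => good_club (G e) (t e)).
Proof.
  intros HA HG Ht. unfold good_club.
  pose proof (@term_nth A 0 G emp HA HG) as H0.
  dfn. apply (@Def_good A (fun e => G (fun i => e (S i)))); [exact HA | | apply term_var].
  apply (tlist_ren S HG).
Qed.

Lemma no_counterexample (k f : U) : R k -> ~ counterexample k f.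
Proof.
  intros Rk Hf0. pose proof (HA2 Rk) as Ok.
  (* Unlike the ordinal parameters of a definition, its code belongs to [V k], so selection by a
     fixed code is subject to indiscernibility. *)
  assert (Sel : forall (P : U -> Prop) y, DEF (fun e => P (e 0)) -> P y -> HOD E y ->
    exists m c y', m ∈ V k /\ c ∈ V k /\ selected m c P y').
  { intros P y HP Py Hy. apply HOD_OD, OD_iff in Hy as [m [c [b [s Hd]]]].
    destruct (defines_formula Hd) as [Hm Hc]. destruct (R_formula_code Rk Hm Hc) as [HmV HcV].
    destruct (selected_exists P HP Hd Py) as [y' Hy']. exists m, c, y'. auto. }
  destruct (Sel (counterexample k) f) as [m [c [f1 [HmV [HcV Hf1]]]]];
    [dfn | exact Hf0 | apply Hf0 |].
  destruct (@R_extend (S n) [k]) as [M [HM [RM SM]]]; [auto | repeat constructor |].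
  simpl in SM. apply StronglySorted_inv in SM as [SM HkM].
  assert (HMk : Forall (fun c => R c /\ k ∈ c) M).
  { rewrite Forall_forall in *. auto. }
  (* With [M] listing a_0, ..., a_n, the tuple [C] is kappa, a_0, ..., a_(n-1). *)
  set (C := k :: firstn n M).
  assert (HlC : length C = S n) by (simpl; rewrite length_firstn; lia).
  assert (RC : Forall R C) by (constructor; [exact Rk | apply Forall_firstn, RM]).
  assert (SC : StronglySorted E C).
  { constructor; [apply StronglySorted_firstn, SM | apply Forall_firstn, HkM]. }
  assert (Ind : forall P, DefL (fun x => x ∈ V k) (S n) P -> P C <-> P M).
  { intros P HP. apply indiscernible with k; auto.
    - constructor; [auto |]. apply Forall_firstn. revert HMk. apply Forall_impl. tauto.
    - revert HMk. apply Forall_impl. tauto.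
    - lia.
    - lia.
    - rewrite HlC. exact HP. }
  destruct (good_set C) as [H HH].
  assert (HH_HOD : HOD E H).
  { apply good_HOD with C; [apply Forall_R_ordinal, RC | exact HH]. }
  assert (Hhom : homogeneous E n f1 H).
  { apply good_homogeneous with C m c; auto. apply Forall_R_ordinal, RC. }
  destruct (selected_spec Hf1) as [[_ [_ Hce]] _].
  assert (HD : exists D, good_club C D).
  { apply NNPP. intros N. apply (Hce H HH_HOD); [| exact Hhom]. split.
    - intros z Hz. apply HH in Hz. apply Hz.
    - intros D HD1 HD2. apply NNPP. intros N'. apply N. exists D.
      split; [exact HD1 |]. split; [exact HD2 |].
      intros z Hz Hg. apply N'. exists z. split; [exact Hz | apply HH, Hg]. }
  destruct HD as [D0 HD0].
  destruct (Sel (good_club C) D0) as [m' [c' [D1 [HmV' [HcV' HD1]]]]]; [| exact HD0 | apply HD0 |].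
  { apply (@Def_good_club _ (fun _ => C)); [exact I | | apply term_var].
    apply tlist_const, Forall_forall. intros; exact I. }
  pose proof (R_emp Rk) as Hemp.
  (* Variable 0 is reserved for the club; the tuple is read from the variables 1 to n + 1. *)
  assert (DefSel : forall t, term (fun x => x ∈ V k) t ->
    Def E (fun x => x ∈ V k) (fun e =>
      selected m' c' (good_club (map (fun i => e (S i)) (List.seq 0 (S n)))) (t e))).
  { intros t Ht.
    apply Def_selected with (P := fun e => good_club (map (fun i => e (S i)) (List.seq 0 (S n))));
      [| apply term_const; assumption | apply term_const; assumption | exact Ht].
    apply Def_good_club; [exact Hemp | | apply term_var].
    apply (tlist_ren (fun i => S (S i)) (tlist_vars _ (List.seq 0 (S n)))). }
  assert (Ex : exists D2, selected m' c' (good_club M) D2).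
  { apply (Ind (fun T => exists D, selected m' c' (good_club T) D)); [| exists D1; exact HD1].
    unfold DefL. apply (@Def_ex _ _ _ (fun D e => selected m' c' (good_club (map e (List.seq 0 (S n)))) D)).
    apply (DefSel (fun e => e 0)), term_var. }
  destruct Ex as [D2 HD2].
  (* Any [xi] below kappa is an admissible parameter, so its membership in the selected club
     transfers from the tuple [C] to the tuple [M]. *)
  assert (Hagree : forall xi, xi ∈ k -> xi ∈ D1 -> xi ∈ D2).
  { intros xi Hxi HxD1.
    assert (Q : exists D, selected m' c' (good_club M) D /\ xi ∈ D).
    { apply (Ind (fun T => exists D, selected m' c' (good_club T) D /\ xi ∈ D));
        [| exists D1; auto].
      unfold DefL. apply (@Def_ex _ _ _ (fun D e =>
        selected m' c' (good_club (map e (List.seq 0 (S n)))) D /\ xi ∈ D)).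
      apply Def_and; [apply (DefSel (fun e => e 0)), term_var |].
      apply Def_mem; [apply term_const, (mem_R_in_V Rk Hxi) | apply term_var]. }
    destruct Q as [D [HD HxD]]. rewrite (selected_unique HD2 HD). exact HxD. }
  destruct (selected_spec HD1) as [[_ [[_ [Hunb _]] _]] _].
  destruct (selected_spec HD2) as [[_ [[_ [_ Hclosed]] Hdisj]] _].
  (* [D1] is unbounded in kappa and included in [D2], so closure puts kappa into [D2]; but kappa is
     good for [M]. *)
  apply (Hdisj k).
  - apply Hclosed.
    + rewrite Forall_forall in HkM. apply HkM, nth_In. lia.
    + apply not_empty. exists emp. destruct (R_limit Rk) as [_ Ho].
      apply (ordinal_trans Ok (b := omega)); [apply omega_iff, is_nat_emp | exact Ho].
    + intros x Hx. destruct (Hunb x Hx) as [y [Hy Hxy]].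
      assert (Hyk : y ∈ k).
      { destruct (selected_spec HD1) as [[_ [[Hs _] _]] _]. exact (Hs y Hy). }
      exists y. split; [exact (Hagree y Hyk Hy) | auto].
  - apply good_kappa; auto.
Qed.

(** * Cardinality of kappa in HOD *)

Lemma no_HOD_surjection (k b g : U) : R k -> b ∈ k -> HOD E g ->
  is_fun E g (fun x => x ∈ b) (fun y => y ∈ k) ->
  ~ forall y, y ∈ k -> exists x, maps E g x y.
Proof.
  intros Rk Hb Hg Hfun Hsurj. pose proof (HA2 Rk) as Ok.
  set (P := fun a g => HOD E g /\ is_fun E g (fun x => x ∈ b) (fun y => y ∈ a) /\
    forall y, y ∈ a -> exists x, maps E g x y).
  assert (HP : forall A t u, A b -> term A t -> term A u -> Def E A (fun e => P (t e) (u e))).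
  { intros A t u HA Ht Hu. unfold P. dfn. }
  pose proof (HOD_OD Hg) as Hod. apply OD_iff in Hod as [m [c [d [s Hd]]]].
  destruct (defines_formula Hd) as [Hm Hc]. destruct (R_formula_code Rk Hm Hc) as [HmV HcV].
  destruct (@selected_exists m c d s g (P k)) as [g1 Hg1].
  { apply (HP _ (fun _ => k) (fun e => e 0)); [exact I | apply term_const; exact I | apply term_var]. }
  { exact Hd. }
  { split; [exact Hg | auto]. }
  destruct (R_unbounded Ok) as [a [Ra Hka]].
  assert (Hbv : b ∈ V k) by exact (mem_R_in_V Rk Hb).
  assert (DefSel : Def E (fun x => x ∈ V k) (fun e => selected m c (P (e 1)) (e 0))).
  { apply Def_selected with (P := fun e => P (e 1));
      [| apply term_const; assumption | apply term_const; assumption | apply term_var].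
    apply (HP _ (fun e => e 2) (fun e => e 0)); [exact Hbv | apply term_var | apply term_var]. }
  assert (Ind : forall Q, Def E (fun x => x ∈ V k) (fun e => Q (e 0)) -> Q k -> Q a).
  { intros Q HQ Qk. apply (@indiscernible k [k] [a] (fun T => Q (nth 0 T emp)));
      [exact Rk | auto | auto | repeat constructor | repeat constructor | reflexivity
      | simpl; lia | exact HQ | exact Qk]. }
  assert (Ex : exists g2, selected m c (P a) g2).
  { apply (Ind (fun a => exists g, selected m c (P a) g)); [| exists g1; exact Hg1].
    apply Def_ex. exact DefSel. }
  destruct Ex as [g2 Hg2].
  destruct (selected_spec Hg1) as [[_ [F1 _]] _]. destruct (selected_spec Hg2) as [[_ [F2 S2]] _].
  apply is_fun_iff in F1 as [F1 [F1' _]]. apply is_fun_iff in F2 as [F2 [_ F2']].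
  (* Let the surjection onto [a] send x to kappa, and the one onto kappa send x to y. Both x and y
     are below kappa, hence admissible parameters, so the surjection onto [a] sends x to y as well.
     But y < kappa. *)
  destruct (S2 k Hka) as [x Hx]. apply maps_iff in Hx.
  assert (Hxb : x ∈ b).
  { destruct (F2 _ Hx) as [x' [y' [Hxb [_ Hp]]]]. apply pair_inj in Hp as [-> _]. exact Hxb. }
  destruct (F1' x Hxb) as [y Hy].
  assert (Hyk : y ∈ k).
  { destruct (F1 _ Hy) as [x' [y' [_ [Hyk Hp]]]]. apply pair_inj in Hp as [_ ->]. exact Hyk. }
  assert (Hy2 : exists g, selected m c (P a) g /\ pair x y ∈ g).
  { apply (Ind (fun a => exists g, selected m c (P a) g /\ pair x y ∈ g)); [| exists g1; auto].
    apply Def_ex. apply Def_and; [exact DefSel |].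
    assert (Hxk : x ∈ k) by exact (ordinal_trans Ok Hxb Hb).
    apply (@Def_pair_mem _ (fun e => e 0) (fun _ => x) (fun _ => y));
      [apply term_var | |]; apply term_const; apply (mem_R_in_V Rk); assumption. }
  destruct Hy2 as [g3 [Hg3 Hy3]]. rewrite (selected_unique Hg3 Hg2) in Hy3.
  rewrite (F2' x y k Hy3 Hx) in Hyk. exact (foundation_irrefl Hyk).
Qed.

(** * Absoluteness for HOD *)

Local Notation W := {x : U | HOD E x}.
Local Notation E' := (restrict E (HOD E)).
Local Notation "! x" := (proj1_sig x) (at level 1, format "! x").

Lemma W_eq (x y : W) : !x = !y -> x = y.
Proof.
  destruct x as [x Hx], y as [y Hy]. simpl. intros ->. f_equal. apply proof_irrelevance.
Qed.

(** HOD is transitive; the absoluteness of the bounded notions below rests on this. *)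
Lemma W_mem (x : W) (z : U) : z ∈ !x -> exists w : W, !w = z /\ E' w x.
Proof.
  intros Hz. exists (exist (HOD E) z (HOD_mem (proj2_sig x) Hz)). split; [reflexivity | exact Hz].
Qed.

Lemma W_subset (x y : W) : subset E' x y <-> subset E !x !y.
Proof.
  split.
  - intros H z Hz. destruct (W_mem x Hz) as [w [<- Hw]]. exact (H w Hw).
  - intros H z Hz. exact (H !z Hz).
Qed.

Lemma W_is_upair (p x y : W) : is_upair E' p x y <-> is_upair E !p !x !y.
Proof.
  split; intros H z.
  - split.
    + intros Hz. destruct (W_mem p Hz) as [w [<- Hw]]. apply H in Hw as [-> | ->]; auto.
    + intros [-> | ->]; apply H; auto.
  - unfold restrict. rewrite (H !z). split; (intros [G | G]; [left | right]);
      try (apply W_eq; exact G); rewrite G; reflexivity.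
Qed.

Lemma W_is_pair (p x y : W) : is_pair E' p x y <-> is_pair E !p !x !y.
Proof.
  split.
  - intros [u [v [H1 [H2 H3]]]]. exists !u, !v. rewrite <- !W_is_upair. auto.
  - intros [u [v [H1 [H2 H3]]]].
    destruct (@W_mem p u) as [u' [<- _]]; [apply H3; auto |].
    destruct (@W_mem p v) as [v' [<- _]]; [apply H3; auto |].
    exists u', v'. rewrite !W_is_upair. auto.
Qed.

Lemma W_maps (f x y : W) : maps E' f x y <-> maps E !f !x !y.
Proof.
  split.
  - intros [p [H1 H2]]. exists !p. rewrite <- W_is_pair. auto.
  - intros [p [H1 H2]]. destruct (W_mem f H2) as [q [<- Hq]]. exists q.
    rewrite W_is_pair. auto.
Qed.

Lemma HOD_of_maps (f x y : U) : HOD E f -> maps E f x y -> HOD E x /\ HOD E y.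
Proof.
  intros Hf H. apply maps_iff in H. pose proof (HOD_mem Hf H) as Hp.
  assert (Hu : HOD E (upair x y)) by (apply (HOD_mem Hp), upair_iff; auto).
  split; apply (HOD_mem Hu), upair_iff; auto.
Qed.

Lemma W_list (l : list U) : Forall (HOD E) l -> exists l' : list W, map (@proj1_sig U _) l' = l.
Proof.
  intros H. induction H as [| x l Hx _ [l' <-]]; [exists []; reflexivity |].
  exists (exist (HOD E) x Hx :: l'). reflexivity.
Qed.

(** The enumeration of an n-subset is an external list, so it can be carried into HOD and back entry
    by entry. *)
Lemma W_n_subset (k : nat) (a x : W) : n_subset E' k a x <-> n_subset E k !a !x.
Proof.
  unfold n_subset. rewrite W_subset. apply and_iff_compat_l. split.
  - intros [l [H1 [H2 H3]]]. exists (map (@proj1_sig U _) l). split; [| split].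
    + apply NoDup_map_NoDup_ForallPairs; [| exact H1]. intros u v _ _. apply W_eq.
    + rewrite length_map. exact H2.
    + intros z. split.
      * intros Hz. destruct (W_mem x Hz) as [w [<- Hw]]. apply in_map, H3, Hw.
      * intros Hz. apply in_map_iff in Hz as [w [<- Hw]]. apply H3 in Hw. exact Hw.
  - intros [l [H1 [H2 H3]]]. destruct (@W_list l) as [l' <-].
    { apply Forall_forall. intros z Hz. apply H3 in Hz. exact (HOD_mem (proj2_sig x) Hz). }
    exists l'. split; [exact (NoDup_map_inv _ _ H1) |].
    split; [rewrite length_map in H2; exact H2 |].
    intros z. unfold restrict. rewrite (H3 !z), in_map_iff. split.
    + intros [w [Hw Hin]]. apply W_eq in Hw as <-. exact Hin.
    + intros Hin. exists z. auto.
Qed.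

Lemma W_ordinal (a : W) : ordinal E !a -> ordinal E' a.
Proof.
  intros Ha. split; [| split].
  - intros y Hy z Hz. exact (ordinal_trans Ha Hz Hy).
  - intros x y Hx Hy.
    destruct (ordinal_trichotomy (ordinal_mem Ha Hx) (ordinal_mem Ha Hy)) as [H | [H | H]]; auto.
    apply W_eq in H. auto.
  - intros s _ Hs. destruct (zfc_foundation HZ (x := !s)) as [m [Hm Hmin]].
    + intros G. apply Hs. intros z. apply (G !z).
    + destruct (W_mem s Hm) as [w [<- Hw]]. exists w. split; [exact Hw |].
      intros z Hz. exact (Hmin !z Hz).
Qed.

(** A club in the sense of HOD is one in the universe, so a set that meets every true club belonging
    to HOD is stationary in HOD. *)
Lemma W_club (a C : W) : club E' a C -> club E !a !C.
Proof.
  intros [H1 [H2 H3]]. split; [apply W_subset, H1 | split].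
  - intros x Hx. destruct (W_mem a Hx) as [w [<- Hw]].
    destruct (H2 w Hw) as [y [Hy Hwy]]. exists !y. auto.
  - intros l Hl Hne Hlim. destruct (W_mem a Hl) as [w [<- Hw]]. apply (H3 w Hw).
    + intros G. apply Hne. intros z Hz. destruct (W_mem w Hz) as [v [<- Hv]]. exact (G v Hv).
    + intros x Hx. destruct (Hlim !x Hx) as [y [Hy [Hyw Hxy]]].
      destruct (W_mem C Hy) as [v [<- Hv]]. exists v. auto.
Qed.

Lemma W_homogeneous (k : nat) (f H : W) : homogeneous E k !f !H -> homogeneous E' k f H.
Proof.
  intros G x y u v m Hx Hy Hu Hv [Hm Hmin] z.
  apply (G !x !y !u !v !m); [apply W_n_subset, Hx | apply W_n_subset, Hy |
    apply W_maps, Hu | apply W_maps, Hv |].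
  split; [exact Hm |]. intros w Hw.
  assert (Hw' : exists w' : W, !w' = w /\ (E' w' x \/ E' w' y)).
  { destruct Hw as [Hw | Hw]; [destruct (W_mem x Hw) as [w' [K1 K2]] |
      destruct (W_mem y Hw) as [w' [K1 K2]]]; exists w'; auto. }
  destruct Hw' as [w' [<- Hw']]. destruct (Hmin w' Hw') as [-> | K]; auto.
Qed.

(** A finite set of ordinals is definable from its elements. Hence a function that is total on the
    n-subsets in HOD is total on all n-subsets. *)
Lemma HOD_n_subset (k : nat) (a x : U) : ordinal E a -> n_subset E k a x -> HOD E x.
Proof.
  intros Oa [Hs [l [_ [_ Hl]]]]. apply HOD_set_of_ordinals.
  - apply (@OD_of_Def (fun y => set_of y l)).
    + apply (@Def_set_of _ (fun e => e 0) (fun _ => l)); [apply term_var |].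
      apply tlist_const, Forall_forall. intros z Hz. apply Hl, Hs in Hz.
      exact (ordinal_mem Oa Hz).
    + intros y. split.
      * intros Hy. apply extensionality. intros z. rewrite (Hy z), Hl. reflexivity.
      * intros ->. exact Hl.
  - intros z Hz. exact (ordinal_mem Oa (Hs z Hz)).
Qed.

Lemma ineffable_in_HOD (k : W) : R !k -> ineffable E' n k.
Proof.
  intros Rk. pose proof (HA2 Rk) as Ok. split; [split |].
  - apply W_ordinal, Ok.
  - intros [b [f [Hb [[F1 F2] [_ Hs]]]]].
    apply (@no_HOD_surjection !k !b !f Rk Hb (proj2_sig f)).
    + split.
      * intros p Hp. destruct (W_mem f Hp) as [q [<- Hq]].
        destruct (F1 q Hq) as [x [y [Hx [Hy Hxy]]]]. exists !x, !y.
        rewrite <- W_is_pair. auto.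
      * intros x Hx. destruct (W_mem b Hx) as [x' [<- Hx']].
        destruct (F2 x' Hx') as [y [Hy Huniq]]. exists !y. split; [apply W_maps, Hy |].
        intros z Hz. destruct (HOD_of_maps (proj2_sig f) Hz) as [_ Oz].
        rewrite (Huniq (exist (HOD E) z Oz)); [reflexivity |]. apply W_maps, Hz.
    + intros y Hy. destruct (W_mem k Hy) as [y' [<- Hy']].
      destruct (Hs y' Hy') as [x Hx]. exists !x. apply W_maps, Hx.
  - intros f [[F1 F2] _]. apply NNPP. intros N.
    apply (@no_counterexample !k !f Rk). split; [exact (proj2_sig f) | split].
    + intros x Hx. pose proof (HOD_n_subset Ok Hx) as Hox.
      destruct (F2 (exist (HOD E) x Hox)) as [y [Hy Huniq]].
      { apply W_n_subset, Hx. }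
      exists !y. split; [apply W_maps in Hy; exact Hy |].
      intros z Hz. destruct (HOD_of_maps (proj2_sig f) Hz) as [_ Oz].
      rewrite (Huniq (exist (HOD E) z Oz)); [reflexivity |]. apply W_maps, Hz.
    + intros H HH [S1 S2] Hhom. apply N. exists (exist (HOD E) H HH). split.
      * split; [apply W_subset, S1 |]. intros C HC.
        destruct (S2 !C (proj2_sig C) (W_club HC)) as [z [Hz1 Hz2]].
        destruct (W_mem C Hz1) as [w [<- Hw]]. exists w. auto.
      * apply W_homogeneous, Hhom.
Qed.

End Reflection.

End Universe.

Theorem theorem7 (n : nat) (U : Type) (E : U -> U -> Prop) (R : U -> Prop) :
  1 <= n ->
  weakly_reflective_theory E R (n + 1) ->
  forall kappa : U, R kappa ->
    exists h : HOD E kappa,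
      ineffable (restrict E (HOD E)) n (exist (HOD E) kappa h).
Proof.
  intros _ [HZ H1 H2 H4 H7] kappa Hk.
  assert (h : HOD E kappa) by (eapply HOD_ordinal; eauto).
  exists h. eapply ineffable_in_HOD; eauto.
Qed.
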